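(* Let $(\Omega,\mathcal F,\mu,T)$ be a probability preserving dynamical system, let $f:\Omega\to[0,+\infty)$ be a measurable function, let $(h_\varepsilon)_{\varepsilon>0}$ be positive numbers and let $\mathbb P$ be a probability measure on $(\Omega,\mathcal F)$. Assume that the family of point processes $(\mathcal N_\varepsilon)_{\varepsilon>0}$ on $[0,+\infty)\times[0,1]$ given by $$\mathcal N_\varepsilon(x)=\sum_{n\ge1:\ f(T^n(x))>\varepsilon^{-1}}\delta_{\left(nh_\varepsilon,\ \frac1{\varepsilon f(T^n(x))}\right)}$$ converges in distribution with respect to $\mathbb P$, as $\varepsilon\to0$, to a Poisson point process of intensity $\lambda\times m$, where $m$ is a probability measure on $[0,1]$ without any atom. Then the family of high records point processes $(\mathcal R_f(h_\varepsilon,\varepsilon^{-1}))_{\varepsilon>0}$ converges in distribution with respect to $\mathbb P$, as $\varepsilon\to0$, to the point process $$\mathcal R=\sum_{\ell=1}^\infty Z_\ell\,\delta_{T_\ell},\qquad T_\ell=\sum_{i=1}^\ell X_i,$$ where the $X_i$ are independent standard exponential random variables, the $Z_\ell$ are independent Bernoulli random variables with respective parameters $\ell^{-1}$, and the two sequences $(X_i)_i$ and $(Z_\ell)_\ell$ are independent.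
   Context: For $u>0$ and $\ell\ge 0$, the high records point process of $f$ is the point process on $[0,+\infty)$ $$\mathcal R_f(u,\ell)=\sum_{k=1}^\infty\mathbf 1_{\{f\circ T^k>\max(\ell,\,f,\,f\circ T,\dots,f\circ T^{k-1})\}}\,\delta_{ku}.$$ $\lambda$ is the Lebesgue measure on $[0,+\infty)$. A Poisson point process of intensity $\eta$ on a space $E$ is a point process whose counts on pairwise disjoint Borel sets $B_1,\dots,B_n$ are independent Poisson variables with parameters $\eta(B_i)$. Convergence in distribution of point processes on $E$ is convergence in distribution in the space $M_p(E)$ of point measures on $E$ endowed with the topology of vague convergence. *)

(* Defs.v *)
From HB Require Import structures.
From mathcomp Require Import all_boot all_order all_algebra finmap.
From mathcomp Require Import all_classical all_reals all_analysis.
From mathcomp Require Import measurable_realfun.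

Set Implicit Arguments.
Unset Strict Implicit.
Unset Printing Implicit Defensive.

Import Order.TTheory GRing.Theory Num.Theory.
Import numFieldNormedType.Exports.

Local Open Scope classical_set_scope.
Local Open Scope ring_scope.

HB.instance Definition _ (S1 S2 : ptopologicalType) :=
  Pointed.on (S1 * S2)%type.

Definition borel (S : ptopologicalType) := g_sigma_algebraType (@open S).

(* A space E is given as a closed subset D of an ambient locally compact
   second-countable space S: a measure on E is a measure on S carried by D. *)
Section point_measures.
Context {R : realType} {S : ptopologicalType}.
Implicit Types (D : set S) (b : pred nat) (x : nat -> S).

Definition atom (c : bool) (y : S) : {measure set (borel S) -> \bar R} :=
  if c then (\d_(y : borel S) : {measure set (borel S) -> \bar R}) else mzero.

(* The sum of the Dirac masses at the points x n over the n such that b n;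
   the mask b covers both finite and infinite sums. *)
Definition point_sum b x : {measure set (borel S) -> \bar R} :=
  mseries (fun n => atom (b n) (x n)) 0.

Definition is_point_measure D (nu : {measure set (borel S) -> \bar R}) :=
  (exists b x, (forall n, b n -> D (x n)) /\
     (nu = point_sum b x :> (set S -> \bar R))) /\
  (forall K : set S, K `<=` D -> compact K -> (nu K < +oo)%E).

(* M_p(E) *)
Record point_measure D := PointMeasure {
  pm_measure :> {measure set (borel S) -> \bar R} ;
  pm_axiom : is_point_measure D pm_measure }.

Lemma is_point_measure0 D : is_point_measure D mzero.
Proof.
split=> [|K _ _]; last by rewrite /mzero ltry.
exists (fun=> false), (fun=> point); split=> //.
apply/funext => A; rewrite /= /point_sum /mseries eseries0//.
Qed.

Definition zero_point_measure D := PointMeasure (is_point_measure0 D).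

HB.instance Definition _ D := gen_eqMixin (point_measure D).
HB.instance Definition _ D := gen_choiceMixin (point_measure D).
HB.instance Definition _ D :=
  isPointed.Build (point_measure D) (zero_point_measure D).

(* C_K^+(E) *)
Record test_function D := TestFunction {
  tf_fun :> S -> R ;
  tf_ge0 : forall y, D y -> 0 <= tf_fun y ;
  tf_continuous : {within D, continuous tf_fun} ;
  tf_support : exists K : set S,
    [/\ K `<=` D, compact K & forall y, D y -> ~ K y -> tf_fun y = 0] }.

Definition test_integrals D (nu : point_measure D) :
    {ptws test_function D -> R^o} :=
  fun phi => (\int[pm_measure nu]_(y in D) phi y)%R.

(* The vague topology on M_p(E): the coarsest one making all the maps
   nu |-> \int phi dnu continuous. *)
HB.instance Definition _ D :=
  Topological.copy (point_measure D) (initial_topology (@test_integrals D)).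

Lemma is_point_measure_sum D b x :
  (forall n, b n -> D (x n)) ->
  (forall K : set S, K `<=` D -> compact K ->
     exists n0, forall n, b n -> K (x n) -> (n < n0)%N) ->
  is_point_measure D (point_sum b x).
Proof.
move=> bD fin; split; first by exists b, x.
move=> K KD cK; have [n0 Kn0] := fin K KD cK.
rewrite /point_sum /= /mseries (@nneseries_split _ _ 0%N n0) => [|k _]; last first.
  exact: measure_ge0.
rewrite [X in (_ + X)%E]eseries0 ?adde0; last first.
  move=> n; rewrite /= add0n => n0n _; rewrite /atom; case: ifPn => //= bn.
  rewrite diracE; case: (boolP (x n \in K)) => // /set_mem /(Kn0 _ bn).
  by rewrite ltnNge n0n.
apply/lte_sum_pinfty => n _; rewrite /atom; case: ifPn => _.
  by rewrite /= diracE ltry.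
by rewrite /mzero ltry.
Qed.

(* The element of M_p(E) with underlying measure nu; the zero measure is a
   default value for the measures that are not in M_p(E). *)
Definition to_point_measure D (nu : {measure set (borel S) -> \bar R}) :
    point_measure D :=
  if pselect (is_point_measure D nu) is left nuP then PointMeasure nuP
  else zero_point_measure D.

End point_measures.
Arguments point_measure {R S} D.

Section probability.
Context {R : realType}.

Definition measure_preserving d (Omega : measurableType d)
    (mu : probability Omega R) (T : Omega -> Omega) :=
  measurable_fun setT T /\ forall A, measurable A -> mu (T @^-1` A) = mu A.

Definition mutually_independent d (Omega : measurableType d)
    (P : probability Omega R) (I : choiceType)
    d' (S : measurableType d') (X : I -> Omega -> S) :=
  forall (J : {fset I}) (A : I -> set S),
    (forall i, i \in J -> measurable (A i)) ->
    P (\bigcap_(i in [set` J]) (X i @^-1` A i)) =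
    (\prod_(i <- J) P (X i @^-1` A i))%E.

(* The sigma-algebra generated by a family of random variables. *)
Definition sigma_generated (Omega : Type) (I : Type)
    d' (S : measurableType d') (X : I -> Omega -> S) : set (set Omega) :=
  <<s \bigcup_i preimage_set_system setT (X i) measurable >>.

Definition independent_families d (Omega : measurableType d)
    (P : probability Omega R) (I1 I2 : Type)
    d1 (S1 : measurableType d1) (X : I1 -> Omega -> S1)
    d2 (S2 : measurableType d2) (Y : I2 -> Omega -> S2) :=
  forall A B, sigma_generated X A -> sigma_generated Y B ->
    P (A `&` B) = (P A * P B)%E.

(* Poisson law of parameter a in [0, +oo]; that of parameter +oo is the Dirac
   mass at +oo. The second argument of poisson_prob is a dummy; poisson_prob 0
   is the Dirac mass at 0. *)
Definition poisson_distributed d (Omega : measurableType d)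
    (P : probability Omega R) (Y : Omega -> \bar R) (a : \bar R) :=
  match a with
  | r%:E => 0 <= r /\
      forall k : nat, P [set w | Y w = (k%:R)%:E] = poisson_prob r 0 [set k]
  | +oo%E => P [set w | Y w = +oo%E] = 1%E
  | -oo%E => False
  end.

Definition poisson_point_process d (Omega : measurableType d)
    (P : probability Omega R) (S : ptopologicalType) (D : set S)
    (N : Omega -> point_measure (R := R) D) (eta : set S -> \bar R) :=
  measurable_fun setT (N : Omega -> borel (point_measure (R := R) D)) /\
  forall n (B : 'I_n -> set S),
    (forall i, (measurable (B i : set (borel S))) /\ B i `<=` D) ->
    trivIset setT B ->
    mutually_independent P (fun i w => N w (B i)) /\
    forall i, poisson_distributed P (fun w => N w (B i)) (eta (B i)).

Definition cvg_in_distribution d (Omega : measurableType d)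
    (P : probability Omega R) (I : Type) (S : topologicalType)
    (X : I -> Omega -> S) (F : set_system I)
    d' (Omega' : measurableType d') (P' : probability Omega' R)
    (Y : Omega' -> S) :=
  forall G : S -> R, continuous G -> (exists M : R, forall s, `|G s| <= M) ->
    'E_P[G \o X i]%E @[i --> F] --> 'E_P'[G \o Y]%E.

End probability.

Section processes.
Context {R : realType}.

Definition halfline : set R := `[0, +oo[.
Definition strip : set (R * R) := `[0, +oo[ `*` `[0, 1].

Section dynamics.
Context {Omega : Type} (T : Omega -> Omega) (f : Omega -> R).

Definition exceedance_measure (e u : R) (x : Omega) :=
  point_sum (R := R)
    (fun n => (0 < n)%N && (e^-1 < f (iter n T x)))
    (fun n => (n%:R * u, (e * f (iter n T x))^-1) : R * R).

Definition exceedance_process (e u : R) (x : Omega) :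
  point_measure (R := R) strip := to_point_measure strip (exceedance_measure e u x).

Definition record_measure (u l : R) (x : Omega) :=
  point_sum (R := R)
    (fun k => (0 < k)%N &&
       (\big[Num.max/l]_(0 <= j < k) f (iter j T x) < f (iter k T x)))
    (fun k => k%:R * u : R).

Definition record_process (u l : R) (x : Omega) :
  point_measure (R := R) halfline := to_point_measure halfline (record_measure u l x).

Lemma bounded_multiples (u M : R) : 0 < u ->
  exists n0, forall n : nat, n%:R * u <= M -> (n < n0)%N.
Proof.
move=> u0; exists (Num.truncn (M / u)).+1 => n.
rewrite -ler_pdivlMr // => nM; rewrite -(ltr_nat R).
exact: le_lt_trans nM (truncnS_gt _).
Qed.

(* For positive e and u, to_point_measure never returns its default value. *)
Lemma exceedance_measureP (e u : R) (x : Omega) : 0 < e -> 0 < u ->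
  is_point_measure strip (exceedance_measure e u x).
Proof.
move=> e0 u0; apply: is_point_measure_sum => [n /andP[_ fn]|K _ cK].
  have ef : 1 < e * f (iter n T x) by rewrite -ltr_pdivrMl // mulr1.
  have ef0 := lt_trans ltr01 ef.
  split; rewrite /= in_itv /=; first by rewrite andbT mulr_ge0 // ltW.
  by rewrite invr_ge0 (ltW ef0) invf_le1 // ltW.
have [M [_ /(_ (M + 1))]] := compact_bounded cK.
rewrite ltrDl ltr01 => /(_ isT) KM.
have [n0 n0P] := bounded_multiples (M + 1) u0.
exists n0 => n _ /KM nM; apply: n0P; apply: le_trans nM.
by rewrite (le_trans (ler_norm _)) // /Num.norm /= le_max lexx.
Qed.

Lemma record_measureP (u l : R) (x : Omega) : 0 < u ->
  is_point_measure halfline (record_measure u l x).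
Proof.
move=> u0; apply: is_point_measure_sum => [n _|K _ cK].
  by rewrite /halfline /= in_itv /= andbT mulr_ge0 // ltW.
have [M [_ /(_ (M + 1))]] := compact_bounded cK.
rewrite ltrDl ltr01 => /(_ isT) KM.
have [n0 n0P] := bounded_multiples (M + 1) u0.
by exists n0 => n _ /KM nM; apply: n0P; rewrite (le_trans (ler_norm _)).
Qed.

End dynamics.

(* Indices start at 0: X i and Z l are the X_(i+1) and Z_(l+1) of the series
   sum_(l >= 1) Z_l delta_(T_l), so that T_(l+1) = sum_(i < l.+1) X i.
   The value outside M_p([0, +oo[) is irrelevant when the X i are independent
   standard exponential variables, as T_l then tends to +oo almost surely. *)
Definition limit_process {Omega : Type} (X : nat -> Omega -> R)
    (Z : nat -> Omega -> bool) (w : Omega) : point_measure (R := R) halfline :=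
  to_point_measure halfline
    (point_sum (fun l => Z l w) (fun l => \sum_(i < l.+1) X i w : R)).

End processes.

(* Main.v *)
Require Import Defs.
From HB Require Import structures.
From mathcomp Require Import all_boot all_order all_algebra finmap.
From mathcomp Require Import all_classical all_reals all_analysis.
From mathcomp Require Import measurable_realfun.
From mathcomp Require Import zify ring lra.

(** The atoms of the exceedance process at [x] are the times [n h] and the
    marks [1 / (e f (T^n x))] of the values of [f] above [1 / e]. As soon as
    [f x <= 1 / e], which fails with a probability that tends to 0, the high
    records are the times of the atoms whose mark is smaller than all earlier
    ones. In a Poisson process of intensity [lambda x m] the successive times
    are separated by independent exponential gaps, and the marks are
    independent with a common atomless law, so that by Renyi the [l]-th mark is
    a strict running minimum with probability [1 / l], independently for
    distinct [l]. The record process of the limit is thus the announced one.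
    This is made rigorous without any continuous mapping theorem, by lower
    bounds alone.

    It suffices to show that the liminf of the expectations of [G] of the
    record processes is at least the expectation of [G] of the limit, for every
    continuous [G] with values in [[0, C]]: applied to [C - G], this lower
    bound becomes the missing upper bound ([record_integral_cvg]). Since lower
    bounds are all that is needed, the expectations may be handled as lower
    integrals, which are monotone and superadditive on all bounded nonnegative
    functions of the record processes, measurable or not.

    For the lower bound ([record_liminf]), a time window [[0, L delta]] is cut
    into [L] columns of width [delta], and the interval of marks into [q]
    levels of [m]-mass [1 / q]. A word chooses in each column either no level
    or one level. That a configuration charges exactly the cells named by a
    word with [n] occupied columns is implied by finitely many strict
    inequalities between masses, hence is bounded from below by continuous
    weights for the vague topology, and it has probability
    [(delta / q)^n exp (- L delta)] for the Poisson process
    ([pattern_weight_expectation]). When the levels are distinct, the word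
    determines the columns of the records ([record_process_pattern]), so that
    [G] of the record process is at least the infimum of [G] over the point
    measures with this pattern of records ([grid_lower_bound]).

    There remains to compare the two laws on patterns. Counting the words with
    a given pattern of records gives exactly the Bernoulli weights of
    parameters [1 / l], up to a factor [1 - L^2 / q] due to coinciding levels
    ([word_countE], [record_pattern_weight]). On the side of the limit process,
    rounding the gaps up to multiples of [delta] produces each pattern with at
    least the same probability ([scan_expectation]), and these probabilities
    add up to [exp (- L delta) (1 + delta)^L], which is close to [1] when
    [L delta^2] is small. Finally, when [delta] tends to 0 and [L delta] to
    infinity, all the point measures that share the pattern of the limit
    process converge vaguely to it ([pattern_nbhd_cvg]), and the infimum of [G]
    over them converges to the value of [G] ([limit_expectation]). *)

Set Implicit Arguments.
Unset Strict Implicit.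
Unset Printing Implicit Defensive.
Import Order.TTheory GRing.Theory Num.Theory.
Import numFieldNormedType.Exports.
Local Open Scope classical_set_scope.
Local Open Scope ring_scope.

(** * The vague topology *)

Section vague_topology.
Context {R : realType} {S : ptopologicalType} (D : set S).

Lemma test_integrals_continuous (phi : test_function (R := R) D) :
  continuous (fun nu : point_measure (R := R) D =>
    test_integrals nu phi : R).
Proof.
move=> nu.
have c1 : continuous (@test_integrals R S D : point_measure D -> _).
  exact: initial_continuous.
have c2 : continuous (fun g : {ptws test_function (R := R) D -> R^o} => g phi).
  exact: (@proj_continuous {classic test_function (R := R) D} (fun=> R^o) phi).
exact: (@continuous_comp _ _ _ (@test_integrals R S D) (fun g : {ptws test_function (R := R) D -> R^o} => g phi) nu (c1 nu) (c2 _)).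
Qed.

Lemma cvg_test_integrals (F : set_system (point_measure (R := R) D))
    (nu : point_measure (R := R) D) : Filter F ->
  (forall phi : test_function D,
     test_integrals mu phi @[mu --> F] --> (test_integrals nu phi : R)) ->
  F --> nu.
Proof.
move=> FF cvF A [B [[C oC <-] Cnu CA]]; apply: (filterS CA).
have H : (@test_integrals R S D @ F) --> test_integrals nu.
  apply/cvg_sup => phi A' [B' [[C' oC' <-] Cnu' CA']]; apply: (filterS CA').
  by apply: (cvF phi); exact: open_nbhs_nbhs.
by apply: H; exact: open_nbhs_nbhs.
Qed.
End vague_topology.

(** * Integrals against point measures *)

Lemma open_borel {S : ptopologicalType} (A : set S) :
  open A -> measurable (A : set (borel S)).
Proof. by move=> oA; apply: sub_sigma_algebra. Qed.

Lemma closed_borel {S : ptopologicalType} (A : set S) :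
  closed A -> measurable (A : set (borel S)).
Proof.
move=> cA; rewrite -[A]setCK; apply: measurableC; apply: open_borel.
exact: closed_openC.
Qed.

Section point_sums.
Context {R : realType} {S : ptopologicalType}.
Implicit Types (b : pred nat) (x : nat -> S) (D : set S).

Lemma within_continuous_borel D (g : S -> R) :
  measurable (D : set (borel S)) -> {within D, continuous g} ->
  measurable_fun (D : set (borel S)) (g : borel S -> R).
Proof.
move=> mD /continuousP cg.
apply: (measurability _ (RGenOpens.measurableE R)).
move=> _ [_ [a [b ->] <-]].
have [V oV VE] := (open_subspaceP _ _).1 (cg _ (itv_open a b)).
rewrite setIC -VE.
by apply: measurableI => //; apply: open_borel.
Qed.

Lemma continuous_borel (g : S -> R) : continuous g ->
  measurable_fun setT (g : borel S -> R).
Proof.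
move=> cg; apply: within_continuous_borel; first exact: measurableT.
exact: continuous_subspaceT.
Qed.

Lemma point_sumE b x (A : set S) :
  point_sum b x A = (\sum_(0 <= n <oo) ((b n && (x n \in A))%:R : R)%:E)%E.
Proof.
rewrite /point_sum /= /mseries; apply: eq_eseriesr => n _.
by rewrite /atom; case: (b n) => //=; rewrite diracE; case: (_ \in _).
Qed.

Lemma integral_point_sum b x D (g : S -> R) :
  measurable (D : set (borel S)) ->
  (forall y, D y -> 0 <= g y) ->
  measurable_fun (D : set (borel S)) (g : borel S -> R) ->
  (forall n, b n -> D (x n)) ->
  (\int[point_sum b x]_(y in D) (g y)%:E =
   \sum_(0 <= n <oo) (if b n then g (x n) else 0)%:E)%E.
Proof.
move=> mD g0 mg bD.
rewrite /point_sum ge0_integral_measure_series//; last exact/measurable_EFinP.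
apply: eq_eseriesr => n _; rewrite /atom; case: ifPn => bn.
  rewrite integral_dirac//; last exact/measurable_EFinP.
  by rewrite diracE mem_set ?mul1e//; exact: bD.
by rewrite integral_measure_zero.
Qed.

(** Points are counted with multiplicity: the indices in [s] are distinct, but the
    points need not be. *)
Lemma point_sum_ge b x (A : set S) (s : seq nat) :
  uniq s -> (forall n, n \in s -> b n /\ A (x n)) ->
  ((size s)%:R%:E <= point_sum (R := R) b x A)%E.
Proof.
move=> us sA; rewrite point_sumE.
pose k := (\max_(n <- s) n).+1.
have sk n : n \in s -> (n < k)%N by move=> ns; rewrite ltnS leq_bigmax_seq.
apply: (@le_trans _ _ (\sum_(0 <= n < k) ((b n && (x n \in A))%:R : R)%:E)%E).
  rewrite sumEFin lee_fin.
  rewrite (_ : (size s)%:R = \sum_(0 <= n < k | n \in s) (1 : R)).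
    rewrite [leRHS](bigID (fun n => n \in s)) /= ler_wpDr//.
      by apply: sumr_ge0 => n _.
    apply: ler_sum => n ns; have [bn An] := sA _ ns.
    by rewrite bn mem_set.
  rewrite -big_filter (perm_big s); last first.
    apply: uniq_perm => //; first by rewrite filter_uniq// iota_uniq.
    move=> n; rewrite mem_filter mem_index_iota /= andb_idr// => ns.
    exact: sk.
  by rewrite big_const_seq count_predT iter_addr_0.
apply: (@nneseries_lim_ge R (fun n => ((b n && (x n \in A))%:R : R)%:E) xpredT).
by move=> n _ _; rewrite lee_fin.
Qed.

End point_sums.

Section test_integrals.
Context {R : realType} {S : ptopologicalType} (D : set S).
Hypothesis cD : closed D.
Implicit Types (nu : point_measure (R := R) D) (phi : test_function (R := R) D).

Lemma to_point_measureE (mu : {measure set (borel S) -> \bar R}) :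
  is_point_measure D mu -> pm_measure (to_point_measure D mu) = mu.
Proof. by move=> h; rewrite /to_point_measure; case: pselect. Qed.

Lemma test_measurable phi :
  measurable_fun (D : set (borel S)) (phi : borel S -> R).
Proof.
apply: within_continuous_borel; first exact: closed_borel.
exact: tf_continuous.
Qed.

Lemma test_measurable_EFin phi :
  measurable_fun (D : set (borel S)) (fun y : borel S => (phi y)%:E).
Proof. by apply/measurable_EFinP; exact: test_measurable. Qed.

Lemma indic_measurable_EFin (A : set S) : measurable (A : set (borel S)) ->
  measurable_fun (D : set (borel S)) (fun y : borel S => (\1_A y : R)%:E).
Proof.
move=> mA; apply/measurable_EFinP.
by apply: measurable_funTS; exact: measurable_indic.
Qed.

Lemma integral_indic_sub nu (A : set S) : A `<=` D ->
  measurable (A : set (borel S)) ->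
  (\int[pm_measure nu]_(y in D) (\1_A y)%:E = pm_measure nu A)%E.
Proof.
move=> AD mA; have mD := closed_borel cD.
by rewrite (@integral_indic _ (borel S))// (setIidl AD).
Qed.

Lemma test_integrals_point_sum nu (b : pred nat) (x : nat -> S) phi (n0 : nat) :
  (pm_measure nu = point_sum b x :> (set S -> \bar R)) ->
  (forall n, b n -> D (x n)) ->
  (forall n, (n0 <= n)%N -> b n -> phi (x n) = 0) ->
  test_integrals nu phi = \sum_(n < n0 | b n) phi (x n).
Proof.
move=> nuE bD phi0; have mD := closed_borel cD.
rewrite /test_integrals /Rintegral.
rewrite (eq_measure_integral (point_sum b x)); last by move=> A _ _; rewrite nuE.
rewrite integral_point_sum//; [|exact: tf_ge0|exact: test_measurable].
rewrite (nneseries_split 0 n0); last first.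
  by move=> k _; rewrite lee_fin; case: ifP => // /bD/tf_ge0 ->.
rewrite eseries0 ?adde0; last first.
  by move=> n; rewrite add0n => n0n _; case: ifP => // bn; rewrite phi0.
by rewrite add0n sumEFin [RHS]big_mkcond /= big_mkord.
Qed.

Lemma integral_test_fin nu phi (K : set S) :
  K `<=` D -> compact K -> closed K -> (forall y, D y -> phi y <= \1_K y) ->
  (\int[pm_measure nu]_(y in D) (phi y)%:E)%E \is a fin_num.
Proof.
move=> KD kK cK phiK; have mD := closed_borel cD; have mK := closed_borel cK.
rewrite ge0_fin_numE; last first.
  by apply: integral_ge0 => y Dy; rewrite lee_fin tf_ge0.
apply: (@le_lt_trans _ _ (\int[pm_measure nu]_(y in D) (\1_K y)%:E)%E).
  apply: ge0_le_integral => //.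
  - by move=> y Dy; rewrite lee_fin tf_ge0.
  - exact: test_measurable_EFin.
  - exact: indic_measurable_EFin.
rewrite integral_indic_sub//.
by have [_] := pm_axiom nu; apply.
Qed.

Lemma test_integralsE nu phi (K : set S) :
  K `<=` D -> compact K -> closed K -> (forall y, D y -> phi y <= \1_K y) ->
  (test_integrals nu phi)%:E = (\int[pm_measure nu]_(y in D) (phi y)%:E)%E.
Proof. by move=> KD kK cK phiK; rewrite fineK//; apply: integral_test_fin phiK. Qed.

(** With the next lemma, this compares masses of sets with test integrals, which
    are continuous for the vague topology while the masses are not. *)
Lemma test_integrals_le nu phi (A : set S) : A `<=` D ->
  measurable (A : set (borel S)) ->
  (forall y, D y -> phi y <= \1_A y) ->
  ((test_integrals nu phi)%:E <= pm_measure nu A)%E.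
Proof.
move=> AD mA phiA; have mD := closed_borel cD.
apply: (@le_trans _ _ (\int[pm_measure nu]_(y in D) (phi y)%:E)%E).
  rewrite /test_integrals /Rintegral.
  by case: (integral _ _ _) (@integral_ge0 _ (borel S) R (pm_measure nu) D
    (fun y => (phi y)%:E) (fun y Dy => tf_ge0 phi Dy)) => [r _||]//; rewrite leey.
apply: (@le_trans _ _ (\int[pm_measure nu]_(y in D) (\1_A y)%:E)%E).
  apply: ge0_le_integral => //.
  - by move=> y Dy; rewrite lee_fin tf_ge0.
  - exact: test_measurable_EFin.
  - exact: indic_measurable_EFin.
by rewrite integral_indic_sub//.
Qed.

(** The compact [K] makes the test integral finite; otherwise its real value
    would be the default value of [fine]. *)
Lemma test_integrals_ge nu phi (A K : set S) : A `<=` D ->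
  measurable (A : set (borel S)) ->
  K `<=` D -> compact K -> closed K -> (forall y, D y -> phi y <= \1_K y) ->
  (forall y, D y -> \1_A y <= phi y) ->
  (pm_measure nu A <= (test_integrals nu phi)%:E)%E.
Proof.
move=> AD mA KD kK cK phiK phiA; have mD := closed_borel cD.
rewrite (test_integralsE nu KD kK cK phiK).
apply: (@le_trans _ _ (\int[pm_measure nu]_(y in D) (\1_A y)%:E)%E).
  by rewrite integral_indic_sub//.
apply: ge0_le_integral => //.
- exact: indic_measurable_EFin.
- exact: test_measurable_EFin.
Qed.

(** Dominated convergence: the bounding set [K] has finite mass because it is a
    compact subset of [D]. *)
Lemma test_integrals_cvg nu (psi : nat -> test_function (R := R) D)
    (A K : set S) : A `<=` K -> measurable (A : set (borel S)) ->
  K `<=` D -> compact K -> closed K ->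
  (forall n y, D y -> psi n y <= \1_K y) ->
  (forall y, D y -> psi n y @[n --> \oo] --> (\1_A y : R)) ->
  test_integrals nu (psi n) @[n --> \oo] --> fine (pm_measure nu A).
Proof.
move=> AK mA KD kK cK psiK psiA; have AD := subset_trans AK KD.
have mD := closed_borel cD.
have mK := closed_borel cK.
have nuK : (pm_measure nu K < +oo)%E by have [_] := pm_axiom nu; apply.
have [] := @dominated_convergence _ _ _ (pm_measure nu) D mD
  (fun n y => (psi n y)%:E) (fun y => (\1_A y)%:E) (fun y => (\1_K y)%:E).
- by move=> n; exact: test_measurable_EFin.
- exact: indic_measurable_EFin.
- apply: aeW => y Dy; apply: cvg_EFin; first exact: nearW.
  exact: psiA.
- apply/integrableP; split; first exact: indic_measurable_EFin.
  under eq_integral do rewrite gee0_abs ?lee_fin//.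
  by rewrite integral_indic_sub//.
- apply: aeW => y n Dy; rewrite gee0_abs ?lee_fin ?psiK//.
  exact: tf_ge0.
move=> _ _; rewrite integral_indic_sub//.
have nuA : pm_measure nu A \is a fin_num.
  rewrite ge0_fin_numE ?measure_ge0//; apply: le_lt_trans nuK.
  by apply: le_measure; rewrite ?inE.
by rewrite -[X in _ --> X -> _](fineK nuA) => /fine_cvgP[].
Qed.

End test_integrals.

(** * Bump functions *)
Section clamp.
Context {R : realType}.
Implicit Types x y : R.

Definition clamp x : R := Num.max 0 (Num.min 1 x).

Lemma clamp_ge0 x : 0 <= clamp x. Proof. by rewrite le_max lexx. Qed.

Lemma clamp_le1 x : clamp x <= 1.
Proof. by rewrite ge_max ler01 ge_min lexx. Qed.

Lemma clamp_id_ge1 x : 1 <= x -> clamp x = 1.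
Proof. by move=> x1; rewrite /clamp (min_idPl x1) (max_idPr ler01). Qed.

Lemma clamp_id_le0 x : x <= 0 -> clamp x = 0.
Proof.
by move=> x0; apply/max_idPl; rewrite ge_min x0 orbT.
Qed.

Lemma clamp_eq1 x : clamp x = 1 -> 1 <= x.
Proof.
rewrite /clamp; case: (leP 1 x) => // x1.
by case: (leP 0 x) => x0 h; lra.
Qed.

Lemma clamp_gt0 x : 0 < clamp x -> 0 < x.
Proof. by case: (leP x 0) => // /clamp_id_le0 ->; rewrite ltxx. Qed.

Lemma clamp_continuous {T : topologicalType} (g : T -> R) :
  continuous g -> continuous (clamp \o g).
Proof.
move=> cg; rewrite (_ : clamp \o g = (fun=> 0) \max ((fun=> 1) \min g)) //.
apply: max_fun_continuous; first by move=> x; exact: cvg_cst.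
by apply: min_fun_continuous => // x; exact: cvg_cst.
Qed.

Lemma clamp_cvg (u : nat -> R) (l : R) : u n @[n --> \oo] --> l ->
  clamp (u n) @[n --> \oo] --> clamp l.
Proof.
have c : continuous clamp by apply: (@clamp_continuous R id) => y.
by move=> ul; apply: (continuous_cvg _ _ ul); exact: c.
Qed.

Lemma clamp_dilate_cvg x :
  clamp (n.+1%:R * x) @[n --> \oo] --> ((0 < x)%R%:R : R).
Proof.
case: (ltP 0 x) => x0; last first.
  rewrite (_ : (fun n => _) = fun=> 0); first exact: cvg_cst.
  apply/funext => n; rewrite clamp_id_le0//.
  by rewrite pmulr_rle0.
apply: cvg_near_cst.
near=> n; apply: clamp_id_ge1; rewrite -ler_pdivrMr// mul1r.
apply: le_trans (_ : n%:R <= _); last by rewrite ler_nat.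
near: n; exact: nbhs_infty_ger.
Unshelve. all: by end_near. Qed.

Lemma clamp_one_minus_dilate_cvg x :
  clamp (1 - n.+1%:R * x) @[n --> \oo] --> ((x <= 0)%R%:R : R).
Proof.
case: (leP x 0) => x0.
  rewrite (_ : (fun n => _) = fun=> 1); first exact: cvg_cst.
  apply/funext => n; rewrite clamp_id_ge1//.
  by rewrite lerDl oppr_ge0 pmulr_rle0.
apply: cvg_near_cst.
near=> n; apply: clamp_id_le0; rewrite subr_le0 -ler_pdivrMr// mul1r.
apply: le_trans (_ : n%:R <= _); last by rewrite ler_nat.
near: n; exact: nbhs_infty_ger.
Unshelve. all: by end_near. Qed.
End clamp.

Section strip_bumps.
Context {R : realType}.
Local Notation strip := (@strip R).
Implicit Types (a b c d M : R) (p : R * R).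

Lemma fst_continuous : continuous (fst : R * R -> R).
Proof. by move=> p; exact: cvg_fst. Qed.

Lemma snd_continuous : continuous (snd : R * R -> R).
Proof. by move=> p; exact: cvg_snd. Qed.

Lemma closed_rectangle (A B : set R) : closed A -> closed B ->
  closed (A `*` B : set (R * R)).
Proof.
move=> cA cB; have -> : A `*` B = (fst @^-1` A) `&` (snd @^-1` B) by [].
apply: closedI; apply: preimage_closed => //; apply: in1W.
  exact: fst_continuous.
exact: snd_continuous.
Qed.

Lemma open_rectangle (A B : set R) : open A -> open B ->
  open (A `*` B : set (R * R)).
Proof.
move=> cA cB; have -> : A `*` B = (fst @^-1` A) `&` (snd @^-1` B) by [].
by apply: openI; apply: open_comp => // p _;
  [exact: fst_continuous|exact: snd_continuous].
Qed.

Lemma closed_strip : closed strip.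
Proof. by apply: closed_rectangle; [exact: rray_closed|exact: itv_closed]. Qed.

Definition window M : set (R * R) := `[0, M] `*` `[0, 1].

Lemma closed_window M : closed (window M).
Proof. by apply: closed_rectangle; exact: itv_closed. Qed.

Lemma compact_window M : compact (window M).
Proof. by apply: compact_setX; exact: segment_compact. Qed.

Lemma window_strip M : window M `<=` strip.
Proof.
move=> p [/=]; rewrite !in_itv /= => /andP[p0 _] p1.
by split; rewrite /= in_itv /= ?p0.
Qed.

Section test_of_continuous.
Variables (g : R * R -> R) (M : R).
Hypotheses (g0 : forall p, 0 <= g p) (cg : continuous g).
Hypothesis gM : forall p, strip p -> ~ window M p -> g p = 0.

Let gK : exists K : set (R * R),
  [/\ K `<=` strip, compact K & forall y, strip y -> ~ K y -> g y = 0].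
Proof.
by exists (window M); split; [exact: window_strip|exact: compact_window|].
Qed.

(** Being nonnegative and continuous on the whole plane is what makes [g] a test
    function on the strip without any discussion of the relative topology. *)
Definition strip_test : test_function (R := R) strip :=
  TestFunction (fun p _ => g0 p) (continuous_subspaceT cg) gK.
End test_of_continuous.

Definition open_rect a b c d : set (R * R) := `]a, b[ `*` `]c, d[.

(** A continuous function whose positivity set is the open rectangle. *)
Definition depth a b c d p : R :=
  Num.min (Num.min (p.1 - a) (b - p.1)) (Num.min (p.2 - c) (d - p.2)).

Lemma depth_gt0 a b c d p : (0 < depth a b c d p) <-> open_rect a b c d p.
Proof.
rewrite /depth !lt_min !subr_gt0 /open_rect /=; split.
  by move=> /andP[? ?]; rewrite !in_itv.
by rewrite !in_itv /= => -[-> ->].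
Qed.

Lemma depth_continuous a b c d : continuous (depth a b c d).
Proof.
apply: (@min_fun_continuous _ _ R (fun p => Num.min (p.1 - a) (b - p.1))
    (fun p => Num.min (p.2 - c) (d - p.2))).
  apply: (@min_fun_continuous _ _ R (fun p => p.1 - a) (fun p => b - p.1)) => p.
    by apply: cvgB; [exact: fst_continuous|exact: cvg_cst].
  by apply: cvgB; [exact: cvg_cst|exact: fst_continuous].
apply: (@min_fun_continuous _ _ R (fun p => p.2 - c) (fun p => d - p.2)) => p.
  by apply: cvgB; [exact: snd_continuous|exact: cvg_cst].
by apply: cvgB; [exact: cvg_cst|exact: snd_continuous].
Qed.

(** The inner bumps increase to the indicator of an open rectangle, and the outer
    bumps decrease on the strip to the indicator of a window: masses of open rectangles
    are estimated from below, masses of windows from above. *)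
Definition inner_bump a b c d (n : nat) p := clamp (n.+1%:R * depth a b c d p).

Definition outer_bump M (n : nat) p := clamp (1 - n.+1%:R * (p.1 - M)).

Lemma inner_bump_continuous a b c d n : continuous (inner_bump a b c d n).
Proof.
apply: (@clamp_continuous _ _ (fun p => n.+1%:R * depth a b c d p)) => p.
by apply: cvgMl_tmp; exact: depth_continuous.
Qed.

Lemma outer_bump_continuous M n : continuous (outer_bump M n).
Proof.
apply: (@clamp_continuous _ _ (fun p => 1 - n.+1%:R * (p.1 - M))) => p.
apply: cvgB; first exact: cvg_cst.
apply: cvgMl_tmp; apply: cvgB; [exact: fst_continuous|exact: cvg_cst].
Qed.

Lemma inner_bump_eq0 a b c d n p : ~ open_rect a b c d p ->
  inner_bump a b c d n p = 0.
Proof.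
move=> np; apply: clamp_id_le0; rewrite pmulr_rle0// leNgt.
by apply/negP => /depth_gt0.
Qed.

Lemma outer_bump_eq0 M n p : strip p -> ~ window (M + 1) p ->
  outer_bump M n p = 0.
Proof.
move=> [/=]; rewrite !in_itv /= andbT => p0 p1 np.
apply: clamp_id_le0; rewrite subr_le0.
have Mp : M + 1 < p.1.
  by rewrite ltNge; apply/negP => pM; apply: np; split; rewrite /= in_itv /= ?p0.
have p1M : 1 <= p.1 - M by lra.
by rewrite (le_trans p1M)// ler_peMl ?ler1n//; lra.
Qed.

Lemma open_rect_window a b c d M : 0 <= a -> b <= M -> 0 <= c -> d <= 1 ->
  open_rect a b c d `<=` window M.
Proof.
move=> a0 bM c0 d1 p [/=]; rewrite !in_itv /= => /andP[ap pb] /andP[cp pd].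
by split; rewrite /= in_itv /=; apply/andP; split; lra.
Qed.
End strip_bumps.

(** * Integrals of possibly non-measurable bounded functions *)

Section lower_integral.
Context {R : realType} d (T : measurableType d) (P : probability T R).
Implicit Types (f g : T -> R) (C : R).
Import HBNNSimple.

(** The integral of a nonnegative function is a supremum over the simple functions
    below it, whether or not the function is measurable: it is a lower integral. *)
Lemma ge0_integral_le f (x : \bar R) : (forall w, 0 <= f w) ->
  (forall h : {nnsfun T >-> R}, (forall w, h w <= f w) ->
     (\int[P]_w (h w)%:E <= x)%E) ->
  (\int[P]_w (f w)%:E <= x)%E.
Proof.
move=> f0 fx; rewrite ge0_integralTE; last by move=> w; rewrite lee_fin.
apply: ge_ereal_sup => _ [h hf <-]; rewrite -integralT_nnsfun.
by apply: fx => w; have := hf w; rewrite lee_fin.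
Qed.

Lemma nnsfun_integral_le f (h : {nnsfun T >-> R}) : (forall w, 0 <= f w) ->
  (forall w, h w <= f w) -> (\int[P]_w (h w)%:E <= \int[P]_w (f w)%:E)%E.
Proof.
move=> f0 hf; rewrite integralT_nnsfun ge0_integralTE; last first.
  by move=> w; rewrite lee_fin.
by apply: ereal_sup_ubound; exists h => // w; rewrite lee_fin.
Qed.

Lemma le_integral_lower f g : (forall w, 0 <= f w) -> (forall w, f w <= g w) ->
  (\int[P]_w (f w)%:E <= \int[P]_w (g w)%:E)%E.
Proof.
move=> f0 fg; apply: ge0_integral_le => // h hf.
apply: nnsfun_integral_le => w; first exact: le_trans (fg w).
exact: le_trans (fg w).
Qed.

Lemma integral_bounded f C : (forall w, 0 <= f w) -> (forall w, f w <= C) ->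
  (\int[P]_w (f w)%:E <= C%:E)%E.
Proof.
move=> f0 fC; apply: (@le_trans _ _ (\int[P]_w (cst C w)%:E)%E).
  exact: le_integral_lower.
have h : (C%:E * P setT)%E = C%:E by rewrite probability_setT mule1.
by rewrite -[leRHS]h -(integral_cst P (@measurableT _ T) C%:E).
Qed.

Lemma integral_fin f C : (forall w, 0 <= f w) -> (forall w, f w <= C) ->
  (\int[P]_w (f w)%:E)%E \is a fin_num.
Proof.
move=> f0 fC; rewrite ge0_fin_numE; last first.
  by apply: integral_ge0 => w _; rewrite lee_fin.
by apply: le_lt_trans (integral_bounded f0 fC) _; rewrite ltry.
Qed.

Lemma RintegralE f C : (forall w, 0 <= f w) -> (forall w, f w <= C) ->
  (\int[P]_w f w)%:E = (\int[P]_w (f w)%:E)%E.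
Proof. by move=> f0 fC; rewrite fineK//; exact: integral_fin fC. Qed.

Lemma expectation_bounded f C : (forall w, 0 <= f w) -> (forall w, f w <= C) ->
  'E_P[f]%E = (\int[P]_w f w)%:E.
Proof. by move=> f0 fC; rewrite unlock (@RintegralE f C). Qed.

Lemma le_Rintegral_lower f g C : (forall w, 0 <= f w) ->
  (forall w, f w <= g w) -> (forall w, g w <= C) ->
  \int[P]_w f w <= \int[P]_w g w.
Proof.
move=> f0 fg gC; rewrite -lee_fin (@RintegralE f C)//; last first.
  by move=> w; exact: le_trans (gC w).
rewrite (@RintegralE g C)//; last by move=> w; exact: le_trans (fg w).
exact: le_integral_lower.
Qed.

(** Lower integrals are only superadditive, since the sum of simple functions below
    [f] and [g] is below [f + g]; this is the direction that turns the lower bounds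
    for [G] and [C - G] into a limit. *)
Lemma Rintegral_superadditive f g C : (forall w, 0 <= f w) ->
  (forall w, 0 <= g w) -> (forall w, f w + g w <= C) ->
  \int[P]_w f w + \int[P]_w g w <= \int[P]_w (f w + g w).
Proof.
move=> f0 g0 fgC.
have fC w : f w <= C by apply: le_trans (fgC w); rewrite lerDl.
have gC w : g w <= C by apply: le_trans (fgC w); rewrite lerDr.
rewrite -lee_fin (@RintegralE (fun w => f w + g w) C)//; last first.
  by move=> w; rewrite addr_ge0.
rewrite EFinD -leeBrDr// (@RintegralE f C)//.
apply: ge0_integral_le => // h hf; rewrite leeBrDr//.
rewrite addeC -leeBrDr; last exact: (@integral_fin h C _ (fun w => le_trans (hf w) (fC w))).
rewrite (@RintegralE g C)//; apply: ge0_integral_le => // k kg.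
rewrite leeBrDr; last exact: (@integral_fin h C _ (fun w => le_trans (hf w) (fC w))).
rewrite -ge0_integralD//=; last 4 first.
- by move=> w _; rewrite lee_fin.
- by apply/measurable_EFinP.
- by move=> w _; rewrite lee_fin.
- by apply/measurable_EFinP.
apply: (@le_trans _ _ (\int[P]_w ((add_nnsfun k h) w)%:E)%E).
  by [].
apply: (@nnsfun_integral_le _ (add_nnsfun k h)) => w /=; first by rewrite addr_ge0.
  by rewrite addrC lerD.
Qed.

(** Cutting off a measurable set of small probability: a simple function below [f]
    can be multiplied by the indicator of [A]. *)
Lemma Rintegral_restrict f C (A : set T) : measurable A ->
  (forall w, 0 <= f w) -> (forall w, f w <= C) ->
  \int[P]_w f w <= \int[P]_w (f w * \1_A w) + C * fine (P (~` A)).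
Proof.
move=> mA f0 fC.
have fA0 w : 0 <= f w * \1_A w by rewrite mulr_ge0.
have fAC w : f w * \1_A w <= C.
  by apply: le_trans (fC w); rewrite ler_piMr// indicE; case: (_ \in _).
rewrite -lee_fin (@RintegralE f C)// EFinD (@RintegralE (fun w => f w * \1_A w) C)//.
apply: ge0_integral_le => // h hf.
have mAc : measurable (~` A) by exact: measurableC.
apply: (@le_trans _ _ (\int[P]_w ((h w * \1_A w)%:E + (C * \1_(~` A) w)%:E))%E).
  apply: ge0_le_integral => //.
  - by move=> w _; rewrite lee_fin.
  - exact/measurable_EFinP.
  - apply: emeasurable_funD; apply/measurable_EFinP; apply: measurable_funM => //.
  - move=> w _; rewrite -EFinD lee_fin !indicE in_setC.
    case: (w \in A) => /=; first by rewrite mulr1 mulr0 addr0.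
    by rewrite mulr0 add0r mulr1 (le_trans (hf w)).
rewrite ge0_integralD//=; last 4 first.
- by move=> w _; rewrite lee_fin mulr_ge0.
- by apply/measurable_EFinP; exact: measurable_funM.
- by move=> w _; rewrite lee_fin mulr_ge0// (le_trans (f0 w)).
- by apply/measurable_EFinP; exact: measurable_funM.
apply: leeD.
  apply: (@nnsfun_integral_le _ (mul_nnsfun h (indic_nnsfun R mA))) => // w /=.
  by rewrite ler_wpM2r.
have C0 : 0 <= C by apply: le_trans (f0 point) (fC _).
under eq_integral do rewrite EFinM.
rewrite ge0_integralZl_EFin//; last first.
  by apply/measurable_EFinP.
by rewrite integral_indic// setIT EFinM fineK// fin_num_measure.
Qed.

Lemma bounded_convergence (u : nat -> T -> R) (l : T -> R) C :
  (forall n, measurable_fun setT (u n)) -> measurable_fun setT l ->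
  (forall n w, 0 <= u n w <= C) ->
  {ae P, forall w, u n w @[n --> \oo] --> l w} ->
  (forall w, 0 <= l w <= C) ->
  \int[P]_w u n w @[n --> \oo] --> \int[P]_w l w.
Proof.
move=> mu ml uC [N [mN N0 uN]] lC.
have bound : {ae P, forall w n, setT w -> (`|(u n w)%:E| <= cst C%:E w)%E}.
  by apply: aeW => w n _; have /andP[h0 h1] := uC n w; rewrite gee0_abs lee_fin.
have cvgE : {ae P, forall w, setT w -> (u n w)%:E @[n --> \oo] --> (l w)%:E}.
  exists N; split => // w nw; apply: uN => /= h; apply: nw => _.
  by apply: cvg_EFin => //; exact: nearW.
have [_ _] := @dominated_convergence _ _ _ P setT measurableT
  (fun n w => (u n w)%:E) (fun w => (l w)%:E) (cst C%:E)
  (fun n => (measurable_EFinP _ _).2 (mu n)) ((measurable_EFinP _ _).2 ml)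
  cvgE (finite_measure_integrable_cst P C measurableT) bound.
have lfin : (\int[P]_w (l w)%:E)%E \is a fin_num.
  by apply: (@integral_fin l C) => w; have /andP[] := lC w.
by rewrite -[X in _ --> X -> _](fineK lfin) => /fine_cvgP[].
Qed.

(** The limit is controlled on a set of full measure only, and may be nonmeasurable:
    it is replaced by [0] outside [A], which does not change its lower integral. *)
Lemma Rintegral_cvg_ae (u : nat -> T -> R) (l : T -> R) C (A : set T) :
  measurable A -> P (~` A) = 0%E ->
  (forall n, measurable_fun setT (u n)) ->
  (forall n w, 0 <= u n w <= C) -> (forall w, 0 <= l w <= C) ->
  (forall w, A w -> u n w @[n --> \oo] --> l w) ->
  \int[P]_w u n w @[n --> \oo] --> \int[P]_w l w.
Proof.
move=> mA A0 mu uC lC ul.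
have lA w : 0 <= l w * \1_A w <= C.
  have /andP[l0 l1] := lC w; rewrite mulr_ge0//=.
  by apply: le_trans l1; rewrite ler_piMr// indicE; case: (_ \in _).
have ulA w : u n w * \1_A w @[n --> \oo] --> l w * \1_A w.
  case: (boolP (w \in A)) => wA; rewrite indicE.
    by rewrite wA; apply: cvgMr_tmp; apply: ul; exact: set_mem.
  rewrite (negbTE wA) mulr0 (_ : (fun n => _) = fun=> 0); first exact: cvg_cst.
  by apply/funext => n; rewrite mulr0.
have mlA : measurable_fun setT (fun w => l w * \1_A w).
  apply: (@measurable_fun_cvg _ _ _ _ (fun n w => u n w * \1_A w)) => // n.
  exact: measurable_funM.
have -> : \int[P]_w l w = \int[P]_w (l w * \1_A w).
  apply/eqP; rewrite eq_le; apply/andP; split.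
    have := @Rintegral_restrict l C A mA (fun w => (andP (lC w)).1)
      (fun w => (andP (lC w)).2).
    by rewrite A0 /= mulr0 addr0.
  apply: (@le_Rintegral_lower _ _ C) => w; have /andP[l0 l1] := lC w => //.
    by rewrite mulr_ge0.
  by rewrite ler_piMr// indicE; case: (_ \in _).
apply: (@bounded_convergence _ _ C) => //.
exists (~` A); split; [exact: measurableC|exact: A0|].
move=> w /= nw Aw; apply: nw; rewrite indicE mem_set// mulr1; exact: ul.
Qed.

End lower_integral.

(** * Limits of finite sums and products *)

Lemma cvg_sum_seq {R : realType} {T : Type} (F : set_system T) (FF : Filter F)
    (I : Type) (s : seq I) (Q : pred I) (u : I -> T -> R) (l : I -> R) :
  (forall i, u i x @[x --> F] --> l i) ->
  (\sum_(i <- s | Q i) u i x) @[x --> F] --> \sum_(i <- s | Q i) l i.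
Proof.
by move=> ul; apply: cvg_big => //; exact: add_continuous.
Qed.

Lemma cvg_prod_seq {R : realType} {T : Type} (F : set_system T) (FF : Filter F)
    (I : Type) (s : seq I) (Q : pred I) (u : I -> T -> R) (l : I -> R) :
  (forall i, u i x @[x --> F] --> l i) ->
  (\prod_(i <- s | Q i) u i x) @[x --> F] --> \prod_(i <- s | Q i) l i.
Proof.
by move=> ul; apply: cvg_big => //; exact: mul_continuous.
Qed.

Section continuous_real_functions.
Context {R : realType} {T : topologicalType}.
Implicit Types f g : T -> R.

Lemma continuousM_fun f g : continuous f -> continuous g ->
  continuous (fun x => f x * g x).
Proof. by move=> cf cg x; apply: cvgM; [exact: cf|exact: cg]. Qed.

Lemma continuousB_fun f g : continuous f -> continuous g ->
  continuous (fun x => f x - g x).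
Proof. by move=> cf cg x; apply: cvgB; [exact: cf|exact: cg]. Qed.

Lemma continuous_sum_seq (I : Type) (s : seq I) (u : I -> T -> R) :
  (forall i, continuous (u i)) -> continuous (fun x => \sum_(i <- s) u i x).
Proof. by move=> cu x; apply: cvg_sum_seq => i; exact: cu. Qed.

Lemma continuous_prod_seq (I : Type) (s : seq I) (u : I -> T -> R) :
  (forall i, continuous (u i)) -> continuous (fun x => \prod_(i <- s) u i x).
Proof. by move=> cu x; apply: cvg_prod_seq => i; exact: cu. Qed.
End continuous_real_functions.

(** * Poisson processes charge patterns of rectangles *)

Lemma mutually_independent_finType {R : realType} d (Omega : measurableType d)
    (P : probability Omega R) (I : finType) d' (S : measurableType d')
    (X : I -> Omega -> S) (A : I -> set S) :
  mutually_independent P X -> (forall i, measurable (A i)) ->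
  P (\bigcap_i (X i @^-1` A i)) = (\prod_(i : I) P (X i @^-1` A i))%E.
Proof.
move=> indep mA; have := indep [fset i | i in enum I]%fset A.
rewrite (perm_big (enum I)); last first.
  apply: uniq_perm; [exact: fset_uniq|exact: enum_uniq|].
  by move=> i; rewrite !inE/= mem_enum.
rewrite big_enum /= => <-//; congr (P _); apply: eq_bigcapl.
by split=> [i _|//] /=; rewrite !inE/= mem_enum.
Qed.

Section poisson_pattern.
Context {R : realType} d0 (Omega0 : measurableType d0).
Variables (P0 : probability Omega0 R).
Variable N : Omega0 -> point_measure (R := R) (@strip R).
Variable eta : {measure set (measurableTypeR R * measurableTypeR R) -> \bar R}.
Hypothesis poissonN : poisson_point_process P0 N eta.

Lemma poisson_prob_one (k : R) : 0 <= k ->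
  poisson_prob k 0 [set 1%N] = (k * expR (- k))%:E.
Proof.
rewrite le0r => /predU1P[->|k0]; rewrite /poisson_prob.
  by rewrite ltxx mul0r diracE memNset//= => /eqP.
rewrite k0 esum_set1 ?lee_fin ?poisson_pmf_ge0// /poisson_pmf k0.
by rewrite expr1 invr1 mulr1.
Qed.

Lemma poisson_prob_zero (k : R) : 0 <= k ->
  poisson_prob k 0 [set 0%N] = (expR (- k))%:E.
Proof.
rewrite le0r => /predU1P[->|k0]; rewrite /poisson_prob.
  by rewrite ltxx diracE mem_set//= oppr0 expR0.
rewrite k0 esum_set1 ?lee_fin ?poisson_pmf_ge0// /poisson_pmf k0.
by rewrite expr0 fact0 invr1 !mul1r.
Qed.

Variables (M : R) (k : nat) (a b c e : 'I_k -> R) (kappa : R).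
Let Q i := open_rect (a i) (b i) (c i) (e i).
Hypotheses (a0 : forall i, 0 <= a i) (bM : forall i, b i <= M).
Hypotheses (c0 : forall i, 0 <= c i) (e1 : forall i, e i <= 1).
Hypothesis disjQ : trivIset setT Q.
Hypothesis etaQ : forall i, eta (Q i) = kappa%:E.
Hypothesis etaW : eta (window M) = M%:E.

Let W := window M.
Let UQ := \bigcup_i Q i.

Let QW i : Q i `<=` W.
Proof. exact: open_rect_window. Qed.

Let UQW : UQ `<=` W.
Proof. by move=> p [i _] /QW. Qed.

Let UQE : UQ = \big[setU/set0]_(i < k) Q i.
Proof.
rewrite -(bigcup_seq (index_enum _)); apply: eq_bigcupl.
by split=> [i _|//] /=; rewrite mem_index_enum.
Qed.

(* The complement of the rectangles in the window comes last, so that a big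
   operator over all the pieces splits off its last term. *)
Let B (i : 'I_k.+1) : set (R * R) :=
  if unlift ord_max i is Some j then Q j else W `\` UQ.

Let BQ j : B (lift ord_max j) = Q j. Proof. by rewrite /B liftK. Qed.
Let Bmax : B ord_max = W `\` UQ. Proof. by rewrite /B unlift_none. Qed.

Let mQ i : measurable (Q i : set (borel (R * R)%type)).
Proof. by apply: open_borel; apply: open_rectangle; exact: itv_open. Qed.

Let mW : measurable (W : set (borel (R * R)%type)).
Proof. by apply: closed_borel; exact: closed_window. Qed.

Let mUQ : measurable (UQ : set (borel (R * R)%type)).
Proof. by rewrite UQE; apply: bigsetU_measurable => i _. Qed.

Let mB i : measurable (B i : set (borel (R * R)%type)) /\ B i `<=` @strip R.
Proof.
rewrite /B; case: unlift => [j|].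
  by split => //; apply: subset_trans (@window_strip _ M); exact: QW.
split; first exact: measurableD.
by move=> p [/window_strip].
Qed.

Let disjB : trivIset setT B.
Proof.
apply/trivIsetP => i j _ _; rewrite /B.
case: (unliftP ord_max i) => [i'|] ->; case: (unliftP ord_max j) => [j'|] ->.
- rewrite (inj_eq lift_inj) => ij; exact: (trivIsetP.1 disjQ).
- move=> _; apply/seteqP; split => // p [Qp [_]]; apply.
  by exists i'.
- move=> _; apply/seteqP; split => // p [[_ h] Qp]; apply: h.
  by exists j'.
- by rewrite eqxx.
Qed.

Let mQ2 i : measurable (Q i : set (measurableTypeR R * measurableTypeR R)%type).
Proof. by apply: measurableX; exact: measurable_itv. Qed.

Let mW2 : measurable (W : set (measurableTypeR R * measurableTypeR R)%type).
Proof. by apply: measurableX; exact: measurable_itv. Qed.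

Let etaB i : eta (B i) =
  (if unlift ord_max i is Some j then kappa else M - k%:R * kappa)%:E.
Proof.
rewrite /B; case: unlift => [j|]; first exact: etaQ.
have mU : measurable (UQ : set (measurableTypeR R * measurableTypeR R)%type).
  by rewrite UQE; apply: bigsetU_measurable => i' _.
have etaW' : eta W = M%:E by [].
have UQW' : W `&` UQ = UQ by exact: setIidr.
have etafin : (eta W < +oo)%E by rewrite etaW' ltry.
have etaD : eta (W `\` UQ) = (eta W - eta (W `&` UQ))%E.
  exact: (measureD mW2 mU etafin).
have etaUQ : eta UQ = (\sum_(i < k) eta (Q i))%E.
  rewrite UQE; exact: (measure_bigsetU_ord eta xpredT mQ2 disjQ).
move: etaD; rewrite UQW' etaW' etaUQ.
under eq_bigr do rewrite etaQ.
by rewrite sumEFin sumr_const card_ord -EFinB mulr_natl.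
Qed.

Let hits (i : 'I_k.+1) : set (\bar R) :=
  if unlift ord_max i is Some j then [set 1%E] else [set 0%E].

Let pattern := [set w | (forall i, N w (Q i) = 1%E) /\ N w (W `\` UQ) = 0%E].

Let patternE : pattern = \bigcap_i ((fun w => N w (B i)) @^-1` hits i).
Proof.
apply/seteqP; split => [w [N1 N0] i _|w h].
  by rewrite /= /hits /B; case: unlift.
split=> [i|].
  by have := h (lift ord_max i) Logic.I; rewrite /= BQ /hits liftK.
by have := h ord_max Logic.I; rewrite /= Bmax /hits unlift_none.
Qed.

(** The factors are [kappa exp (- kappa)] for each of the [k] rectangles and
    [exp (- (M - k kappa))] for the rest of the window. *)
Lemma poisson_pattern_prob : P0 pattern = (kappa ^+ k * expR (- M))%:E.
Proof.
have [mN hN] := poissonN; have [indep law] := hN _ B mB disjB.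
rewrite patternE (mutually_independent_finType indep); last first.
  by move=> i; rewrite /hits; case: unlift => [j|]; exact: emeasurable_set1.
have kappa_ge0 : (0 < k)%N -> 0 <= kappa.
  move=> k0; have := law (lift ord_max (Ordinal k0)).
  by rewrite /poisson_distributed etaB liftK => -[].
have probB i : P0 ((fun w => N w (B i)) @^-1` hits i) =
    (if unlift ord_max i is Some j then kappa * expR (- kappa)
     else expR (- (M - k%:R * kappa)))%:E.
  have := law i; rewrite /poisson_distributed etaB /hits.
  case: unlift => [j|] [r0 h].
    by rewrite -(poisson_prob_one r0) -(h 1%N).
  by rewrite -(poisson_prob_zero r0) -(h 0%N).
rewrite (eq_bigr _ (fun i _ => probB i)).
rewrite big_ord_recr /= unlift_none.
under eq_bigr => i _.
  rewrite (_ : widen_ord _ i = lift ord_max i); last first.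
    by apply/val_inj; rewrite /= /bump leqNgt ltn_ord.
  rewrite liftK; over.
rewrite prodEFin -EFinM prodr_const card_ord; congr EFin.
by rewrite exprMn -expRM_natl -mulrA -expRD; congr (_ * expR _); ring.
Qed.

Let inner (i : 'I_k) (n : nat) : test_function (R := R) (@strip R) :=
  strip_test (g := inner_bump (a i) (b i) (c i) (e i) n) (fun p => clamp_ge0 _)
    (@inner_bump_continuous R (a i) (b i) (c i) (e i) n)
    (M := M) (fun p _ np => inner_bump_eq0 n (fun Qp => np (@QW i p Qp))).

Let outer (n : nat) : test_function (R := R) (@strip R) :=
  strip_test (g := outer_bump M n) (fun p => clamp_ge0 _) (@outer_bump_continuous R M n)
    (M := M + 1) (fun p sp np => outer_bump_eq0 n sp np).

(** A continuous lower approximation of the indicator of the event that every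
    rectangle is charged and that the window contains fewer than [k + 1] points. The
    last factor has to be an upper estimate of the mass of the closed window, hence
    the outer bumps. *)
Definition pattern_weight (n : nat) (nu : point_measure (R := R) (@strip R)) : R :=
  (\prod_(i < k) clamp (test_integrals nu (inner i n))) *
  clamp (k.+1%:R - test_integrals nu (outer n)).

Let limit_weight (nu : point_measure (R := R) (@strip R)) : R :=
  (\prod_(i < k) clamp (fine (pm_measure nu (Q i)))) *
  clamp (k.+1%:R - fine (pm_measure nu W)).

Lemma pattern_weight_ge0 n nu : 0 <= pattern_weight n nu.
Proof. by rewrite mulr_ge0 ?prodr_ge0// => *; exact: clamp_ge0. Qed.

Lemma pattern_weight_le1 n nu : pattern_weight n nu <= 1.
Proof.
rewrite mulr_ile1 ?clamp_ge0 ?clamp_le1 ?prodr_ge0//.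
  by move=> *; exact: clamp_ge0.
by apply: prodr_ile1 => i _; rewrite clamp_ge0 clamp_le1.
Qed.

Lemma pattern_weight_continuous n : continuous (pattern_weight n).
Proof.
have ct phi : continuous (fun nu : point_measure (R := R) (@strip R) =>
    clamp (test_integrals nu phi)).
  exact: (@clamp_continuous R _ (fun nu => test_integrals nu phi : R)
    (@test_integrals_continuous R _ _ phi)).
apply: continuousM_fun; first by apply: continuous_prod_seq => i; exact: ct.
apply: (@clamp_continuous R _ (fun nu => k.+1%:R - test_integrals nu (outer n) : R)).
apply: continuousB_fun; first by move=> nu; exact: cst_continuous.
exact: test_integrals_continuous.
Qed.

Let inner_le i n p : @strip R p -> inner i n p <= \1_(Q i) p.
Proof.
move=> _; rewrite indicE /inner /=; case: (boolP (p \in Q i)) => [_|/negP np].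
  exact: clamp_le1.
rewrite inner_bump_eq0//; apply: contra_not np; exact: mem_set.
Qed.

Let outer_le n p : @strip R p -> outer n p <= \1_(window (M + 1)) p.
Proof.
move=> sp; rewrite indicE /outer /=.
case: (boolP (p \in window (M + 1))) => [_|/negP np].
  exact: clamp_le1.
rewrite outer_bump_eq0//; apply: contra_not np; exact: mem_set.
Qed.

Let WS : W `<=` window (M + 1).
Proof.
move=> p [/=]; rewrite !in_itv/= => /andP[p0 pM] p1.
by split; rewrite /= in_itv//= p0 (le_trans pM)// lerDl.
Qed.

Let outer_ge n p : @strip R p -> \1_W p <= outer n p.
Proof.
move=> _; rewrite indicE; case: (boolP (p \in W)) => [/set_mem[/=]|_].
  rewrite in_itv /= => /andP[p0 pM] _; rewrite /outer_bump clamp_id_ge1//.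
  by rewrite lerDl oppr_ge0 pmulr_rle0// subr_le0.
exact: clamp_ge0.
Qed.

Lemma pattern_weight_gt0 n nu : 0 < pattern_weight n nu ->
  (forall i, (0 < pm_measure nu (Q i))%E) /\
  (pm_measure nu W < k.+1%:R%:E)%E.
Proof.
have p0 : 0 <= \prod_(i < k) clamp (test_integrals nu (inner i n)).
  by apply: prodr_ge0 => i _; exact: clamp_ge0.
rewrite /pattern_weight => h.
have h1 : 0 < \prod_(i < k) clamp (test_integrals nu (inner i n)).
  by rewrite lt_neqAle p0 andbT; apply/eqP => z; rewrite -z mul0r ltxx in h.
have h2 : 0 < clamp (k.+1%:R - test_integrals nu (outer n)).
  by move: h; rewrite pmulr_rgt0.
split=> [i|].
  have : clamp (test_integrals nu (inner i n)) != 0.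
    by move: h1; rewrite lt0r => /andP[/prodf_neq0/(_ i isT)].
  move=> ci; have {ci} ti : 0 < test_integrals nu (inner i n).
    by apply: clamp_gt0; rewrite lt_neqAle eq_sym ci clamp_ge0.
  apply: (@lt_le_trans _ _ (test_integrals nu (inner i n))%:E).
    by rewrite lte_fin.
  apply: test_integrals_le => //; [exact: closed_strip| |exact: inner_le].
  by apply: subset_trans (@window_strip _ M); exact: QW.
apply: (@le_lt_trans _ _ (test_integrals nu (outer n))%:E); last first.
  by rewrite lte_fin -subr_gt0; exact: clamp_gt0.
apply: (@test_integrals_ge _ _ _ _ nu _ _ (window (M + 1))) => //.
- exact: closed_strip.
- exact: window_strip.
- exact: window_strip.
- exact: compact_window.
- exact: closed_window.
- exact: outer_le.
- exact: outer_ge.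
Qed.

Let pattern_weight_cvg nu : pattern_weight n nu @[n --> \oo] --> limit_weight nu.
Proof.
apply: cvgM.
  apply: cvg_prod_seq => i; apply: clamp_cvg.
  apply: (@test_integrals_cvg _ _ _ _ nu (inner i) (Q i) W) => //.
  - exact: closed_strip.
  - exact: window_strip.
  - exact: compact_window.
  - exact: closed_window.
  - move=> n p sp; apply: le_trans (inner_le _ _ sp) _.
    rewrite !indicE ler_nat; case: (boolP (p \in Q i)) => // /set_mem Qp.
    by rewrite mem_set//; exact: QW Qp.
  - move=> p _; rewrite /inner /= /inner_bump.
    have := @clamp_dilate_cvg R (depth (a i) (b i) (c i) (e i) p).
    suff -> : (0 < depth (a i) (b i) (c i) (e i) p)%R = (p \in Q i) by [].
    by apply/idP/idP => [/depth_gt0/mem_set//|/set_mem/depth_gt0].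
apply: clamp_cvg; apply: cvgB; first exact: cvg_cst.
apply: (@test_integrals_cvg _ _ _ _ nu outer W (window (M + 1))) => //.
- exact: closed_strip.
- exact: window_strip.
- exact: compact_window.
- exact: closed_window.
- move=> p [sp1 sp2]; rewrite /outer /= /outer_bump.
  have := @clamp_one_minus_dilate_cvg R (p.1 - M).
  suff -> : (p.1 - M <= 0)%R = (p \in W) by [].
  rewrite subr_le0; move: sp1 sp2; rewrite /= !in_itv /= andbT => sp1 sp2.
  apply/idP/idP => [pM|/set_mem[/=]]; last by rewrite in_itv /= => /andP[].
  by apply: mem_set; split; rewrite /= in_itv /= ?sp1.
Qed.

Let pm_fin (nu : point_measure (R := R) (@strip R)) (A : set (R * R)) : measurable (A : set (borel (R * R)%type)) ->
  A `<=` W -> pm_measure nu A \is a fin_num.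
Proof.
move=> mA AW; rewrite ge0_fin_numE ?measure_ge0//.
apply: (@le_lt_trans _ _ (pm_measure nu W)).
  by apply: le_measure; rewrite ?inE.
by have [_] := pm_axiom nu; apply; [exact: window_strip|exact: compact_window].
Qed.

(* Masses at least 1 in k disjoint sets and total mass at most k leave no
   freedom. *)
Let limit_weight_eq1 nu : limit_weight nu = 1 <->
  (forall i, pm_measure nu (Q i) = 1%E) /\ pm_measure nu (W `\` UQ) = 0%E.
Proof.
have finQ i : pm_measure nu (Q i) \is a fin_num by exact: pm_fin.
have finR : pm_measure nu (W `\` UQ) \is a fin_num.
  by apply: pm_fin => [|p []//]; exact: measurableD.
have nuW : fine (pm_measure nu W) =
    \sum_(i < k) fine (pm_measure nu (Q i)) + fine (pm_measure nu (W `\` UQ)).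
  have : pm_measure nu W = (pm_measure nu UQ + pm_measure nu (W `\` UQ))%E.
    rewrite -measureU//; [|exact: measurableD|exact: setDIK].
    by rewrite setDUK.
  have -> : pm_measure nu UQ = (\sum_(i < k) pm_measure nu (Q i))%E.
    rewrite UQE; exact: (measure_bigsetU_ord (pm_measure nu) xpredT mQ disjQ).
  move=> ->; under eq_bigr do rewrite -(fineK (finQ _)).
  by rewrite sumEFin -(fineK finR) -EFinD.
have W_ge0 : 0 <= fine (pm_measure nu (W `\` UQ)) by exact: fine_ge0.
split=> [h|[Q1 R0]]; last first.
  rewrite /limit_weight nuW R0; under eq_bigr do rewrite Q1 clamp_id_ge1//.
  rewrite big1_eq mul1r; under eq_bigr do rewrite Q1.
  by rewrite sumr_const card_ord addr0 -natrB// subSnn clamp_id_ge1.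
have p1 : \prod_(i < k) clamp (fine (pm_measure nu (Q i))) <= 1.
  by apply: prodr_ile1 => i _; rewrite clamp_ge0 clamp_le1.
have c1 : clamp (k.+1%:R - fine (pm_measure nu W)) = 1.
  apply/eqP; rewrite eq_le clamp_le1 /= -[leLHS]h /limit_weight ler_piMl//.
  exact: clamp_ge0.
have q1 i : 1 <= fine (pm_measure nu (Q i)).
  apply: clamp_eq1; apply/eqP; rewrite eq_le clamp_le1 /= -[leLHS]h.
  rewrite /limit_weight c1 mulr1 (bigD1 i)//= ler_piMr ?clamp_ge0//.
  by apply: prodr_ile1 => j _; rewrite clamp_ge0 clamp_le1.
move/clamp_eq1: c1; rewrite nuW => c1.
have sumQ : \sum_(i < k) (fine (pm_measure nu (Q i)) - 1) + fine (pm_measure nu (W `\` UQ)) <= 0.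
  rewrite big_split /= sumrN sumr_const card_ord.
  by move: c1; rewrite -natr1; lra.
have sQ_ge0 : 0 <= \sum_(i < k) (fine (pm_measure nu (Q i)) - 1).
  by apply: sumr_ge0 => i _; rewrite subr_ge0.
split; last first.
  by rewrite -(fineK finR); congr EFin; apply/eqP; rewrite eq_le W_ge0 andbT; lra.
move=> i; rewrite -(fineK (finQ i)); congr EFin; apply/eqP.
rewrite eq_le q1 andbT -subr_le0.
apply: (@le_trans _ _ (\sum_(i < k) (fine (pm_measure nu (Q i)) - 1))); last lra.
rewrite [leRHS](bigD1 i)//= lerDl; apply: sumr_ge0 => j _.
by rewrite subr_ge0.
Qed.

Let weight_measurable n : measurable_fun setT (fun w => pattern_weight n (N w)).
Proof.
have [mN _] := poissonN.
apply: (@measurableT_comp _ _ _ _ (borel (point_measure (R := R) (@strip R))) _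
  (pattern_weight n) _ N) => //.
apply: (@continuous_borel R); exact: pattern_weight_continuous.
Qed.

(** The weights tend to a function that equals [1] on the event of
    [poisson_pattern_prob], so that their expectations eventually exceed any smaller
    number than its probability. *)
Lemma pattern_weight_expectation (eps : R) : 0 < eps ->
  exists n, kappa ^+ k * expR (- M) - eps <=
            \int[P0]_w pattern_weight n (N w).
Proof.
move=> eps0.
have cvw w : pattern_weight n (N w) @[n --> \oo] --> limit_weight (N w).
  exact: pattern_weight_cvg.
have mlim : measurable_fun setT (fun w => limit_weight (N w)).
  by apply: (@measurable_fun_cvg _ _ _ _ (fun n w => pattern_weight n (N w))).
have limit_bounded nu : 0 <= limit_weight nu <= 1.
  apply/andP; split.
    by rewrite mulr_ge0 ?clamp_ge0 ?prodr_ge0// => *; exact: clamp_ge0.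
  rewrite mulr_ile1 ?clamp_ge0 ?clamp_le1 ?prodr_ge0//.
    by move=> *; exact: clamp_ge0.
  by apply: prodr_ile1 => i _; rewrite clamp_ge0 clamp_le1.
have cvi := @bounded_convergence _ _ _ P0
  (fun n w => pattern_weight n (N w)) (fun w => limit_weight (N w)) 1
  weight_measurable mlim
  (fun n w => introT andP (conj (pattern_weight_ge0 n (N w)) (pattern_weight_le1 n (N w))))
  (aeW P0 cvw) (fun w => limit_bounded (N w)).
have limE : kappa ^+ k * expR (- M) <= \int[P0]_w limit_weight (N w).
  have patE : pattern = (fun w => limit_weight (N w)) @^-1` [set 1].
    by apply/seteqP; split => w /limit_weight_eq1.
  have mpat : measurable pattern.
    by rewrite patE -[_ @^-1` _]setTI; exact: mlim.
  rewrite -lee_fin -poisson_pattern_prob (@RintegralE _ _ _ P0 _ 1); last 2 first.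
  - by move=> w; have /andP[] := limit_bounded (N w).
  - by move=> w; have /andP[] := limit_bounded (N w).
  rewrite -[pattern]setIT -(integral_indic P0 measurableT mpat).
  apply: le_integral_lower => w; first by rewrite indicE.
  rewrite indicE; case: (boolP (w \in pattern)) => [|_].
    by rewrite patE => /set_mem ->.
  by have /andP[] := limit_bounded (N w).
have lt : kappa ^+ k * expR (- M) - eps < \int[P0]_w limit_weight (N w).
  by apply: lt_le_trans limE; rewrite ltrBlDr ltrDl.
have [n _ /(_ n (leqnn n)) /= h] := cvgr_gt _ cvi _ lt.
by exists n; exact: ltW.
Qed.

End poisson_pattern.

(** * Counting words by record pattern *)

Section words.
Local Open Scope nat_scope.

(** The words of length [k] over [s], generated by their last letters because records
    depend on what precedes them. *)
Definition extensions (A : Type) (s : seq A) (k : nat) : seq (seq A) :=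
  iter k (fun ws => [seq rcons w o | w <- ws, o <- s]) [:: [::]].

Lemma extensions_uniq (A : eqType) (s : seq A) k :
  uniq s -> uniq (extensions s k).
Proof.
move=> us; elim: k => // k ih.
apply: allpairs_uniq => // -[w o] [w' o'] _ _ /= /rcons_inj[-> ->] //.
Qed.

Lemma extensionsP (A : eqType) (s : seq A) k (w : seq A) :
  reflect (size w = k /\ {subset w <= s}) (w \in extensions s k).
Proof.
elim: k w => [|k ih] w.
  rewrite inE; apply: (iffP eqP) => [->//|[/size0nil]//].
apply: (iffP allpairsP) => [[[w' o] /= [/ih[sw ws] os ->]]|[]].
  split; first by rewrite size_rcons sw.
  by move=> x; rewrite mem_rcons inE => /predU1P[->//|/ws].
case/lastP: w => // w o; rewrite size_rcons => -[sw] ws.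
exists (w, o); split => //=.
  by apply/ih; split => // x xw; apply: ws; rewrite mem_rcons inE xw orbT.
by apply: ws; rewrite mem_rcons inE eqxx.
Qed.

Lemma big_extensionsS (V : nmodType) (A : Type) (s : seq A) k (F : seq A -> V) :
  (\sum_(w <- extensions s k.+1) F w =
   \sum_(w <- extensions s k) \sum_(o <- s) F (rcons w o))%R.
Proof. by rewrite /extensions iterS big_allpairs_dep. Qed.

Definition levels (w : seq (option nat)) : seq nat := pmap id w.

Lemma levels_rcons w o :
  levels (rcons w o) = if o is Some x then rcons (levels w) x else levels w.
Proof.
by rewrite /levels -cats1 pmap_cat /=; case: o => [x|] /=; rewrite ?cats1 ?cats0.
Qed.

(** A level word tells, for each column of the grid, the level of its point, if any;
    a record word tells whether that point is a record. *)
Definition level_words q := extensions (None :: map Some (iota 0 q)).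

Definition record_words := extensions [:: None; Some true; Some false].

Definition records (w : seq (option nat)) : seq (option bool) :=
  mkseq (fun i => omap (fun v => all (ltn v) (levels (take i w))) (nth None w i))
    (size w).

Lemma size_records w : size (records w) = size w.
Proof. exact: size_mkseq. Qed.

Lemma nth_records w i : nth None (records w) i =
  omap (fun v => all (ltn v) (levels (take i w))) (nth None w i).
Proof.
case: (ltnP i (size w)) => iw; first by rewrite nth_mkseq.
by rewrite !nth_default// size_records.
Qed.

Lemma records_rcons w o : records (rcons w o) =
  rcons (records w) (omap (fun v => all (ltn v) (levels w)) o).
Proof.
rewrite /records size_rcons mkseqS; congr rcons; last first.
  by rewrite nth_rcons ltnn eqxx -cats1 take_size_cat.
apply/eq_in_map => i; rewrite mem_iota /= add0n => iw.
by rewrite nth_rcons iw -cats1 takel_cat// ltnW.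
Qed.

Definition occupied (A : Type) (y : seq (option A)) := count isSome y.

Lemma occupied_rcons (A : Type) (y : seq (option A)) o :
  occupied (rcons y o) = occupied y + isSome o.
Proof. by rewrite /occupied -cats1 count_cat /= addn0. Qed.

Lemma size_levels w : size (levels w) = occupied w.
Proof. by rewrite /levels size_pmap. Qed.

Lemma occupied_records w : occupied (records w) = occupied w.
Proof.
elim/last_ind: w => // w o ih; rewrite records_rcons !occupied_rcons ih.
by case: o.
Qed.

(** The number of permutations whose record pattern is [y]: the [l]-th entry
    is a record for [1] and not a record for [l - 1] of its relative ranks. *)
Fixpoint rank_choices (l : nat) (y : seq (option bool)) : nat :=
  match y with
  | [::] => 1
  | None :: y' => rank_choices l y'
  | Some z :: y' => (if z then 1 else l) * rank_choices l.+1 y'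
  end.

Lemma rank_choices_rcons l y o : rank_choices l (rcons y o) =
  rank_choices l y * (if o is Some false then l + occupied y else 1).
Proof.
elim: y l => [|[z|] y ih] l /=.
- by case: o => [[]|]; rewrite /occupied /= ?mul1n ?muln1 ?addn0.
- by rewrite ih mulnA addSnnS.
- by rewrite ih.
Qed.

(** The lower bound [v] on the levels makes the induction possible: when the last
    point is a record, it bounds all the other levels from below. *)
Definition word_count q v (y : seq (option bool)) : nat :=
  \sum_(w <- level_words q (size y))
    [&& uniq (levels w), records w == y & all (leq v) (levels w)].

Lemma hockey_stick q v n : v <= q ->
  \sum_(v <= x < q) 'C(q - x.+1, n) = 'C(q - v, n.+1).
Proof.
move=> vq; rewrite -[in LHS](subnK vq).
move: (q - v) => k; elim: k v {vq} => [|k ih] v; first by rewrite big_geq// bin0n.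
rewrite big_ltn; last by rewrite addSn ltnS leq_addl.
rewrite addSn subSS addnK binS addnC; congr (_ + _).
by rewrite -addnS; exact: ih.
Qed.

Lemma mem_levels x w : (x \in levels w) = (Some x \in w).
Proof. by rewrite /levels mem_pmap map_id. Qed.

Lemma level_words_lt q L w x : w \in level_words q L -> x \in levels w -> x < q.
Proof.
move=> /extensionsP[_ ws]; rewrite mem_levels => /ws.
by rewrite inE /= (mem_map Some_inj) mem_iota.
Qed.

Lemma unused_levels q v (s : seq nat) : v <= q -> uniq s ->
  (forall x, x \in s -> v <= x < q) ->
  \sum_(v <= x < q) (x \notin s) = q - v - size s.
Proof.
move=> vq us sq; suff <- : \sum_(v <= x < q) (x \in s) = size s.
  rewrite -[X in X - _](_ : \sum_(v <= x < q) 1 = _); last first.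
    by rewrite sum_nat_const_nat muln1.
  rewrite -sumnB; last by move=> x _; case: (_ \in _).
  by apply: eq_bigr => x _; case: (_ \in _).
rewrite -big_mkcond /= sum1_count -size_filter.
apply/perm_size/uniq_perm => //; first by rewrite filter_uniq// iota_uniq.
move=> x; rewrite mem_filter mem_index_iota andb_idr//; exact: sq.
Qed.

(* the last column of a word is empty, or its point sits at a level that is
   not used yet *)
Let word_count_rcons q v y o : v <= q -> word_count q v (rcons y o) =
  \sum_(w <- level_words q (size y))
   ([&& uniq (levels w), records w == y, all (leq v) (levels w) & o == None] +
    \sum_(v <= x < q)
      [&& uniq (levels w), records w == y, all (leq v) (levels w),
       x \notin levels w & o == Some (all (ltn x) (levels w))]).
Proof.
move=> vq; rewrite /word_count size_rcons /level_words big_extensionsS.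
apply: eq_bigr => w _; rewrite big_cons big_map; congr (_ + _).
  rewrite levels_rcons records_rcons eqseq_rcons /= (eq_sym None).
  by rewrite -andbA [(o == None) && _]andbC.
rewrite (_ : iota 0 q = index_iota 0 q); last by rewrite /index_iota subn0.
rewrite (@big_cat_nat _ _ _ v)//= big_nat big1 ?add0n => [|x /andP[_ xv]].
  rewrite !big_nat; apply: eq_bigr => x /andP[vx _].
  rewrite levels_rcons records_rcons eqseq_rcons rcons_uniq all_rcons /= vx.
  rewrite (eq_sym o) /=; case: (uniq _); last by rewrite andbF.
  case: (records w == y); last by rewrite !andbF.
  by rewrite andbT /= andbA andbC.
by rewrite levels_rcons all_rcons leqNgt xv !andbF.
Qed.

(** Renyi's theorem in combinatorial form. If the last point is a record at level [x],
    the rest of the word has its levels above [x], and summing over [x] is the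
    hockey-stick identity; all the remaining choices of a fresh level give a point
    which is not a record. *)
Lemma word_countE q v y : v <= q ->
  word_count q v y = 'C(q - v, occupied y) * rank_choices 0 y.
Proof.
elim/last_ind: y v => [|y o ih] v vq.
  by rewrite /word_count big_seq1 bin0.
have last_level z : \sum_(w <- level_words q (size y)) \sum_(v <= x < q)
    [&& uniq (levels w), records w == y, all (leq v) (levels w),
       x \notin levels w & Some z == Some (all (ltn x) (levels w))] =
    word_count q v (rcons y (Some z)).
  rewrite word_count_rcons//; apply: eq_bigr => w _.
  by rewrite /= !andbF.
have countT : word_count q v (rcons y (Some true)) =
    'C(q - v, (occupied y).+1) * rank_choices 0 y.
  rewrite -last_level exchange_big /= -hockey_stick// big_distrl /= !big_nat.
  apply: eq_bigr => x /andP[vx xq]; rewrite -ih//.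
  apply: eq_bigr => w _; congr nat_of_bool; congr (_ && (_ && _)).
  apply/idP/idP => [/and3P[_ _ /eqP[<-]//]|xw].
  apply/and3P; split; last by rewrite xw.
    by apply/allP => u /(allP xw)/= xu; rewrite (leq_trans vx)// ltnW.
  by apply/negP => /(allP xw)/=; rewrite ltnn.
have countTF : word_count q v (rcons y (Some true)) +
    word_count q v (rcons y (Some false)) =
    'C(q - v, occupied y) * rank_choices 0 y * (q - v - occupied y).
  rewrite -!last_level -big_split -ih// big_distrl /= !big_seq.
  apply: eq_bigr => w wq; rewrite -big_split /=.
  case: (boolP (uniq _)) => [uw|_]; last by rewrite /= big1.
  case: (boolP (records w == y)) => [/eqP rw|_]; last by rewrite /= big1.
  case: (boolP (all _ _)) => [vw|_]; last by rewrite /= big1.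
  rewrite /= mul1n -rw occupied_records -size_levels -unused_levels//.
    apply: eq_bigr => x _; case: (x \notin _) => //=.
    by case: (all _ _).
  by move=> x xw; rewrite (allP vw) //=; exact: level_words_lt wq xw.
case: o => [[]|].
- by rewrite countT rank_choices_rcons occupied_rcons muln1 addn1.
- rewrite rank_choices_rcons occupied_rcons addn1 add0n.
  move: countTF; rewrite countT.
  have := mul_bin_left (q - v) (occupied y).
  nia.
- rewrite word_count_rcons// rank_choices_rcons occupied_rcons muln1 addn0 -ih//.
  apply: eq_bigr => w _; rewrite eqxx andbT big1 ?addn0// => x _.
  by rewrite !andbF.
Qed.

End words.

Section record_law.
Context {R : realType}.
Implicit Types (y : seq (option bool)) (w : seq (option nat)).

(** The probability that independent Bernoulli variables of parameters [1 / l.+1],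
    [1 / l.+2], ... take the successive marks of [y]; at [l = 0] the first point is a
    record almost surely. *)
Fixpoint record_law (l : nat) y : R :=
  match y with
  | [::] => 1
  | None :: y' => record_law l y'
  | Some z :: y' =>
    (if z then l.+1%:R^-1 else l%:R / l.+1%:R) * record_law l.+1 y'
  end.

Lemma record_law_rcons l y o : record_law l (rcons y o) =
  record_law l y * (if o is Some z then
    if z then (l + occupied y).+1%:R^-1
    else (l + occupied y)%:R / (l + occupied y).+1%:R else 1).
Proof.
elim: y l => [|[z|] y ih] l /=.
- by case: o => [z|]; rewrite /occupied /= ?addn0 ?mulr1 ?mul1r.
- by rewrite ih mulrA /occupied /= addnA addn1.
- by rewrite ih.
Qed.

Lemma record_law_ge0 l y : 0 <= record_law l y.
Proof.
elim: y l => [|[z|] y ih] l //=; rewrite mulr_ge0//.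
by case: z; rewrite ?divr_ge0.
Qed.

(** A point preceded by [l] others has [l + 1] possible relative ranks, whence the
    factorial. *)
Lemma rank_choicesE y :
  (rank_choices 0 y)%:R = record_law 0 y * ((occupied y)`!)%:R :> R.
Proof.
elim/last_ind: y => [|y o ih]; first by rewrite mul1r.
rewrite rank_choices_rcons record_law_rcons occupied_rcons natrM ih !add0n.
case: o => [z|]; last by rewrite addn0 !mulr1.
rewrite addn1 factS natrM.
have n0 : (occupied y).+1%:R != 0 :> R by rewrite pnatr_eq0.
by case: z; field.
Qed.

(** Given its past, an occupied last column is a record or not with probabilities
    adding up to [1]; each column thus contributes a factor [1 + delta]. *)
Lemma record_law_total (delta : R) L :
  \sum_(y <- record_words L) delta ^+ occupied y * record_law 0 y =
  (1 + delta) ^+ L.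
Proof.
elim: L => [|L ih]; first by rewrite big_seq1 mulr1.
rewrite big_extensionsS exprSr -ih big_distrl /=; apply: eq_bigr => y _.
rewrite big_cons big_cons big_seq1 !record_law_rcons !occupied_rcons.
rewrite addn0 addn1 !add0n exprS.
have n0 : (occupied y).+1%:R != 0 :> R by rewrite pnatr_eq0.
have n1 : (occupied y)%:R = (occupied y).+1%:R - 1 :> R by rewrite -natr1 addrK.
by rewrite n1; field.
Qed.

(** The probability that [n] uniform levels among [q] are distinct. *)
Lemma ffact_bound (q n : nat) : (0 < q)%N ->
  (1 - (n%:R ^+ 2) / q%:R) * q%:R ^+ n <= (q ^_ n)%:R :> R.
Proof.
move=> q0; have qR0 : 0 < q%:R :> R by rewrite ltr0n.
elim: n => [|n ih]; first by rewrite expr0n mul0r subr0 mul1r.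
case: (ltnP q n.+1) => qn.
  apply: (@le_trans _ _ 0) => //; apply: mulr_le0_ge0; last first.
    by rewrite exprn_ge0// ltW.
  rewrite subr_le0 ler_pdivlMr// mul1r -natrX ler_nat.
  by rewrite (leq_trans (ltnW qn))// expnS leq_pmulr// expn_gt0.
rewrite ffactnSr natrM natrB ?(ltnW qn)//.
apply: (@le_trans _ _ ((1 - n%:R ^+ 2 / q%:R) * q%:R ^+ n * (q%:R - n%:R))); last first.
  by apply: ler_wpM2r => //; rewrite subr_ge0 ler_nat ltnW.
rewrite [in leLHS](exprS q%:R) [in leLHS]mulrA [in leRHS]mulrAC.
apply: ler_wpM2r; first by rewrite exprn_ge0// ltW.
rewrite -natr1.
have -> : (1 - (n%:R + 1) ^+ 2 / q%:R) * q%:R = q%:R - (n%:R + 1) ^+ 2 :> R.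
  by field; rewrite gt_eqF.
have -> : (1 - n%:R ^+ 2 / q%:R) * (q%:R - n%:R) =
    q%:R - n%:R - n%:R ^+ 2 + n%:R ^+ 3 / q%:R :> R.
  by field; rewrite gt_eqF.
have : 0 <= n%:R ^+ 3 / q%:R :> R by rewrite divr_ge0// exprn_ge0.
have : 0 <= n%:R :> R by [].
nra.
Qed.

(** Uniform levels produce a record pattern with the probability given by the
    Bernoulli variables, up to the probability that two points share a level. *)
Lemma record_pattern_weight (F : seq (option bool) -> R) (delta : R) q L :
  (0 < q)%N -> 0 <= delta -> (forall y, 0 <= F y) ->
  (1 - L%:R ^+ 2 / q%:R) *
    \sum_(y <- record_words L) F y * (delta ^+ occupied y * record_law 0 y) <=
  \sum_(w <- level_words q L | uniq (levels w))
    F (records w) * (delta / q%:R) ^+ occupied w.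
Proof.
move=> q0 delta0 F0; have qR0 : 0 < q%:R :> R by rewrite ltr0n.
have -> : \sum_(w <- level_words q L | uniq (levels w))
    F (records w) * (delta / q%:R) ^+ occupied w =
  \sum_(y <- record_words L)
    (word_count q 0 y)%:R * (F y * (delta / q%:R) ^+ occupied y).
  rewrite [RHS]big_seq.
  under [RHS]eq_bigr => y /extensionsP[sy _].
    rewrite /word_count sy natr_sum big_distrl /=; over.
  rewrite -big_seq exchange_big /= big_seq_cond [RHS]big_seq big_mkcondr /=.
  apply: eq_bigr => w wL.
  have yL : records w \in record_words L.
    apply/extensionsP; split.
      by rewrite size_records; have [] := extensionsP _ _ _ wL.
    by move=> [[]|] _.
  have uL : uniq (record_words L) by exact: extensions_uniq.
  rewrite (bigD1_seq (records w))//= eqxx big1 ?addr0 => [|y /negbTE nyw].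
    have -> : all (leq 0) (levels w) by apply/allP.
    by rewrite andbT occupied_records; case: (uniq _); rewrite ?mul1r ?mul0r.
  by rewrite eq_sym nyw andbF mul0r.
rewrite big_distrr /= !big_seq; apply: ler_sum => y /extensionsP[sy _].
rewrite word_countE// subn0 natrM rank_choicesE.
have nL : (occupied y <= L)%N by rewrite -sy count_size.
set n := occupied y in nL *.
have := ffact_bound n q0; rewrite -bin_ffact natrM => hq.
have q1 : (1 - L%:R ^+ 2 / q%:R) * q%:R ^+ n <= ('C(q, n))%:R * (n`!)%:R :> R.
  apply: le_trans hq; apply: ler_wpM2r; first by rewrite exprn_ge0// ltW.
  rewrite lerD2l lerN2 ler_pM2r ?invr_gt0//.
  by rewrite lerXn2r ?nnegrE// ler_nat.
have -> : 'C(q, n)%:R * (record_law 0 y * (n`!)%:R) * (F y * (delta / q%:R) ^+ n) =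
  F y * (delta ^+ n * record_law 0 y) * ('C(q, n)%:R * (n`!)%:R / q%:R ^+ n) :> R.
  by rewrite exprMn exprVn; ring.
rewrite mulrC; apply: ler_wpM2l.
  by rewrite !mulr_ge0 ?exprn_ge0 ?record_law_ge0.
by rewrite ler_pdivlMr// exprn_gt0.
Qed.

End record_law.

(** * The limit process on a grid *)

Section scan.
Context {R : realType} (delta : R).
Implicit Types (x : nat -> R) (z : nat -> bool) (y : seq (option bool)).

(** The columns of width [delta] hit by the points with gaps [x] and marks [z], each
    gap being rounded up to a multiple of [delta], which keeps the points in distinct
    columns and the gaps independent; [r] columns have been seen since the last point,
    and [l] points before. The next [k] columns are read. *)
Fixpoint scan x z (k l r : nat) : seq (option bool) :=
  if k is k'.+1 then
    if r%:R * delta < x l <= r.+1%:R * delta then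
      Some (z l) :: scan x z k' l.+1 0
    else None :: scan x z k' l r.+1
  else [::].

Lemma size_scan x z k l r : size (scan x z k l r) = k.
Proof. by elim: k l r => //= k ih l r; case: ifP => _ /=; rewrite ih. Qed.

Lemma scan_record_words x z k l r : scan x z k l r \in record_words k.
Proof.
apply/extensionsP; split; first exact: size_scan.
by move=> [[]|] _.
Qed.

(** That the gaps are scanned as [y] is a condition on each gap separately; the last
    interval expresses that no further point occurs. *)
Fixpoint gaps (r : nat) y : seq (interval R) :=
  match y with
  | [::] => [:: `]r%:R * delta, +oo[]
  | None :: y' => gaps r.+1 y'
  | Some _ :: y' => `]r%:R * delta, r.+1%:R * delta] :: gaps 0 y'
  end.

Definition marks y : seq bool := pmap id y.

Hypothesis delta_gt0 : 0 < delta.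

Lemma gaps_gt r y t : t \in nth `]-oo, +oo[ (gaps r y) 0 -> r%:R * delta < t.
Proof.
elim: y r => [|[z|] y ih] r /=; first by rewrite in_itv /= andbT.
  by rewrite in_itv /= => /andP[].
by move=> /ih; apply: le_lt_trans; rewrite ler_pM2r// ler_nat.
Qed.

Lemma scan_gaps x z l r y :
  (forall i, x (l + i)%N \in nth `]-oo, +oo[ (gaps r y) i) ->
  (forall i, (i < size (marks y))%N -> nth true (marks y) i = z (l + i)%N) ->
  scan x z (size y) l r = y.
Proof.
elim: y l r => //= -[b|] y ih l r xg zm /=.
  have := xg 0%N; rewrite addn0 /= in_itv /= => ->.
  have /= -> := zm 0%N isT; rewrite addn0 ih// => i.
    by rewrite addSnnS; exact: (xg i.+1).
  by move=> im; rewrite addSnnS; exact: (zm i.+1).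
have /gaps_gt := xg 0%N; rewrite addn0 ltNge => /negbTE ->.
by rewrite andbF ih.
Qed.

End scan.

Section scan_measurable.
Context {R : realType} (delta : R) d (T : measurableType d).
Variables (X : nat -> T -> R) (Z : nat -> T -> bool).
Hypotheses (mX : forall i, measurable_fun setT (X i))
  (mZ : forall i, measurable_fun setT (Z i)).

Lemma scan_measurable (F : seq (option bool) -> R) k l r :
  measurable_fun setT (fun w => F (scan delta (X ^~ w) (Z ^~ w) k l r)).
Proof.
elim: k l r F => [|k ih] l r F /=; first exact: measurable_cst.
rewrite (_ : (fun w => _) = fun w =>
  if r%:R * delta < X l w <= r.+1%:R * delta then
    if Z l w then F (Some true :: scan delta (X ^~ w) (Z ^~ w) k l.+1 0)
    else F (Some false :: scan delta (X ^~ w) (Z ^~ w) k l.+1 0)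
  else F (None :: scan delta (X ^~ w) (Z ^~ w) k l r.+1)); last first.
  by apply/funext => w; case: ifP => // _; case: (Z l w).
apply: measurable_fun_ifT.
- by apply: measurable_and; [exact: measurable_fun_ltr|exact: measurable_fun_ler].
- apply: measurable_fun_ifT => //.
    exact: (ih _ _ (fun y => F (Some true :: y))).
  exact: (ih _ _ (fun y => F (Some false :: y))).
- exact: (ih _ _ (fun y => F (None :: y))).
Qed.

End scan_measurable.

Lemma sigma_generated_bigcap d (T : measurableType d)
    d' (S : measurableType d') (X : nat -> T -> S) (A : nat -> set S) :
  (forall i, measurable (A i)) ->
  sigma_generated X (\bigcap_i (X i @^-1` A i)).
Proof.
move=> mA.
pose G : set (set T) := \bigcup_i preimage_set_system setT (X i) measurable.
suff : measurable (\bigcap_i (X i @^-1` A i) : set (g_sigma_algebraType G)).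
  by [].
apply: bigcap_measurableType => i _; apply: sub_sigma_algebra.
by exists i => //; exists (A i) => //; rewrite setTI.
Qed.

Section exponential_gaps.
Context {R : realType} d (T : measurableType d) (P : probability T R).
Variable X : nat -> {RV P >-> R}.
Hypothesis lawX : forall i A, measurable A ->
  distribution P (X i) A = exponential_prob 1 A.

Lemma exponential_le0 i : P (X i @^-1` `]-oo, 0]) = 0%E.
Proof.
rewrite -[LHS]/(distribution P (X i) `]-oo, 0]%classic) lawX//.
rewrite /exponential_prob -integral_itv_bndo_bndc; last first.
  apply: measurable_funTS; apply/measurable_EFinP.
  exact: measurable_exponential_pdf.
apply: integral0_eq => x /=; rewrite in_itv /= => x0.
by rewrite /exponential_pdf patchE ifF// memNset//= in_itv /= andbT leNgt x0.
Qed.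

Let meas i (j : interval R) : measurable (X i @^-1` [set` j]).
Proof.
have mXi : measurable_fun setT (X i) by exact: measurable_funPT.
by rewrite -[_ @^-1` _]setTI; apply: mXi => //; exact: measurable_itv.
Qed.

Lemma exponential_le i t : 0 <= t ->
  P (X i @^-1` `]-oo, t]) = (1 - expR (- t))%:E.
Proof.
rewrite le_eqVlt => /predU1P[<-|t0].
  by rewrite exponential_le0 oppr0 expR0 subrr.
have split_le : X i @^-1` `]-oo, t] =
    (X i @^-1` `]-oo, 0[) `|` (X i @^-1` `[0, t]).
  rewrite -preimage_setU; congr (_ @^-1` _).
  apply/seteqP; split => x /=; rewrite !in_itv /=.
    by move=> ->; rewrite andbT; case: (ltP x 0); [left|right].
  by move=> [x0|/andP[]//]; rewrite ltW// (lt_trans x0).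
have U : P ((X i @^-1` `]-oo, 0[) `|` (X i @^-1` `[0, t])) =
    (P (X i @^-1` `]-oo, 0%R[) + P (X i @^-1` `[0%R, t]))%E.
  apply: measureU; [exact: meas|exact: meas|].
  rewrite -preimage_setI; apply/seteqP; split => x //=.
  by rewrite !in_itv /= => -[x0 /andP[]]; rewrite leNgt x0.
have P0 : P (X i @^-1` `]-oo, 0[) = 0%E.
  apply/eqP; rewrite eq_le; apply/andP; split; last exact: measure_ge0.
  rewrite -(exponential_le0 i).
  apply: le_measure; rewrite ?inE; [exact: meas|exact: meas|].
  apply: preimage_subset => x /=.
  by rewrite !in_itv /=; exact: ltW.
have Pt : P (X i @^-1` `[0, t]) = (1 - expR (- t))%:E.
  rewrite -[LHS]/(distribution P (X i) `[0, t]%classic) lawX//.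
  by rewrite exponential_prob_itv0c// mulN1r.
by rewrite split_le U P0 Pt add0e.
Qed.

Lemma exponential_gt i t : 0 <= t -> P (X i @^-1` `]t, +oo[) = (expR (- t))%:E.
Proof.
move=> t0.
have gtC : X i @^-1` `]t, +oo[ = ~` (X i @^-1` `]-oo, t]).
  by apply/seteqP; split => w /=; rewrite !in_itv /= andbT ltNge => /negP.
have := @probability_setC _ _ _ P (X i @^-1` `]-oo, t]) (meas i _).
rewrite -gtC exponential_le// => ->.
by rewrite -EFinB subKr.
Qed.

Lemma exponential_itv i s t : 0 <= s -> s <= t ->
  P (X i @^-1` `]s, t]) = (expR (- s) - expR (- t))%:E.
Proof.
move=> s0 st.
have : P (X i @^-1` `]-oo, t]) =
    (P (X i @^-1` `]-oo, s]) + P (X i @^-1` `]s, t]))%E.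
  rewrite -measureU//; last first.
    rewrite -preimage_setI; apply/seteqP; split => x //=.
    by rewrite !in_itv /= => -[xs /andP[]]; rewrite ltNge xs.
  rewrite -preimage_setU; congr (P (_ @^-1` _)).
  apply/seteqP; split => x /=; rewrite !in_itv /=.
    by move=> ->; rewrite andbT; case: (leP x s); [left|right].
  by move=> [xs|/andP[]//]; rewrite (le_trans xs).
rewrite !exponential_le ?(le_trans s0 st)//.
have : P (X i @^-1` `]s, t]) \is a fin_num by exact: fin_num_measure.
case: (P _) => // p _ [] h; congr EFin; lra.
Qed.

End exponential_gaps.

Lemma mutually_independent_nat {R : realType} d (T : measurableType d)
    (P : probability T R) d' (S : measurableType d') (X : nat -> T -> S)
    (A : nat -> set S) n :
  mutually_independent P X -> (forall i, measurable (A i)) ->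
  (forall i, measurable_fun setT (X i)) ->
  (forall i, (n <= i)%N -> A i = setT) ->
  fine (P (\bigcap_i (X i @^-1` A i))) = \prod_(i < n) fine (P (X i @^-1` A i)).
Proof.
move=> indep mA mX AT.
have := indep [fset i | i in iota 0 n]%fset A (fun i _ => mA i).
rewrite (perm_big (index_iota 0 n)); last first.
  apply: uniq_perm; [exact: fset_uniq|exact: iota_uniq|].
  by move=> i; rewrite !inE /index_iota subn0.
rewrite big_mkord (_ : \bigcap_(i in _) _ = \bigcap_i (X i @^-1` A i)); last first.
  apply/seteqP; split => w h i.
    move=> _; case: (ltnP i n) => ni; last by rewrite /= AT.
    by apply: h => /=; rewrite !inE mem_iota add0n.
  by move=> _; exact: h.
have mXA i : measurable (X i @^-1` A i).
  by rewrite -[_ @^-1` _]setTI; exact: mX.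
move=> ->; under eq_bigr do rewrite -(fineK (fin_num_measure P _ (mXA _))).
by rewrite prodEFin.
Qed.

Section limit_scan.
Context {R : realType} d1 (Omega1 : measurableType d1).
Variables (P1 : probability Omega1 R).
Variables (X : nat -> {RV P1 >-> R}) (Z : nat -> {RV P1 >-> bool}).
Hypothesis lawX : forall i A, measurable A ->
  distribution P1 (X i) A = exponential_prob 1 A.
Hypothesis indepX : mutually_independent P1 (fun i => X i : Omega1 -> R).
Hypothesis lawZ : forall l A,
  distribution P1 (Z l) A = bernoulli_prob (l.+1%:R^-1 : R) A.
Hypothesis indepZ : mutually_independent P1 (fun l => Z l : Omega1 -> bool).
Hypothesis indepXZ : independent_families P1 (fun i => X i : Omega1 -> R)
  (fun l => Z l : Omega1 -> bool).
Variable delta : R.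
Hypothesis delta_gt0 : 0 < delta.

Let mX i : measurable_fun setT (X i : Omega1 -> R).
Proof. exact: measurable_funPT. Qed.

Let mZ i : measurable_fun setT (Z i : Omega1 -> bool).
Proof. exact: measurable_funPT. Qed.

(** A rounded gap equal to [r + 1] columns has probability
    [exp (- r delta) - exp (- (r + 1) delta)], at least
    [delta exp (- (r + 1) delta)]: up to this inequality, the rounded process puts
    weight [delta exp (- delta)] on an occupied column and [exp (- delta)] on an empty
    one, as the Poisson process does. *)
Lemma gaps_prob l r y :
  delta ^+ occupied y * expR (- (delta * (r + size y)%:R)) <=
  \prod_(i < size (gaps delta r y))
    fine (P1 (X (l + i)%N @^-1` [set` nth `]-oo, +oo[ (gaps delta r y) i])).
Proof.
have d0 k : 0 <= k%:R * delta by rewrite mulr_ge0// ltW.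
elim: y l r => [|[z|] y ih] l r /=.
- rewrite big_ord1 /= exponential_gt// !addn0 /occupied /= expr0 mul1r.
  by rewrite mulrC.
- rewrite big_ord_recl /= addn0 exponential_itv//; last first.
    by rewrite ler_pM2r// ler_nat.
  rewrite /occupied /= add1n exprS.
  rewrite (_ : delta * _ * _ = (delta * expR (- (r.+1%:R * delta))) *
     (delta ^+ count isSome y * expR (- (delta * (0 + size y)%:R)))); last first.
    rewrite -!mulrA; congr (_ * _); rewrite mulrCA -expRD; congr (_ * expR _).
    by rewrite add0n addnS -addSn natrD; ring.
  apply: ler_pM.
  + by rewrite mulr_ge0 ?expR_ge0// ltW.
  + by rewrite mulr_ge0 ?expR_ge0 ?exprn_ge0// ltW.
  + have -> : - (r%:R * delta) = - (r.+1%:R * delta) + delta.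
      by rewrite -natr1; ring.
    rewrite expRD -[X in _ - X]mulr1 -mulrBr mulrC ler_wpM2l ?expR_ge0//.
    by have := expR_ge1Dx delta; lra.
  + apply: le_trans (ih l.+1 0%N) _; rewrite le_eqVlt; apply/orP; left.
    apply/eqP; apply: eq_bigr => i _.
    by rewrite /bump /= add1n addSnnS.
- by have := ih l r.+1; rewrite addSnnS /occupied /= add0n.
Qed.

Lemma marks_prob l y :
  \prod_(i < size (marks y))
    fine (P1 (Z (l + i)%N @^-1` [set nth true (marks y) i])) = record_law l y.
Proof.
have lawZb k b : fine (P1 (Z k @^-1` [set b])) =
    if b then k.+1%:R^-1 else k%:R / k.+1%:R.
  rewrite -[P1 _]/(distribution P1 (Z k) [set b]) lawZ bernoulli_probE; last first.
    by rewrite invr_ge0 ler0n /= invf_le1 ?ltr0n// ler1n.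
  rewrite !diracE; case: b.
    by rewrite mem_set// memNset// -!EFinM -EFinD /= mulr1 mulr0 addr0.
  rewrite memNset// mem_set// -!EFinM -EFinD /= mulr1 mulr0 add0r /unstable.onem.
  by rewrite -[in RHS](addrK 1 k%:R) natr1 mulrBl mul1r mulfV// pnatr_eq0.
elim: y l => [|[z|] y ih] l /=; first by rewrite big_ord0.
  rewrite big_ord_recl /= addn0 lawZb -ih; congr (_ * _).
  by apply: eq_bigr => i _; rewrite /bump /= add1n addSnnS.
exact: ih.
Qed.

Definition scan_word k w := scan delta (X ^~ w) (Z ^~ w) k 0 0.

(** A lower bound for the law of the scanned word, whose total mass is close to [1]
    when [L * delta ^ 2] is small. *)
Definition word_law L (y : seq (option bool)) : R :=
  expR (- (delta * L%:R)) * (delta ^+ occupied y * record_law 0 y).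

Let event y : set Omega1 :=
  (\bigcap_i (X i @^-1` [set` nth `]-oo, +oo[ (gaps delta 0 y) i])) `&`
  (\bigcap_i (Z i @^-1` (if (i < size (marks y))%N
                         then [set nth true (marks y) i] else setT))).

Let event_scan y w : event y w -> scan_word (size y) w = y.
Proof.
move=> [Xw Zw]; apply: scan_gaps => // i => [|im]; first exact: Xw.
by have := Zw i Logic.I; rewrite /= add0n im => ->.
Qed.

Let measurable_event y : measurable (event y).
Proof.
apply: measurableI; apply: bigcap_measurableType => i _.
  rewrite -[_ @^-1` _]setTI; apply: mX => //; exact: measurable_itv.
by rewrite -[_ @^-1` _]setTI; exact: mZ.
Qed.

Let event_prob y : word_law (size y) y <= fine (P1 (event y)).
Proof.
rewrite /event indepXZ; last 2 first.
- by apply: sigma_generated_bigcap => i; exact: measurable_itv.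
- exact: sigma_generated_bigcap.
rewrite fineM; last 2 first.
- apply: fin_num_measure; apply: bigcap_measurableType => i _.
  rewrite -[_ @^-1` _]setTI; apply: mX => //; exact: measurable_itv.
- apply: fin_num_measure; apply: bigcap_measurableType => i _.
  by rewrite -[_ @^-1` _]setTI; exact: mZ.
rewrite (@mutually_independent_nat _ _ _ _ _ _ _ _ (size (gaps delta 0 y)) indepX)//;
  last first.
  by move=> i ni; rewrite nth_default//; apply/seteqP; split.
rewrite (@mutually_independent_nat _ _ _ _ _ _ _ _ (size (marks y)) indepZ)//;
  last first.
  by move=> i; rewrite leqNgt => /negbTE ->.
under [X in _ <= _ * X]eq_bigr do rewrite ltn_ord -[X in Z X]add0n.
rewrite marks_prob /word_law mulrA ler_wpM2r ?record_law_ge0// mulrC.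
by have := gaps_prob 0 0 y; rewrite add0n.
Qed.

(** The lower bounds on the probabilities are turned into an upper bound by applying
    them to [C - F]; the missing mass of the bounds costs at most [C] times itself. *)
Lemma scan_expectation (F : seq (option bool) -> R) (C : R) L :
  (forall y, 0 <= F y <= C) ->
  \int[P1]_w F (scan_word L w) <=
  \sum_(y <- record_words L) F y * word_law L y +
  C * (1 - \sum_(y <- record_words L) word_law L y).
Proof.
move=> FC; have F0 y : 0 <= F y by have /andP[] := FC y.
have FC0 y : 0 <= C - F y by have /andP[] := FC y; rewrite subr_ge0.
have mF : measurable_fun setT (fun w => F (scan_word L w)).
  by apply: scan_measurable.
pose g w := \sum_(y <- record_words L) (C - F y) * \1_(event y) w.
have g_le w : g w <= C - F (scan_word L w).
  have uL : uniq (record_words L) by exact: extensions_uniq.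
  have wL : scan_word L w \in record_words L by exact: scan_record_words.
  rewrite /g (bigD1_seq (scan_word L w) wL uL)/= big_seq_cond.
  rewrite [X in _ + X <= _]big1 ?addr0 => [|y /andP[/extensionsP[sy _] yw]].
    by rewrite ler_piMr// indicE; case: (_ \in _).
  rewrite indicE memNset ?mulr0// => yw'.
  by have := event_scan yw'; rewrite sy => wy; rewrite -wy eqxx in yw.
have mg : measurable_fun setT g.
  by apply: measurable_sum => y; apply: measurable_funM => //; exact: measurable_indic.
have g0 w : 0 <= g w by apply: sumr_ge0 => y _; rewrite mulr_ge0.
have Ig : \int[P1]_w g w =
    \sum_(y <- record_words L) (C - F y) * fine (P1 (event y)).
  rewrite /Rintegral /g; under eq_integral do rewrite -sumEFin.
  rewrite ge0_integral_sum//; last 2 first.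
  - by move=> y; apply/measurable_EFinP; apply: measurable_funM => //; exact: measurable_indic.
  - by move=> y w _; rewrite lee_fin mulr_ge0.
  rewrite (eq_bigr (fun y => ((C - F y) * fine (P1 (event y)))%:E)); last first.
    move=> y _; under eq_integral do rewrite EFinM.
    rewrite ge0_integralZl_EFin//; last by apply/measurable_EFinP; exact: measurable_indic.
    by rewrite integral_indic// setIT EFinM fineK// fin_num_measure.
  by rewrite sumEFin.
have IF : \int[P1]_w F (scan_word L w) + \int[P1]_w g w <= C.
  apply: (@le_trans _ _ (\int[P1]_w (F (scan_word L w) + g w))).
    apply: (@Rintegral_superadditive _ _ _ P1 _ _ C) => // w.
    by rewrite addrC -lerBrDr.
  rewrite -lee_fin (@RintegralE _ _ _ P1 _ C) => [|w|w].
  - apply: integral_bounded => w; first by rewrite addr_ge0.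
    by rewrite addrC -lerBrDr.
  - by rewrite addr_ge0.
  - by rewrite addrC -lerBrDr.
have le_g : \sum_(y <- record_words L) (C - F y) * word_law L y <= \int[P1]_w g w.
  rewrite Ig !big_seq; apply: ler_sum => y /extensionsP[<- _].
  by rewrite ler_wpM2l// event_prob.
have -> : \sum_(y <- record_words L) F y * word_law L y +
    C * (1 - \sum_(y <- record_words L) word_law L y) =
    C - \sum_(y <- record_words L) (C - F y) * word_law L y.
  have -> : \sum_(y <- record_words L) (C - F y) * word_law L y =
    C * \sum_(y <- record_words L) word_law L y -
    \sum_(y <- record_words L) F y * word_law L y.
    by rewrite big_distrr /= -sumrB; apply: eq_bigr => y _; rewrite mulrBl.
  by ring.
by lra.
Qed.
End limit_scan.

(** * The limit process is the limit of its discretizations *)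

Section scan_sum.
Context {R : realType} (delta : R).
Hypothesis delta_gt0 : 0 < delta.
Implicit Types (x : nat -> R) (z : nat -> bool).

Definition rounded_gap x i : nat := `|Num.ceil (x i / delta)|%N.

Lemma rounded_gapP x i : 0 < x i ->
  (0 < rounded_gap x i)%N /\
  ((rounded_gap x i)%:R - 1) * delta < x i <= (rounded_gap x i)%:R * delta.
Proof.
move=> xi0; have xd : 0 < x i / delta by rewrite divr_gt0.
have c0 : (0 < Num.ceil (x i / delta))%R by rewrite ceil_gt0.
have ce : (rounded_gap x i)%:R = (Num.ceil (x i / delta))%:~R :> R.
  by rewrite /rounded_gap natr_absz gtr0_norm.
split; first by rewrite absz_gt0 gt_eqF.
rewrite ce -ltr_pdivlMr// -ler_pdivrMr//.
have := ceil_itv (x i / delta).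
by rewrite intrD.
Qed.

(** The column, counted from 0, of the [j]-th point to come when [l] points have been
    seen and the reading starts [r] columns after the last of them. *)
Definition column x l r j : nat :=
  (\sum_(i < j.+1) rounded_gap x (l + i) - r.+1)%N.

(** A sum over the columns marked as records is a sum over the points: the scan places
    the [j]-th point at the sum of the first [j] rounded gaps. *)
Lemma scan_sum x z k l r (F : nat -> R) : (forall i, 0 < x i) ->
  (r < rounded_gap x l)%N ->
  \sum_(i < k | nth None (scan delta x z k l r) i == Some true) F i =
  \sum_(j < k | z (l + j)%N && (column x l r j < k)%N) F (column x l r j).
Proof.
move=> x0; elim: k l r F => [|k ih] l r F rl; first by rewrite !big_ord0.
have [gl0 /andP[glt gle]] := rounded_gapP (x0 l).
have rx : r%:R * delta < x l.
  apply: le_lt_trans glt; rewrite ler_pM2r// lerBrDr natr1 ler_nat.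
  exact: rl.
have xr : (x l <= r.+1%:R * delta) = (rounded_gap x l == r.+1).
  rewrite eqn_leq rl andbT; apply/idP/idP => h.
    have := lt_le_trans glt h; rewrite ltr_pM2r// ltrBlDr natr1 ltr_nat ltnS.
    by [].
  by apply: le_trans gle _; rewrite ler_pM2r// ler_nat.
have gap_pos i : (0 < rounded_gap x i)%N by have [] := rounded_gapP (x0 i).
have sum_ge m n : (n <= \sum_(i < n) rounded_gap x (m + i))%N.
  rewrite -[leqLHS]card_ord -sum1_card; apply: leq_sum => i _; exact: gap_pos.
have shift n : (\sum_(i < n) rounded_gap x (l + bump 0 i) =
    \sum_(i < n) rounded_gap x (l.+1 + i))%N.
  by apply: eq_bigr => i _; rewrite /bump /= add1n addSnnS.
rewrite [scan _ _ _ _ _ _]/= rx /= xr; case: eqP => [glr|glr].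
  have colS j : column x l r j.+1 = (column x l.+1 0 j).+1.
    rewrite /column big_ord_recl addn0 glr /= shift.
    have := sum_ge l.+1 j.+1; move: (\sum_(i < j.+1) _)%N => s; lia.
  have col0 : column x l r 0 = 0%N by rewrite /column big_ord1 addn0 glr subnn.
  rewrite big_mkcond big_ord_recl /= [RHS]big_mkcond big_ord_recl /= addn0 col0.
  rewrite ltn0Sn andbT; congr (_ + _).
    by case: (z l).
  rewrite -!big_mkcond /=.
  rewrite (ih l.+1 0%N (fun i => F i.+1))//.
  apply: eq_big => [j|j _]; rewrite /bump /= add1n colS//.
  by rewrite ltnS addSnnS.
have colS j : column x l r j = (column x l r.+1 j).+1.
  rewrite /column big_ord_recl addn0.
  have : (r.+1 < rounded_gap x l)%N by rewrite ltn_neqAle rl andbT eq_sym; apply/eqP.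
  move: (\sum_(i < j) _)%N => s; lia.
rewrite big_mkcond big_ord_recl /= add0r -big_mkcond /=.
rewrite (ih l r.+1 (fun i => F i.+1)); last first.
  by rewrite ltn_neqAle rl andbT eq_sym; apply/eqP.
rewrite [RHS]big_mkcond big_ord_recr /= [X in _ + X](_ : _ = 0) ?addr0; last first.
  rewrite ifF//; apply/negP => /andP[_]; rewrite /column.
  have := sum_ge l.+1 k; rewrite big_ord_recl addn0 /= shift.
  have : (r.+1 < rounded_gap x l)%N by rewrite ltn_neqAle rl andbT eq_sym; apply/eqP.
  move: (\sum_(i < k) _)%N => s; lia.
rewrite -big_mkcond /=.
by apply: eq_big => [j|j _]; rewrite colS// ltnS.
Qed.

(** Rounding shifts each gap by less than [delta], so the delays add up to at most
    [delta] per point: they vanish in the limit for each fixed [j]. *)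
Lemma column_bounds x j : (forall i, 0 < x i) ->
  \sum_(i < j.+1) x i - delta <= (column x 0 0 j)%:R * delta <=
  \sum_(i < j.+1) x i + j%:R * delta.
Proof.
move=> x0; have gP i := rounded_gapP (x0 i).
have s_gt0 : (0 < \sum_(i < j.+1) rounded_gap x i)%N.
  by rewrite big_ord_recl addn_gt0 (gP _).1.
rewrite /column /= natrB// natr_sum mulrBl mul1r big_distrl /=; apply/andP; split.
  by rewrite lerD2r; apply: ler_sum => i _; have [_ /andP[]] := gP i.
have : \sum_(i < j.+1) (rounded_gap x i)%:R * delta <=
    \sum_(i < j.+1) (x i + delta).
  apply: ler_sum => i _; have [_ /andP[+ _]] := gP i.
  by rewrite mulrBl mul1r => h; lra.
rewrite big_split /= sumr_const card_ord -[delta *+ _]mulr_natl -natr1.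
by rewrite mulrDl mul1r /= => h; lra.
Qed.

End scan_sum.

Section limit_process.
Context {R : realType}.
Local Notation halfline := (@halfline R).
Implicit Types (x : nat -> R) (z : nat -> bool) (y : seq (option bool)).

(** The point measures which, before the time [L * delta], have one point in each
    closed column marked [Some true] by [y] and no other point. This is said with test
    integrals, through which alone the vague topology sees a point measure. *)
Definition pattern_nbhd (delta : R) (L : nat) y :
    set (point_measure (R := R) halfline) :=
  [set nu | exists p : nat -> R,
     (forall i, i%:R * delta <= p i <= i.+1%:R * delta) /\
     forall phi : test_function halfline,
       (forall t, L%:R * delta < t -> phi t = 0) ->
       test_integrals nu phi =
         \sum_(i < L | nth None y i == Some true) phi (p i)].

Lemma closed_halfline : closed halfline.
Proof. exact: rray_closed. Qed.

Lemma test_bounded_support (phi : test_function (R := R) halfline) :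
  exists2 M, 0 <= M & forall t, halfline t -> M < t -> phi t = 0.
Proof.
have [K [KD kK phiK]] := tf_support phi.
have [M [_ KM]] := compact_bounded kK.
exists (Num.max 0 (M + 1)); first by rewrite le_max lexx.
move=> t t0; rewrite gt_max => /andP[_ Mt]; apply: phiK => // Kt.
have := KM (M + 1) _ t Kt; rewrite ltrDl ltr01 => /(_ isT) /=.
by move=> tM; have := le_lt_trans (le_trans (ler_norm t) tM) Mt; rewrite ltxx.
Qed.

Lemma test_cvg (phi : test_function (R := R) halfline) (u : nat -> R) (t : R) :
  0 <= t -> (forall n, 0 <= u n) -> u n @[n --> \oo] --> t ->
  phi (u n) @[n --> \oo] --> phi t.
Proof.
move=> t0 u0 ut.
have := (subspace_continuousP _ _).1 (@tf_continuous _ _ _ phi) t.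
rewrite /halfline /= in_itv /= andbT => /(_ t0) h.
apply: (cvg_comp u phi _ h).
move=> A /= [e e0 eA].
have : \forall n \near \oo, ball t e (u n) by apply: ut; exact: nbhsx_ballx.
by apply: filterS => n un; apply: eA => //=; rewrite in_itv /= u0.
Qed.

Section arrival.
Variables (x : nat -> R) (z : nat -> bool).
Hypothesis x0 : forall i, 0 < x i.
Hypothesis x_oo : forall K : R, exists l, K < \sum_(i < l.+1) x i.
Let arrival l : R := \sum_(i < l.+1) x i.

Let arrival_le l l' : (l <= l')%N -> arrival l <= arrival l'.
Proof.
move=> ll'; rewrite /arrival -(subnKC ll') -addSn big_split_ord /= lerDl.
by apply: sumr_ge0 => i _; exact: ltW.
Qed.

Let arrival_ge0 l : 0 <= arrival l.
Proof. by apply: sumr_ge0 => i _; exact: ltW. Qed.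

Let limit_measure : point_measure (R := R) halfline :=
  to_point_measure halfline (point_sum z arrival).

Let is_limit_measure : is_point_measure halfline (point_sum (R := R) z arrival).
Proof.
apply: is_point_measure_sum => [n _|K _ kK].
  by rewrite /halfline /= in_itv /= andbT.
have [M [_ KM]] := compact_bounded kK.
have [l Ml] := x_oo (M + 1); exists l => n _ Kn.
rewrite ltnNge; apply/negP => ln.
have := KM (M + 1) _ _ Kn; rewrite ltrDl ltr01 => /(_ isT) /= /(le_trans (ler_norm _)).
by rewrite leNgt (lt_le_trans Ml)// arrival_le.
Qed.

(** A test function sees only the time interval [[0, K]], hence finitely many points of
    the limit process; for a fine grid each of these has its own column, and the point
    of [nu n] in that column is within a multiple of [delta n] of it. *)
Lemma pattern_nbhd_cvg (delta : nat -> R) (L : nat -> nat)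
    (nu : nat -> point_measure (R := R) halfline) :
  (forall n, 0 < delta n) -> delta n @[n --> \oo] --> 0 ->
  (forall M : R, \forall n \near \oo, M < (L n)%:R * delta n) ->
  (forall n, pattern_nbhd (delta n) (L n) (scan (delta n) x z (L n) 0 0) (nu n)) ->
  nu n @[n --> \oo] --> limit_measure.
Proof.
move=> d0 dcvg Ldelta nuU; apply: cvg_test_integrals => phi.
have [p pP] := choice nuU.
have [K K0 phiK] := test_bounded_support phi.
have [l0 Kl0] := x_oo (K + 1); rewrite -[X in _ < X]/(arrival l0) in Kl0.
have late l : (l0 <= l)%N -> K + 1 < arrival l.
  by move=> ll; exact: lt_le_trans (arrival_le ll).
have -> : test_integrals limit_measure phi = \sum_(l < l0 | z l) phi (arrival l).
  apply: (@test_integrals_point_sum _ _ _ closed_halfline _ z arrival).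
  - by rewrite /limit_measure to_point_measureE.
  - by move=> n _; rewrite /halfline /= in_itv /= andbT.
  - move=> n ln _; apply: phiK; first by rewrite /halfline /= in_itv /= andbT.
    by have := late _ ln; lra.
pose c n j := column (delta n) x 0 0 j.
have c_bounds n j : arrival j - delta n <= p n (c n j) <= arrival j + j.+1%:R * delta n.
  have /andP[clow cup] := @column_bounds _ _ (d0 n) x j x0.
  have /andP[plow pup] := (pP n).1 (c n j).
  rewrite (le_trans clow plow) (le_trans pup)//.
  by rewrite -natr1 mulrDl mul1r -natr1 mulrDl mul1r addrA lerD2r.
have p_ge0 n i : 0 <= p n i.
  have /andP[h _] := (pP n).1 i; apply: le_trans h.
  by rewrite mulr_ge0// ltW.
have p_cvg j : p n (c n j) @[n --> \oo] --> arrival j.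
  apply: (@squeeze_cvgr _ _ _ _ (fun n => arrival j - delta n)
    (fun n => arrival j + j.+1%:R * delta n)).
  - by apply: nearW => n; exact: c_bounds.
  - by rewrite -[X in _ --> X]subr0; apply: cvgB => //; exact: cvg_cst.
  - rewrite -[X in _ --> X]addr0; apply: cvgD; first exact: cvg_cst.
    by rewrite -(mulr0 j.+1%:R); apply: cvgMl_tmp.
have termE j : \forall n \near \oo, (j < L n)%N && (c n j < L n)%N.
  near=> n.
  have d1 : delta n < 1.
    by near: n; apply: (cvgr_lt _ dcvg); exact: ltr01.
  have Ln : arrival j + j.+1%:R + 1 < (L n)%:R * delta n.
    by near: n; exact: Ldelta.
  have aj := arrival_ge0 j.
  apply/andP; split; rewrite -(ltr_nat R).
    rewrite -(ltr_pM2r (d0 n)); apply: le_lt_trans Ln.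
    have : j%:R * delta n <= j%:R by rewrite ler_piMr// ltW.
    by rewrite -natr1; lra.
  rewrite -(ltr_pM2r (d0 n)); apply: le_lt_trans Ln.
  have /andP[_ cup] := @column_bounds _ _ (d0 n) x j x0.
  apply: le_trans cup _; rewrite -/(arrival j).
  have : j%:R * delta n <= j%:R by rewrite ler_piMr// ltW.
  by rewrite -natr1; lra.
have sum_cvg : \sum_(l < l0 | z l) phi (p n (c n l)) @[n --> \oo] -->
    \sum_(l < l0 | z l) phi (arrival l).
  by apply: cvg_sum_seq => l; apply: test_cvg.
suff eq_sum : \forall n \near \oo, test_integrals (nu n) phi =
    \sum_(l < l0 | z l) phi (p n (c n l)).
  move=> A /sum_cvg sA; apply: filterS2 eq_sum sA => n /= ->; exact.
near=> n.
have LK : K < (L n)%:R * delta n by near: n; exact: Ldelta.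
have d1 : delta n < 1 by near: n; apply: (cvgr_lt _ dcvg); exact: ltr01.
have lL : (l0 < L n)%N && (c n l0 < L n)%N by near: n; exact: termE.
have alltermE : forall l : 'I_l0, (l < L n)%N && (c n l < L n)%N.
  by near: n; apply: filter_forall => l; exact: termE.
rewrite (pP n).2; last by move=> t /(lt_trans LK) Kt; apply: phiK => //;
  rewrite /halfline /= in_itv /= andbT (le_trans K0)// ltW.
have g0 : (0 < rounded_gap (delta n) x 0)%N.
  by have [] := @rounded_gapP _ _ (d0 n) x 0%N (x0 0%N).
rewrite (@scan_sum _ _ (d0 n) x z (L n) 0 0 (fun i => phi (p n i)) x0 g0).
rewrite -(big_mkord (fun j => z j && (c n j < L n)%N) (fun j => phi (p n (c n j)))).
rewrite (@big_cat_nat _ _ _ l0)//=; last by case/andP: lL => /ltnW.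
rewrite [X in _ + X = _]big_nat_cond [X in _ + X = _]big1 ?addr0; last first.
  move=> j /andP[/andP[lj _] _]; apply: phiK.
    by rewrite /halfline /= in_itv /= andbT.
  have /andP[h _] := c_bounds n j; apply: lt_le_trans h.
  by have := late _ lj; lra.
rewrite big_mkord; apply: eq_bigl => l.
by have /andP[_ ->] := alltermE l; rewrite andbT.
Unshelve. all: by end_near. Qed.

End arrival.
End limit_process.

(** * Records of a configuration read on its grid *)

Section cells.
Local Open Scope nat_scope.
Implicit Types (w : seq (option nat)).

Definition cells w : seq (nat * nat) :=
  pmap (fun i => omap (pair i) (nth None w i)) (iota 0 (size w)).

Lemma mem_cells w i u : ((i, u) \in cells w) = (nth None w i == Some u).
Proof.
rewrite /cells mem_pmap; apply/mapP/eqP => [[j _]|wi].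
  by case wj: (nth None w j) => [u'|] //= [-> ->].
exists i; last by rewrite wi.
rewrite mem_iota add0n /= ltnNge; apply/negP => wl.
by rewrite nth_default in wi.
Qed.

Lemma levelsE w : levels w = map snd (cells w).
Proof.
rewrite /cells /levels -[in LHS](mkseq_nth None w) /mkseq.
elim: (iota 0 _) => //= i s ih.
by case: (nth None w i) => [u|] //=; rewrite ih.
Qed.

Lemma uniq_cells w : uniq (cells w).
Proof.
apply: (@map_uniq _ _ fst); rewrite /cells.
rewrite (_ : map fst _ = [seq i <- iota 0 (size w) | isSome (nth None w i)]).
  by rewrite filter_uniq// iota_uniq.
elim: (iota 0 _) => //= i s ih.
by case: (nth None w i) => [u|] //=; rewrite ih.
Qed.

Lemma size_cells w : size (cells w) = occupied w.
Proof. by rewrite -size_levels levelsE size_map. Qed.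

Lemma cells_column_inj w i u u' :
  (i, u) \in cells w -> (i, u') \in cells w -> u = u'.
Proof. by rewrite !mem_cells => /eqP-> /eqP[]. Qed.

Lemma cells_level_inj w i i' u : uniq (levels w) ->
  (i, u) \in cells w -> (i', u) \in cells w -> i = i'.
Proof.
rewrite levelsE => us /[dup] iw /(nth_index (0, 0)) iE /[dup] iw' /(nth_index (0, 0)) iE'.
move: iw iw'; rewrite -!index_mem => iw iw'.
have := nth_uniq 0 _ _ us; rewrite size_map => /(_ _ _ iw iw').
rewrite !(nth_map (0, 0))// iE iE' eqxx => /esym/eqP ii'.
by move: iE; rewrite ii' iE' => -[].
Qed.

Lemma mem_levels_take w i u :
  u \in levels (take i w) -> exists2 i', i' < i & (i', u) \in cells w.
Proof.
rewrite mem_levels => /(nthP None)[i']; rewrite size_take_min leq_min => /andP[ii' _].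
by rewrite nth_take// => wi; exists i' => //; rewrite mem_cells wi.
Qed.

Lemma level_mem_take w i i' u : i' < i -> (i', u) \in cells w ->
  u \in levels (take i w).
Proof.
rewrite mem_cells mem_levels => ii' /eqP wi'.
apply/(nthP None); exists i'; last by rewrite nth_take.
rewrite size_take_min leq_min ii' ltnNge; apply/negP => wl.
by rewrite nth_default in wi'.
Qed.

End cells.

Section pattern_nbhd_point_sum.
Context {R : realType}.
Local Notation halfline := (@halfline R).

Lemma point_sum_gt0 {S : ptopologicalType} (b : pred nat) (t : nat -> S) (A : set S) :
  (0 < point_sum (R := R) b t A)%E -> exists n, b n /\ A (t n).
Proof.
move=> h; apply: contrapT => nA; move: h; rewrite point_sumE eseries0 ?ltxx//.
move=> n _ _; case bn: (b n) => //=; rewrite memNset// => tn.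
by apply: nA; exists n.
Qed.

(** A way to recognize the pattern from an indexed family of points: [E i] is the
    index of the point in the column [i], and [n0] bounds the indices of the points of
    the window. *)
Lemma pattern_nbhd_point_sum (nu : point_measure (R := R) halfline)
    (b : pred nat) (t : nat -> R) (delta : R) (L n0 : nat)
    (y : seq (option bool)) (E : nat -> nat) : 0 < delta ->
  (pm_measure nu = point_sum b t :> (set R -> \bar R)) ->
  (forall n, b n -> 0 <= t n) ->
  (forall n, (n0 <= n)%N -> b n -> L%:R * delta < t n) ->
  (forall i, (i < L)%N -> nth None y i = Some true ->
     b (E i) /\ i%:R * delta <= t (E i) <= i.+1%:R * delta) ->
  (forall i i', (i < L)%N -> nth None y i = Some true ->
     (i' < L)%N -> nth None y i' = Some true -> E i = E i' -> i = i') ->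
  (forall n, b n -> t n <= L%:R * delta ->
     exists i, [/\ (i < L)%N, nth None y i = Some true & n = E i]) ->
  pattern_nbhd delta L y nu.
Proof.
move=> delta0 nuE t0 tn0 EP Einj bE.
(* In the other columns the position is arbitrary. *)
exists (fun i => if (i < L)%N && (nth None y i == Some true) then t (E i) else i%:R * delta).
split=> [i|phi phi0].
  case: ifP => [/andP[iL /eqP yi]|_]; first by have [] := EP _ iL yi.
  by rewrite lexx ler_wpM2r ?ler_nat// ltW.
rewrite (@test_integrals_point_sum _ _ _ (@closed_halfline R) _ b t _ n0)//; last 2 first.
- by move=> n /t0 tn; rewrite /halfline /= in_itv /= andbT.
- by move=> n nn0 bn; apply: phi0; exact: tn0.
rewrite [RHS](eq_bigr (fun i : 'I_L => phi (t (E i)))); last first.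
  by move=> i ->; rewrite ltn_ord.
rewrite -(big_mkord (fun i => nth None y i == Some true) (fun i => phi (t (E i)))).
rewrite -(big_mkord b (fun n => phi (t n))).
rewrite (bigID (fun n => t n <= L%:R * delta)) /= [X in _ + X]big1 ?addr0; last first.
  by move=> n /andP[bn]; rewrite -ltNge; exact: phi0.
rewrite -[LHS]big_filter -[RHS]big_filter.
rewrite -[RHS](big_map E xpredT (fun n => phi (t n))).
apply: perm_big; apply: uniq_perm; first by rewrite filter_uniq// iota_uniq.
  rewrite map_inj_in_uniq ?filter_uniq// ?iota_uniq// => i i'.
  rewrite !mem_filter !mem_index_iota /= => /andP[/eqP yi iL] /andP[/eqP yi' iL'].
  exact: Einj.
move=> n; rewrite mem_filter mem_index_iota /=; apply/idP/mapP.
  move=> /andP[/andP[bn tn] _]; have [i [iL yi ->]] := bE _ bn tn.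
  by exists i => //; rewrite mem_filter yi eqxx mem_index_iota.
move=> [i]; rewrite mem_filter mem_index_iota /= => /andP[/eqP yi iL] ->.
have [bi /andP[_ ti]] := EP _ iL yi.
have tL : t (E i) <= L%:R * delta.
  by apply: le_trans ti _; rewrite ler_pM2r// ler_nat.
rewrite bi tL /= ltnNge; apply/negP => /tn0 /(_ bi).
by rewrite ltNge tL.
Qed.

(** The infimum of a function over an empty set would be a default value. *)
Lemma pattern_nbhd_nonempty (delta : R) (L : nat) (y : seq (option bool)) :
  0 < delta -> size y = L -> pattern_nbhd delta L y !=set0.
Proof.
move=> delta0 yL; pose b i := nth None y i == Some true.
have bL i : b i -> (i < L)%N.
  by rewrite /b ltnNge => yi; apply/negP => Li; rewrite nth_default ?yL in yi.
pose t i : R := i%:R * delta.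
have tP : is_point_measure halfline (point_sum (R := R) b t).
  apply: is_point_measure_sum => [n _|K _ _].
    by rewrite /halfline /= in_itv /= andbT mulr_ge0// ltW.
  by exists L => n /bL.
exists (PointMeasure tP).
apply: (@pattern_nbhd_point_sum _ b t delta L L y id) => //.
- by move=> n _; rewrite mulr_ge0// ltW.
- by move=> n Ln /bL; rewrite ltnNge Ln.
- move=> i iL yi; split; first exact/eqP.
  by rewrite lexx /= ler_wpM2r ?ler_nat// ltW.
- by move=> n bn _; exists n; split => //; [exact: bL|exact/eqP].
Qed.

End pattern_nbhd_point_sum.

Section grid_records.
Context {R : realType}.
Variables (v : nat -> R) (e h : R).
Hypotheses (e0 : 0 < e) (h0 : 0 < h) (v0 : v 0%N <= e^-1).

Let b n := (0 < n)%N && (e^-1 < v n).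
Let time n : R := n%:R * h.
Let mark n : R := (e * v n)^-1.

Variables (delta : R) (L : nat) (s : nat -> R).
Hypotheses (delta_gt0 : 0 < delta).
Hypothesis s_mono : forall u u', (u < u')%N -> s u.+1 <= s u'.

Definition cell (c : nat * nat) : set (R * R) :=
  open_rect (c.1%:R * delta) (c.1.+1%:R * delta) (s c.2) (s c.2.+1).

(** The event that a word stands for, witnessed by the index of the exceedance in each
    of its cells. *)
Definition occupies (w : seq (option nat)) (E : nat * nat -> nat) :=
  (forall c, c \in cells w -> b (E c) /\ cell c (time (E c), mark (E c))) /\
  (forall n, b n -> time n <= L%:R * delta -> exists2 c, c \in cells w & n = E c).

Let mono_col i i' : (i < i')%N -> i.+1%:R * delta <= i'%:R * delta.
Proof. by move=> ii'; rewrite ler_pM2r// ler_nat. Qed.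

Lemma cell_eq c c' p : cell c p -> cell c' p -> c = c'.
Proof.
case: c c' => [i u] [i' u'] [/=]; rewrite !in_itv /= => /andP[p1 p2] /andP[p3 p4].
move=> [/=]; rewrite !in_itv /= => /andP[q1 q2] /andP[q3 q4].
congr pair.
  case: (ltngtP i i') => // /mono_col ii'.
    by have := lt_trans (lt_le_trans p2 ii') q1; rewrite ltxx.
  by have := lt_trans (lt_le_trans q2 ii') p1; rewrite ltxx.
case: (ltngtP u u') => // /s_mono uu'.
  by have := lt_trans (lt_le_trans p4 uu') q3; rewrite ltxx.
by have := lt_trans (lt_le_trans q4 uu') p3; rewrite ltxx.
Qed.

Lemma cell_time_le i i' u u' p p' : cell (i, u) p -> cell (i', u') p' ->
  p.1 < p'.1 -> (i <= i')%N.
Proof.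
move=> [/=]; rewrite !in_itv /= => /andP[p1 p2] _ [/=].
rewrite !in_itv /= => /andP[q1 q2] _ pp'.
rewrite leqNgt; apply/negP => /mono_col ii'.
by have := lt_trans (lt_trans (lt_le_trans q2 ii') p1) pp'; rewrite ltxx.
Qed.

Lemma cell_mark_le i i' u u' p p' : cell (i, u) p -> cell (i', u') p' ->
  p.2 <= p'.2 -> (u <= u')%N.
Proof.
move=> [/=]; rewrite !in_itv /= => _ /andP[p1 p2] [/=].
rewrite !in_itv /= => _ /andP[q1 q2] pp'.
rewrite leqNgt; apply/negP => /s_mono ii'.
by have := lt_le_trans (lt_trans (lt_le_trans q2 ii') p1) pp'; rewrite ltxx.
Qed.

Lemma occupies_time w E c : size w = L -> occupies w E -> c \in cells w ->
  time (E c) <= L%:R * delta.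
Proof.
case: c => i u wL [EP _] cw; have [_ [/=]] := EP _ cw.
rewrite in_itv /= => /andP[_ /ltW ti] _; apply: le_trans ti _.
rewrite ler_pM2r// ler_nat -wL ltnNge; apply/negP => wi.
by move: cw; rewrite mem_cells nth_default.
Qed.

(** A configuration is described by at most one word, so that at most one of the
    weights attached to the words is positive. *)
Lemma occupies_inj w w' E E' : size w = L -> size w' = L ->
  occupies w E -> occupies w' E' -> w = w'.
Proof.
move=> wL w'L oE oE'; apply: (@eq_from_nth _ None); first by rewrite w'L.
suff sub w1 w2 E1 E2 : size w1 = L -> occupies w1 E1 -> occupies w2 E2 ->
    {subset cells w1 <= cells w2}.
  move=> i iL; case wi: (nth None w i) => [u|].
    have /(sub _ _ _ _ wL oE oE') : (i, u) \in cells w by rewrite mem_cells wi.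
    by rewrite mem_cells => /eqP ->.
  case wi': (nth None w' i) => [u|//].
  have /(sub _ _ _ _ w'L oE' oE) : (i, u) \in cells w' by rewrite mem_cells wi'.
  by rewrite mem_cells wi.
move=> w1L o1 o2 c cw1; have [bE cE] := o1.1 _ cw1.
have [c' cw2 EE'] := o2.2 _ bE (occupies_time w1L o1 cw1).
have [_] := o2.1 _ cw2; rewrite -EE' => /(cell_eq cE) -> //.
Qed.

Let mark_lt n n' : b n -> b n' -> (mark n < mark n') = (v n' < v n).
Proof.
move=> /andP[_ vn] /andP[_ vn'].
have ve : 0 < e^-1 by rewrite invr_gt0.
have vn0 := lt_trans ve vn; have vn0' := lt_trans ve vn'.
by rewrite /mark ltf_pV2 ?posrE ?mulr_gt0// ltr_pM2l.
Qed.

Definition is_record k := (0 < k)%N &&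
  (\big[Num.max/e^-1]_(0 <= j < k) v j < v k).

(** The index 0 does not enter the competition: its value is below the threshold. *)
Lemma is_recordP k : reflect
  (b k /\ forall j, b j -> (j < k)%N -> v j < v k) (is_record k).
Proof.
rewrite /is_record big_mkord; apply: (iffP andP) => [[k0 /bigmax_ltP[vk vj]]|].
  split; first by rewrite /b k0.
  by move=> j _ jk; exact: (vj (Ordinal jk)).
move=> [/andP[k0 vk] vj]; split => //; apply/bigmax_ltP; split => // j _.
case: (ltP e^-1 (v j)) => [ej|je]; last exact: le_lt_trans vk.
apply: vj => //; rewrite /b ej andbT lt0n; apply/negP => /eqP j0.
by move: ej; rewrite j0 ltNge v0.
Qed.

(** Smaller marks are larger values of [v]. Exceedances in distinct columns and at
    distinct levels compare like their columns and levels, hence the records are read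
    off the word. *)
Lemma record_of_cell w E i u : size w = L -> uniq (levels w) -> occupies w E ->
  (i, u) \in cells w ->
  is_record (E (i, u)) = all (ltn u) (levels (take i w)).
Proof.
move=> wL uw oE cw; have [bE cE] := oE.1 _ cw.
have tE := occupies_time wL oE cw.
have time_lt n n' : (time n < time n') = (n < n')%N.
  by rewrite /time ltr_pM2r// ltr_nat.
apply/is_recordP/allP => [[_ rec] u' /mem_levels_take[i' ii' cw']|low].
  have [bE' cE'] := oE.1 _ cw'.
  have EE' : (E (i', u') < E (i, u))%N.
    rewrite ltnNge leq_eqVlt; apply/negP => /orP[/eqP EE'|].
      move: cE'; rewrite -EE' => /(cell_eq cE) [ie _].
      by rewrite ie ltnn in ii'.
    rewrite -time_lt => /(cell_time_le cE cE').
    by rewrite leqNgt ii'.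
  have := rec _ bE' EE'; rewrite -mark_lt// => /ltW/(cell_mark_le cE cE').
  rewrite leq_eqVlt => /predU1P[uu'|//].
  rewrite -uu' in cw'; have ie := cells_level_inj uw cw cw'.
  by rewrite ie ltnn in ii'.
split=> // j bj jE.
have tj : time j <= L%:R * delta.
  by apply: le_trans tE; rewrite ltW// time_lt.
have [[i' u'] cw' jE'] := oE.2 _ bj tj.
have [_ cE'] := oE.1 _ cw'.
rewrite jE' in bj jE *.
have ii' : (i' < i)%N.
  rewrite ltn_neqAle (cell_time_le cE' cE) ?time_lt// andbT.
  apply/eqP => ie; rewrite ie in cw' jE.
  by move: jE; rewrite (cells_column_inj cw' cw) ltnn.
have uu' := low _ (level_mem_take ii' cw').
rewrite ltNge; apply/negP; rewrite leNgt -mark_lt// -leNgt.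
move=> /(cell_mark_le cE' cE); rewrite leqNgt.
by move: uu'; rewrite /= => ->.
Qed.

End grid_records.

Section records_pattern.
Context {R : realType} {Omega : Type} (T : Omega -> Omega) (f : Omega -> R).
Variables (e h : R) (x : Omega).
Hypotheses (e0 : 0 < e) (h0 : 0 < h) (fx : f x <= e^-1).
Variables (delta : R) (L : nat) (s : nat -> R).
Hypotheses (delta_gt0 : 0 < delta).
Hypothesis s_mono : forall u u', (u < u')%N -> s u.+1 <= s u'.

Let v n := f (iter n T x).
Let occ w E := occupies v e h delta L s w E.

(** The [n] cells are disjoint and all charged, so a total mass below [n + 1] leaves
    room for exactly one exceedance in each and none elsewhere. *)
Lemma occupiesP (w : seq (option nat)) : size w = L ->
  (forall c, c \in cells w ->
     (0 < pm_measure (exceedance_process T f e h x) (cell delta s c))%E) ->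
  (pm_measure (exceedance_process T f e h x) (window (L%:R * delta)) <
     (size (cells w)).+1%:R%:E)%E ->
  exists E, occ w E.
Proof.
rewrite to_point_measureE; last exact: exceedance_measureP.
move=> wL hit few.
have /choice[E EP] (c : nat * nat) : exists n, c \in cells w ->
    ((0 < n)%N && (e^-1 < v n)) /\ cell delta s c (n%:R * h, (e * v n)^-1).
  case: (boolP (c \in cells w)) => cw; last by exists 0%N.
  by have [n [bn cn]] := point_sum_gt0 (hit _ cw); exists n.
exists E; split => // n bn tn; apply: contrapT => nE.
have Einj : {in cells w &, injective E}.
  move=> c c' cw cw' EE'; apply: (cell_eq delta_gt0 s_mono (EP _ cw).2).
  by rewrite EE'; exact: (EP _ cw').2.
have inW k : (0 < k)%N && (e^-1 < v k) -> k%:R * h <= L%:R * delta ->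
    window (L%:R * delta) (k%:R * h, (e * v k)^-1).
  move=> /andP[_ vk] tk; have ef : 1 < e * v k by rewrite -ltr_pdivrMl// mulr1.
  have ef0 := lt_trans ltr01 ef.
  split; rewrite /= in_itv /= ?tk ?andbT; first by rewrite mulr_ge0// ltW.
  by rewrite invr_ge0 (ltW ef0) invf_le1// ltW.
move: few; apply/negP; rewrite -leNgt.
have -> : (size (cells w)).+1 = size (n :: map E (cells w)) by rewrite /= size_map.
apply: point_sum_ge.
  rewrite /= map_inj_in_uniq// uniq_cells andbT.
  by apply/mapP => -[c cw nEc]; apply: nE; exists c.
move=> k; rewrite inE => /predU1P[->|/mapP[c cw ->]].
  by split=> //; exact: inW.
have [bE cE] := EP _ cw; split => //; apply: inW => //.
case: c cw cE {bE} => i u cw [/=]; rewrite in_itv /= => /andP[_ /ltW ti] _.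
apply: le_trans ti _; rewrite ler_pM2r// ler_nat -wL ltnNge; apply/negP => wi.
by move: cw; rewrite mem_cells nth_default.
Qed.

Lemma record_process_pattern (w : seq (option nat)) E :
  size w = L -> uniq (levels w) -> occ w E ->
  pattern_nbhd delta L (records w) (record_process T f h e^-1 x).
Proof.
move=> wL uw oE.
have recE k : ((0 < k)%N &&
    (\big[Num.max/e^-1]_(0 <= j < k) f (iter j T x) < f (iter k T x))) =
  is_record v e k by [].
have cellE i : nth None (records w) i = Some true -> exists u,
    (i, u) \in cells w /\ all (ltn u) (levels (take i w)).
  rewrite nth_records; case wi: (nth None w i) => [u|] //= [au].
  by exists u; rewrite mem_cells wi.
pose E' i := E (i, odflt 0%N (nth None w i)).
have E'E i u : (i, u) \in cells w -> E' i = E (i, u).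
  by rewrite mem_cells /E' => /eqP ->.
have rec_cell i u : (i, u) \in cells w ->
    is_record v e (E (i, u)) = all (ltn u) (levels (take i w)).
  by move=> cw; exact: (record_of_cell e0 h0 fx delta_gt0 s_mono wL uw oE cw).
have [n0 n0P] := bounded_multiples (L%:R * delta) h0.
apply: (@pattern_nbhd_point_sum _ _ (is_record v e) (fun k => k%:R * h) _ _ n0 _ E') => //.
- by rewrite to_point_measureE//; exact: record_measureP.
- by move=> n _; rewrite mulr_ge0// ltW.
- move=> n nn0 _; rewrite ltNge; apply/negP => /n0P.
  by rewrite ltnNge nn0.
- move=> i iL /cellE[u [cw au]]; rewrite (E'E _ _ cw) rec_cell//; split => //.
  have [_ [/=]] := oE.1 _ cw; rewrite in_itv /= => /andP[t1 t2] _.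
  by rewrite !ltW.
- move=> i i' _ /cellE[u [cw _]] _ /cellE[u' [cw' _]].
  rewrite (E'E _ _ cw) (E'E _ _ cw') => EE'.
  have [_ cE] := oE.1 _ cw; have [_ cE'] := oE.1 _ cw'.
  by rewrite -EE' in cE'; have [] := cell_eq delta_gt0 s_mono cE cE'.
- move=> n rn tn; have /(is_recordP fx)[bn _] := rn.
  have [[i u] cw nE] := oE.2 _ bn tn; exists i.
  have wi : nth None w i = Some u by apply/eqP; rewrite -mem_cells.
  split; last by rewrite (E'E _ _ cw).
    by rewrite -wL ltnNge; apply/negP => ii; rewrite nth_default in wi.
  by rewrite nth_records wi /= -rec_cell// -nE rn.
Qed.

End records_pattern.

(** * Quantiles of an atomless probability *)

Section quantiles.
Context {R : realType} (m : probability (measurableTypeR R) R).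
Hypotheses (m01 : m `[0, 1]%classic = 1%E) (atomless : forall y : R, m [set y] = 0%E).

Let itv (j : interval R) : set (measurableTypeR R) := [set` j].

Let mitv j : measurable (itv j). Proof. exact: measurable_itv. Qed.

Let split01 t : 0 <= t -> t <= 1 -> (m (itv `[0%R, t]) + m (itv `]t, 1%R]))%E = 1%E.
Proof.
move=> t0 t1; rewrite -measureU//; last first.
  apply/seteqP; split => x //= [].
  by rewrite /itv /= !in_itv /= => /andP[_ xt] /andP[]; rewrite ltNge xt.
rewrite -m01; congr (m _); apply/seteqP; split => x; rewrite /itv /= !in_itv /=.
  by move=> [/andP[-> xt]|/andP[tx ->]]; rewrite ?(le_trans xt)// (le_trans t0)// ltW.
by move=> /andP[-> ->]; rewrite andbT /=; case: (leP x t); [left|right].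
Qed.

Let half_open_l t : t <= 1 -> m (itv `[t, 1%R]) = m (itv `]t, 1%R]).
Proof.
move=> t1; rewrite -(measureU0 (mitv `]t, 1]) (measurable_set1 t) (atomless t)).
congr (m _); apply/seteqP; split => x; rewrite /itv /= !in_itv /=.
  by move=> /andP[]; rewrite le_eqVlt => /predU1P[->|->] ->; [right|left].
by move=> [/andP[/ltW -> ->]//|->]; rewrite lexx.
Qed.

Let half_open_r t : 0 <= t -> m (itv `[0%R, t]) = m (itv `[0%R, t[).
Proof.
move=> t0; rewrite -(measureU0 (mitv `[0, t[) (measurable_set1 t) (atomless t)).
congr (m _); apply/seteqP; split => x; rewrite /itv /= !in_itv /=.
  by move=> /andP[->]; rewrite le_eqVlt => /predU1P[->|->]; [right|left].
by move=> [/andP[-> /ltW]//|->]; rewrite t0 lexx.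
Qed.

(** The supremum [t] of the points whose distribution function is at most [c] works:
    since [t] is not an atom, the mass up to [t] is a limit of masses at most [c], and
    the mass beyond [t] is a limit of masses at most [1 - c]. *)
Lemma quantile_exists (c : R) : 0 <= c <= 1 ->
  exists2 t, 0 <= t <= 1 & m `[0, t]%classic = c%:E.
Proof.
move=> /andP[c0 c1].
pose A := [set t | 0 <= t <= 1 /\ (m (itv `[0%R, t]) <= c%:E)%E].
have A0 : A 0.
  split; first by rewrite lexx ler01.
  by rewrite /itv set_itv1 atomless lee_fin.
have supA : has_sup A by split; [exists 0|exists 1 => t [/andP[]]].
have s0 : 0 <= sup A by apply: ub_le_sup A0; exact: supA.2.
have s1 : sup A <= 1 by apply: ge_sup; [exists 0|move=> t [/andP[]]].
set t := sup A in s0 s1.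
exists t; first by rewrite s0.
have lim_le (F : nat -> set (measurableTypeR R)) (a : R) :
    (forall n, measurable (F n)) -> {homo F : i j / (i <= j)%N >-> (i <= j)%O} ->
    (forall n, (m (F n) <= a%:E)%E) -> (m (\bigcup_n F n) <= a%:E)%E.
  move=> mF ndF Fa.
  have h := nondecreasing_cvg_mu (mu := m) mF (bigcup_measurable (fun k _ => mF k)) ndF.
  rewrite -(cvg_lim _ h)//; apply: lime_le; first by apply/cvg_ex; eexists; exact: h.
  exact: nearW.
have inv_le i j : (i <= j)%N -> j.+1%:R^-1 <= i.+1%:R^-1 :> R.
  by move=> ij; rewrite lef_pV2 ?posrE// ler_nat.
apply/eqP; rewrite eq_le; apply/andP; split.
  rewrite -[X in m X]/(itv `[0, t]) half_open_r// /itv itv_bnd_open_bigcup.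
  apply: lim_le => [n|i j ij|n]; first exact: measurable_itv.
    apply/subsetPset => x /=; rewrite !in_itv /= => /andP[-> xt] /=.
    by apply: le_trans xt _; rewrite lerD2l lerN2 inv_le.
  have n1 : 0 < n.+1%:R^-1 :> R by rewrite invr_gt0.
  have [u [/andP[u0 u1] mu] tu] := sup_adherent n1 supA.
  apply: le_trans mu; apply: le_measure; rewrite ?inE.
  - exact: measurable_itv.
  - exact: measurable_itv.
  move=> x /=; rewrite /itv /= !in_itv /= => /andP[-> xt] /=.
  by apply: le_trans xt _; exact: ltW.
have upper : (m (itv `]t, 1%R]) <= (1 - c)%:E)%E.
  rewrite /itv itv_open_bnd_bigcup.
  apply: lim_le => [n|i j ij|n]; first exact: measurable_itv.
    apply/subsetPset => x /=; rewrite !in_itv /= => /andP[xt ->]; rewrite andbT.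
    by apply: le_trans xt; rewrite lerD2l inv_le.
  set u := t + _.
  have tu : t < u by rewrite ltrDl.
  have u0 : 0 <= u by apply: le_trans s0 (ltW tu).
  case: (leP u 1) => u1; last first.
    by rewrite set_itv_ge ?measure0 ?lee_fin ?subr_ge0// bnd_simp -ltNge.
  rewrite -[X in m X]/(itv `[u, 1]) half_open_l//.
  have : ~ A u by move=> Au; have := ub_le_sup supA.2 Au; rewrite leNgt tu.
  move=> nA; have {nA} : (c%:E < m (itv `[0%R, u]))%E.
    by rewrite ltNge; apply/negP => h; apply: nA; rewrite /A /= u0 u1.
  have := split01 u0 u1.
  have : m (itv `[0%R, u]) \is a fin_num by exact: fin_num_measure.
  have : m (itv `]u, 1%R]) \is a fin_num by exact: fin_num_measure.
  case: (m _) => // p _; case: (m _) => // p' _ [] pp'.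
  by rewrite lte_fin lee_fin => h; lra.
have := split01 s0 s1; rewrite -[X in (_ <= m X)%E]/(itv `[0, t]).
move: upper.
have : m (itv `[0%R, t]) \is a fin_num by exact: fin_num_measure.
have : m (itv `]t, 1%R]) \is a fin_num by exact: fin_num_measure.
case: (m _) => // p _; case: (m _) => // p' _.
by rewrite !lee_fin => h [] h2; lra.
Qed.

(** Beyond [q] the sequence is constant, so that monotonicity needs no bound. *)
Lemma equal_levels (q : nat) : (0 < q)%N -> exists s : nat -> R,
  [/\ forall u, 0 <= s u <= 1,
      forall u u', (u < u')%N -> s u.+1 <= s u' &
      forall u, (u < q)%N -> m `](s u), (s u.+1)[%classic = (q%:R^-1)%:E].
Proof.
move=> q0; have qR : 0 < q%:R :> R by rewrite ltr0n.
have /choice[s sP] (u : nat) : exists t : R, 0 <= t <= 1 /\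
    ((u <= q)%N -> m (itv `[0%R, t]) = (u%:R / q%:R)%:E) /\ ((q < u)%N -> t = 1).
  case: (leqP u q) => uq; last by exists 1; rewrite ler01 lexx.
  have [|t t01 mt] := @quantile_exists (u%:R / q%:R).
    by rewrite divr_ge0//= ler_pdivrMr// mul1r ler_nat.
  by exists t.
have s_lt u u' : (u < u')%N -> (u' <= q)%N -> s u < s u'.
  move=> uu' uq; rewrite ltNge; apply/negP => ss.
  have : (m (itv `[0%R, s u']) <= m (itv `[0%R, s u]))%E.
    apply: le_measure; rewrite ?inE//.
    by apply: subset_itvl; rewrite bnd_simp.
  rewrite (sP u).2.1 ?(leq_trans (ltnW uu'))// (sP u').2.1// lee_fin.
  by rewrite ler_pM2r ?invr_gt0// ler_nat leqNgt uu'.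
exists s; split => [u|u u' uu'|u uq].
- exact: (sP u).1.
- case: (leqP u' q) => uq; last first.
    by rewrite ((sP u').2.2 uq); have /andP[] := (sP u.+1).1.
  case: (ltngtP u.+1 u') uu' => // [uu' _|->//].
  by apply: ltW; exact: s_lt.
have /andP[su0 _] := (sP u).1; have /andP[su1 _] := (sP u.+1).1.
have ss : s u < s u.+1 by exact: s_lt.
have : (m (itv `[0%R, s u]) + m (itv `](s u), (s u.+1)[))%E =
    m (itv `[0%R, s u.+1]).
  rewrite (half_open_r su1) -measureU//; last first.
    apply/seteqP; split => x //= [].
    by rewrite /itv /= !in_itv /= => /andP[_ xt] /andP[]; rewrite ltNge xt.
  congr (m _); apply/seteqP; split => x; rewrite /itv /= !in_itv /=.
    move=> [/andP[-> xt]|/andP[tx ->]]; first by rewrite (le_lt_trans xt).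
    by rewrite (le_trans su0)// ltW.
  by move=> /andP[-> ->]; rewrite andbT /=; case: (leP x (s u)); [left|right].
rewrite (sP u).2.1 1?ltnW// (sP u.+1).2.1//.
have : m (itv `](s u), (s u.+1)[) \is a fin_num by exact: fin_num_measure.
rewrite -[X in _ -> _ -> m X = _]/(itv `](s u), (s u.+1)[).
case: (m _) => // p _ [] h; congr EFin.
by move: h; rewrite -natr1 mulrDl div1r; lra.
Qed.

End quantiles.

Section product_rectangles.
Context {R : realType} (m : probability (measurableTypeR R) R).

Lemma product_rectangle (a b c d k : R) : a <= b ->
  m `]c, d[%classic = k%:E ->
  (lebesgue_measure \x m)%E (open_rect a b c d) = ((b - a) * k)%:E.
Proof.
move=> ab mk; rewrite /open_rect product_measure1E; [|exact: measurable_itv..].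
rewrite EFinM; congr (_ * _)%E; last exact: mk.
transitivity (lebesgue_measure `]a, b[%classic); first by [].
rewrite lebesgue_measure_itv /= lte_fin; by case: ltgtP ab => // ->; rewrite subrr.
Qed.

Lemma product_window (M : R) : 0 <= M -> m `[0, 1]%classic = 1%E ->
  (lebesgue_measure \x m)%E (window M) = M%:E.
Proof.
move=> M0 m1; rewrite /window product_measure1E; [|exact: measurable_itv..].
rewrite -[RHS]mule1; congr (_ * _)%E; last exact: m1.
transitivity (lebesgue_measure (`[0, M]%classic : set R)); first by [].
by rewrite lebesgue_measure_itv /= lte_fin oppr0 adde0; case: ltgtP M0 => // <-.
Qed.

End product_rectangles.

(** * Divergence of the arrival times *)

Section gaps_diverge.
Context {R : realType} d1 (Omega1 : measurableType d1).
Variables (P1 : probability Omega1 R) (X : nat -> {RV P1 >-> R}).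
Hypothesis lawX : forall i A, measurable A ->
  distribution P1 (X i) A = exponential_prob 1 A.
Hypothesis indepX : mutually_independent P1 (fun i => X i : Omega1 -> R).

Let meas i (j : interval R) : measurable (X i @^-1` [set` j]).
Proof.
have mXi : measurable_fun setT (X i) by exact: measurable_funPT.
by rewrite -[_ @^-1` _]setTI; apply: mXi => //; exact: measurable_itv.
Qed.

Let all_small a : set Omega1 :=
  \bigcap_i (X i @^-1` (if (a <= i)%N then `]-oo, 1]%classic else setT)).

Let all_small_null a : P1 (all_small a) = 0%E.
Proof.
pose A n i : set R := if (a <= i < a + n)%N then `]-oo, 1]%classic else setT.
have mA n i : measurable (A n i) by rewrite /A; case: ifP.
have mXA n i : measurable (X i @^-1` A n i).
  rewrite /A; case: ifP => _; first exact: meas.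
  by rewrite preimage_setT; exact: measurableT.
have PA n : fine (P1 (\bigcap_i (X i @^-1` A n i))) = (1 - expR (-1)) ^+ n.
  rewrite (@mutually_independent_nat _ _ _ _ _ _ _ _ (a + n) indepX)//; last first.
    by move=> i ni; rewrite /A ltnNge ni andbF.
  rewrite big_split_ord /= big1 ?mul1r => [|i _]; last first.
    by rewrite /A leqNgt ltn_ord /= preimage_setT probability_setT.
  rewrite (eq_bigr (fun=> 1 - expR (-1))).
    by rewrite prodr_const card_ord.
  by move=> i _; rewrite /A leq_addr ltn_add2l ltn_ord /= exponential_le.
have sub n : (P1 (all_small a) <= ((1 - expR (-1)) ^+ n)%:E)%E.
  rewrite -PA fineK; last first.
    by apply: fin_num_measure; apply: bigcap_measurableType => i _; exact: mXA.
  apply: le_measure; rewrite ?inE.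
  - apply: bigcap_measurableType => i _; case: ifP => _; first exact: meas.
    by rewrite preimage_setT; exact: measurableT.
  - by apply: bigcap_measurableType => i _; exact: mXA.
  move=> w h i _; rewrite /A /=; have := h i Logic.I => /=.
  by case: (leqP a i) => //= _; case: ifP.
have e1 : 0 < expR (-1) :> R by exact: expR_gt0.
have e2 : expR (-1) < 1 :> R by rewrite expR_lt1 ltrN10.
have : (1 - expR (-1)) ^+ n @[n --> \oo] --> (0 : R).
  by apply: cvg_expr; rewrite ger0_norm; lra.
have : P1 (all_small a) \is a fin_num.
  apply: fin_num_measure; apply: bigcap_measurableType => i _; case: ifP => _.
    exact: meas.
  by rewrite preimage_setT; exact: measurableT.
move=> pfin c0; apply/eqP; rewrite eq_le; apply/andP; split; last exact: measure_ge0.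
rewrite -(fineK pfin) lee_fin; apply: (cvgr_to_ge c0); apply: nearW => n.
by rewrite -lee_fin fineK.
Qed.

(** Almost surely infinitely many gaps exceed [1], since the probability that the [n]
    gaps after the [a]-th one are all at most [1] is [(1 - exp (- 1))^n]. *)
Lemma gaps_diverge : exists A : set Omega1,
  [/\ measurable A, P1 (~` A) = 0%E &
   forall w, A w -> (forall i, 0 < X i w) /\
     forall K : R, exists l, K < \sum_(i < l.+1) X i w].
Proof.
pose N : set Omega1 := \bigcup_i (X i @^-1` `]-oo, 0]) `|` \bigcup_a all_small a.
have mS a : measurable (all_small a).
  apply: bigcap_measurableType => i _; case: ifP => _; first exact: meas.
  by rewrite preimage_setT; exact: measurableT.
have mN1 : measurable (\bigcup_i (X i @^-1` `]-oo, 0])).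
  by apply: bigcup_measurable => i _; exact: meas.
have mN2 : measurable (\bigcup_a all_small a) by exact: bigcup_measurable.
have mN : measurable N by exact: measurableU.
have N0 : P1 N = 0%E.
  have null (F : nat -> set Omega1) : (forall i, measurable (F i)) ->
      (forall i, P1 (F i) = 0%E) -> P1.-negligible (\bigcup_i F i).
    by move=> mF F0; apply: negligible_bigcup => i; exists (F i); split; [exact: mF|exact: F0|exact: subset_refl].
  have : P1.-negligible N.
    by apply: negligibleU; apply: null => // i; exact: exponential_le0.
  move=> [B [mB B0 NB]]; apply/eqP; rewrite eq_le; apply/andP; split.
    by rewrite -B0; apply: le_measure; rewrite ?inE.
  exact: measure_ge0.
exists (~` N); split; [exact: measurableC|by rewrite setCK|].
move=> w Nw; have X0 i : 0 < X i w.
  rewrite ltNge; apply/negP => Xi; apply: Nw; left; by exists i.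
split=> // K.
have large a : exists2 i, (a <= i)%N & 1 < X i w.
  apply: contrapT => h; apply: Nw; right; exists a => // i _ /=.
  case: ifP => // ai; rewrite /= in_itv /= leNgt; apply/negP => Xi.
  by apply: h; exists i.
suff : forall k : nat, exists l, k%:R < \sum_(i < l.+1) X i w.
  move=> /(_ (Num.truncn K).+1)[l Kl]; exists l; apply: le_lt_trans Kl.
  by apply: ltW; exact: truncnS_gt.
elim=> [|k [l kl]].
  by exists 0%N; rewrite big_ord1.
have [i li Xi] := large l.+1; exists i.
rewrite -natr1 big_ord_recr /=; apply: ltrD => //.
apply: lt_le_trans kl _; rewrite -(subnKC li) big_split_ord /= lerDl.
by apply: sumr_ge0 => j _; exact: ltW.
Qed.

End gaps_diverge.

(** * Lower bounds for the expectation of a test function *)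

Section pattern_inf.
Context {R : realType}.
Local Notation halfline := (@halfline R).
Variables (G : point_measure (R := R) halfline -> R) (C : R).
Hypotheses (cG : continuous G) (GC : forall nu, 0 <= G nu <= C).

Definition pattern_inf (delta : R) (L : nat) y : R :=
  inf [set G nu | nu in pattern_nbhd delta L y].

Let has_lb delta L y : has_lbound [set G nu | nu in pattern_nbhd delta L y].
Proof. by exists 0 => _ [nu _ <-]; have /andP[] := GC nu. Qed.

Lemma pattern_inf_le delta L y nu :
  pattern_nbhd delta L y nu -> pattern_inf delta L y <= G nu.
Proof. by move=> nuy; apply: ge_inf => //; exists nu. Qed.

Lemma pattern_inf_bounds delta L y : 0 <= pattern_inf delta L y <= C.
Proof.
have [[nu nuy]|] := pselect (pattern_nbhd delta L y !=set0).
  apply/andP; split.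
    apply: lb_le_inf; first by exists (G nu), nu.
    by move=> _ [nu' _ <-]; have /andP[] := GC nu'.
  by apply: le_trans (pattern_inf_le nuy) _; have /andP[] := GC nu.
move=> /set0P/negP; rewrite negbK => /eqP n0.
rewrite /pattern_inf n0 image_set0 inf0 lexx /=.
by have /andP[h0 h1] := GC point; apply: le_trans h1.
Qed.

(** Choosing point measures that almost reach the infima reduces the claim to
    [pattern_nbhd_cvg]. *)
Lemma pattern_inf_cvg (x : nat -> R) (z : nat -> bool)
    (delta : nat -> R) (L : nat -> nat) :
  (forall i, 0 < x i) ->
  (forall K : R, exists l, K < \sum_(i < l.+1) x i) ->
  (forall n, 0 < delta n) -> delta n @[n --> \oo] --> 0 ->
  (forall M : R, \forall n \near \oo, M < (L n)%:R * delta n) ->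
  pattern_inf (delta n) (L n) (scan (delta n) x z (L n) 0 0) @[n --> \oo] -->
  G (to_point_measure halfline (point_sum z (fun l => \sum_(i < l.+1) x i))).
Proof.
move=> x0 xoo d0 dcvg Ldelta.
pose y n := scan (delta n) x z (L n) 0 0.
have ne n : pattern_nbhd (delta n) (L n) (y n) !=set0.
  by apply: pattern_nbhd_nonempty => //; exact: size_scan.
have /choice[nu nuP] n : exists nu, pattern_nbhd (delta n) (L n) (y n) nu /\
    G nu < pattern_inf (delta n) (L n) (y n) + n.+1%:R^-1.
  have n1 : 0 < n.+1%:R^-1 :> R by rewrite invr_gt0.
  have hi : has_inf [set G nu | nu in pattern_nbhd (delta n) (L n) (y n)].
    by split; [have [nu nuy] := ne n; exists (G nu), nu|exact: has_lb].
  by have [_ [nu nuy <-] h] := inf_adherent n1 hi; exists nu.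
have nucvg : nu n @[n --> \oo] -->
    to_point_measure halfline (point_sum z (fun l => \sum_(i < l.+1) x i)).
  apply: (@pattern_nbhd_cvg _ x z x0 xoo delta L) => // n.
  by have [] := nuP n.
have Gcvg := cvg_comp _ _ nucvg (@cG _).
apply: (@squeeze_cvgr _ _ _ _ (fun n => G (nu n) - n.+1%:R^-1) (fun n => G (nu n))).
- apply: nearW => n; have [nuy Gnu] := nuP n; rewrite (pattern_inf_le nuy) andbT.
  by rewrite lerBlDr ltW.
- by rewrite -[X in _ --> X]subr0; apply: cvgB => //; exact: cvg_harmonic.
- exact: Gcvg.
Qed.

End pattern_inf.

Section limit_expectation.
Context {R : realType} d1 (Omega1 : measurableType d1).
Variables (P1 : probability Omega1 R).
Variables (X : nat -> {RV P1 >-> R}) (Z : nat -> {RV P1 >-> bool}).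
Hypothesis lawX : forall i A, measurable A ->
  distribution P1 (X i) A = exponential_prob 1 A.
Hypothesis indepX : mutually_independent P1 (fun i => X i : Omega1 -> R).
Variables (G : point_measure (R := R) (@halfline R) -> R) (C : R).
Hypotheses (cG : continuous G) (GC : forall nu, 0 <= G nu <= C).

Lemma limit_expectation (delta : nat -> R) (L : nat -> nat) :
  (forall n, 0 < delta n) -> delta n @[n --> \oo] --> 0 ->
  (forall M : R, \forall n \near \oo, M < (L n)%:R * delta n) ->
  \int[P1]_w pattern_inf G (delta n) (L n) (scan_word X Z (delta n) (L n) w)
    @[n --> \oo] -->
  \int[P1]_w G (limit_process (fun i => X i) (fun l => Z l) w).
Proof.
move=> d0 dcvg Ldelta; have [A [mA A0 AP]] := gaps_diverge lawX indepX.
apply: (@Rintegral_cvg_ae _ _ _ P1 _ _ C A) => //.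
- move=> n; apply: (@scan_measurable _ _ _ _ (fun i => X i) (fun l => Z l)) => i;
    exact: measurable_funPT.
- by move=> n w; exact: pattern_inf_bounds.
- move=> w /AP[x0 xoo].
  exact: (@pattern_inf_cvg _ G C cG GC (X ^~ w) (Z ^~ w) _ _ x0 xoo d0 dcvg Ldelta).
Qed.

End limit_expectation.

Section grid_lower_bound.
Context {R : realType} d (Omega : measurableType d) (P : probability Omega R).
Variables (T : Omega -> Omega) (f : Omega -> R) (h : R -> R).
Variables (m : probability (measurableTypeR R) R).
Variables (d0 : measure_display) (Omega0 : measurableType d0).
Variables (P0 : probability Omega0 R).
Variable N : Omega0 -> point_measure (R := R) (@strip R).
Hypotheses (mf : measurable_fun setT f) (h_gt0 : forall e : R, 0 < e -> 0 < h e).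
Hypotheses (m01 : m `[0, 1]%classic = 1%E) (atomless : forall y : R, m [set y] = 0%E).
Hypothesis poissonN : poisson_point_process P0 N (lebesgue_measure \x m)%E.
Hypothesis cvgN : cvg_in_distribution P
  (fun e => exceedance_process T f e (h e)) 0^'+ P0 N.

(** The starting point may itself be an exceedance, and would then count in the maximum
    that defines the records without being an atom of the exceedance process. *)
Lemma exceedance_tail (eta : R) : 0 < eta ->
  \forall e \near 0^'+, fine (P (~` [set x | f x <= e^-1])) < eta.
Proof.
move=> eta0; pose F (n : nat) := [set x | n.+1%:R < f x].
have mF n : measurable (F n).
  rewrite -[F n]setTI (_ : F n = f @^-1` `]n.+1%:R, +oo[).
    by apply: mf => //; exact: measurable_itv.
  by apply/seteqP; split => x; rewrite /F /= in_itv /= andbT.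
have F0 : \bigcap_n F n = set0.
  apply/seteqP; split => // x /(_ (Num.truncn (f x)) Logic.I).
  by rewrite /F /= ltNge ltW// truncnS_gt.
have mF0 : measurable (\bigcap_n F n) by rewrite F0.
have PF0 : (P (F 0%N) < +oo)%E.
  by apply: le_lt_trans (probability_le1 _ (mF 0%N)) _; rewrite ltry.
have ndF : {homo F : i j / (i <= j)%N >-> (j <= i)%O}.
  move=> i j ij; apply/subsetPset => x; rewrite /F /=; apply: le_lt_trans.
  by rewrite ler_nat ltnS.
have := nonincreasing_cvg_mu PF0 mF mF0 ndF.
rewrite F0 measure0 => /fine_cvgP[_ cv0].
have [n _ /(_ n (leqnn n)) /= Pn] := cvgr_lt _ cv0 _ eta0.
near=> e; apply: le_lt_trans Pn.
have e_gt0 : 0 < e by near: e; exact: nbhs_right_gt.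
have en : e < n.+1%:R^-1.
  by near: e; apply: nbhs_right_lt; rewrite invr_gt0.
have sub : ~` [set x | f x <= e^-1] `<=` F n.
  move=> x /= /negP; rewrite -ltNge; apply: lt_trans.
  by rewrite -[ltLHS]invrK ltf_pV2 ?posrE ?invr_gt0.
have mS : measurable (~` [set x | f x <= e^-1]).
  apply: measurableC; rewrite -[X in measurable X]setTI.
  rewrite (_ : [set x | f x <= e^-1] = f @^-1` `]-oo, e^-1]).
    by apply: mf => //; exact: measurable_itv.
  by apply/seteqP; split => x; rewrite /= in_itv.
apply: fine_le; [exact: fin_num_measure|exact: fin_num_measure|].
by apply: le_measure; rewrite ?inE.
Unshelve. all: by end_near. Qed.

Variables (delta : R) (L q : nat).
Hypotheses (delta_gt0 : 0 < delta) (q_gt0 : (0 < q)%N).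
Let M := L%:R * delta.
Let kappa := delta / q%:R.

Section level_grid.
Variable s : nat -> R.
Hypotheses (s01 : forall u, 0 <= s u <= 1)
  (s_mono : forall u u', (u < u')%N -> s u.+1 <= s u')
  (s_mass : forall u, (u < q)%N -> m `](s u), (s u.+1)[%classic = (q%:R^-1)%:E).

(** One weight per word, from the cells it names. The masses of cells under the product
    intensity are all equal to [kappa], whatever the positions of the quantiles. *)
Lemma word_function (w : seq (option nat)) (eps : R) : 0 < eps ->
  w \in level_words q L ->
  exists H : point_measure (R := R) (@strip R) -> R,
  [/\ continuous H, forall nu, 0 <= H nu <= 1,
      forall nu, 0 < H nu ->
        (forall c, c \in cells w -> (0 < pm_measure nu (cell delta s c))%E) /\
        (pm_measure nu (window M) < (size (cells w)).+1%:R%:E)%E &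
      kappa ^+ size (cells w) * expR (- M) - eps <= \int[P0]_x H (N x)].
Proof.
move=> eps0 wq; have [wL _] := extensionsP _ _ _ wq.
pose c (i : 'I_(size (cells w))) := nth (0%N, 0%N) (cells w) i.
have cw i : c i \in cells w by exact: mem_nth.
have col i : ((c i).1 < L)%N.
  rewrite -wL ltnNge; apply/negP => wi; have := cw i.
  by rewrite [c i]surjective_pairing mem_cells nth_default.
have lev i : ((c i).2 < q)%N.
  apply: (level_words_lt wq); rewrite levelsE; apply/mapP.
  by exists (c i).
have M0 : 0 <= M by rewrite mulr_ge0// ltW.
have a0 i : 0 <= (c i).1%:R * delta by rewrite mulr_ge0// ltW.
have bM i : (c i).1.+1%:R * delta <= M by rewrite ler_pM2r// ler_nat.
have c0 i : 0 <= s (c i).2 by have /andP[] := s01 (c i).2.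
have e1 i : s (c i).2.+1 <= 1 by have /andP[] := s01 (c i).2.+1.
have disj : trivIset setT (fun i => cell delta s (c i)).
  apply/trivIsetP => i j _ _ ij; apply/seteqP; split => // p [pi pj].
  have cc : c i = c j := cell_eq delta_gt0 s_mono pi pj.
  move: ij; rewrite -(inj_eq val_inj) /=.
  rewrite -(nth_uniq (0%N, 0%N) (ltn_ord i) (ltn_ord j) (uniq_cells w)).
  by rewrite -[nth _ _ i]/(c i) cc eqxx.
have etaQ i : (lebesgue_measure \x m)%E (cell delta s (c i)) = kappa%:E.
  rewrite (product_rectangle _ (s_mass (lev i))).
    by rewrite -natr1; congr (_%:E); rewrite /kappa; ring.
  by rewrite ler_pM2r// ler_nat.
have etaW := product_window M0 m01.
have [n hn] := @pattern_weight_expectation _ _ _ P0 N _ poissonN M _ _ _ _ _ kappa a0 bM c0 e1 disj etaQ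
  etaW eps eps0.
eexists; split; last exact: hn.
exact: pattern_weight_continuous.
  by move=> nu; rewrite pattern_weight_ge0 pattern_weight_le1.
move=> nu /pattern_weight_gt0[hit few]; split => // c' c'w.
have ic : (index c' (cells w) < size (cells w))%N by rewrite index_mem.
by have := hit (Ordinal ic); rewrite /c /= nth_index.
Qed.

End level_grid.

Variables (G : point_measure (R := R) (@halfline R) -> R) (C : R).
Hypotheses (cG : continuous G) (GC : forall nu, 0 <= G nu <= C).

(** A combination of the weights of the words is a continuous bounded function of the
    exceedance process. Where [f <= 1 / e] at most one weight is positive, and it forces
    the pattern of the records, hence the combination is at most [G] of the record
    process. *)
Lemma grid_lower_bound (eta : R) : 0 < eta ->
  \forall e \near 0^'+,
    \sum_(w <- level_words q L | uniq (levels w))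
      pattern_inf G delta L (records w) * (kappa ^+ occupied w * expR (- M)) - eta <=
    \int[P]_x G (record_process T f (h e) e^-1 x).
Proof.
move=> eta0; have [s [s01 s_mono s_mass]] := equal_levels m01 atomless q_gt0.
pose g w := pattern_inf G delta L (records w).
have g0 w : 0 <= g w by have /andP[] := pattern_inf_bounds GC delta L (records w).
pose ws := [seq w <- level_words q L | uniq (levels w)].
pose A := \sum_(w <- ws) g w.
have A0 : 0 <= A by apply: sumr_ge0 => w _.
pose eps := eta / 3 / (A + 1).
have eps0 : 0 < eps by rewrite !divr_gt0//; lra.
have /choice[H HP] (w : seq (option nat)) :
  exists H : point_measure (R := R) (@strip R) -> R,
  [/\ continuous H, forall nu, 0 <= H nu <= 1 &
   w \in level_words q L -> (forall nu, 0 < H nu ->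
        (forall c, c \in cells w -> (0 < pm_measure nu (cell delta s c))%E) /\
        (pm_measure nu (window M) < (size (cells w)).+1%:R%:E)%E) /\
      kappa ^+ size (cells w) * expR (- M) - eps <= \int[P0]_x H (N x)].
  case: (boolP (w \in level_words q L)) => wq.
    by have [H [? ? ? ?]] := word_function s01 s_mono s_mass eps0 wq; exists H.
  exists (fun=> 0); split => //; first by move=> nu; exact: cst_continuous.
  by move=> nu; rewrite lexx ler01.
pose Psi nu := \sum_(w <- ws) g w * H w nu.
have H0 w nu : 0 <= H w nu by have [_ /(_ nu)/andP[]] := HP w.
have H1 w nu : H w nu <= 1 by have [_ /(_ nu)/andP[]] := HP w.
have Psi0 nu : 0 <= Psi nu by apply: sumr_ge0 => w _; rewrite mulr_ge0.
have PsiA nu : Psi nu <= A by apply: ler_sum => w _; rewrite ler_piMr.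
have cH w : continuous (H w) by have [] := HP w.
have cPsi : continuous Psi.
  by apply: continuous_sum_seq => w; apply: continuousM_fun => // nu; exact: cst_continuous.
have eta3 : 0 < eta / 3 by rewrite divr_gt0.
have A1 : 0 < A + 1 by lra.
have PsiN : \sum_(w <- ws) g w * (kappa ^+ occupied w * expR (- M)) - eta / 3 <=
    \int[P0]_x Psi (N x).
  have mH w : measurable_fun setT (fun x => H w (N x)).
    have [mN _] := poissonN.
    apply: (@measurableT_comp _ _ _ _ (borel (point_measure (R := R) (@strip R))) _
      (H w) _ N) => //.
    by apply: (@continuous_borel R); exact: cH.
  have IH w : (\int[P0]_x (H w (N x))%:E)%E = (\int[P0]_x H w (N x))%:E.
    by rewrite (@RintegralE _ _ _ P0 _ 1).
  have -> : \int[P0]_x Psi (N x) = \sum_(w <- ws) g w * \int[P0]_x H w (N x).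
    rewrite /Rintegral /Psi; under eq_integral do rewrite -sumEFin.
    rewrite ge0_integral_sum//; last 2 first.
    - by move=> w; apply/measurable_EFinP; exact: measurable_funM.
    - by move=> w x _; rewrite lee_fin mulr_ge0.
    rewrite (eq_bigr (fun w => (g w * \int[P0]_x H w (N x))%:E)).
      by rewrite sumEFin.
    move=> w _; under eq_integral do rewrite EFinM.
    rewrite ge0_integralZl_EFin//; last 2 first.
    - by move=> x _; rewrite lee_fin.
    - exact/measurable_EFinP.
    by rewrite IH EFinM.
  (* The errors eps are weighted by the g w, of total A. *)
  have epsA : A * eps <= eta / 3.
    by rewrite /eps mulrCA ler_piMr ?(ltW eta3)// ler_pdivrMr ?mul1r//; lra.
  apply: (@le_trans _ _ (\sum_(w <- ws) g w * (kappa ^+ occupied w * expR (- M)) - A * eps)).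
    by rewrite lerD2l lerN2.
  rewrite /A big_distrl /= -sumrB !big_seq; apply: ler_sum => w.
  rewrite mem_filter => /andP[_ wq]; rewrite -mulrBr ler_wpM2l//.
  by have [_ _ /(_ wq)[_]] := HP w; rewrite size_cells.
have cvPsi : \int[P]_x Psi (exceedance_process T f e (h e) x) @[e --> 0^'+] -->
    \int[P0]_x Psi (N x).
  have bPsi : exists A : R, forall nu, `|Psi nu| <= A.
    by exists A => nu; rewrite ger0_norm.
  have := cvgN cPsi bPsi.
  have EP e : 'E_P[Psi \o exceedance_process T f e (h e)]%E =
      (\int[P]_x Psi (exceedance_process T f e (h e) x))%:E.
    exact: (@expectation_bounded _ _ _ P _ A (fun x => Psi0 _) (fun x => PsiA _)).
  have EN := @expectation_bounded _ _ _ P0 (Psi \o N) A (fun x => Psi0 _) (fun x => PsiA _).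
  by rewrite EN (funext EP) => /fine_cvgP[].
near=> e.
have e_gt0 : 0 < e by near: e; exact: nbhs_right_gt.
have tail : fine (P (~` [set x | f x <= e^-1])) < eta / 3 / (A + 1).
  by near: e; apply: exceedance_tail; rewrite divr_gt0.
have close : \int[P0]_x Psi (N x) - eta / 3 <
    \int[P]_x Psi (exceedance_process T f e (h e) x).
  by near: e; apply: (cvgr_gt _ cvPsi); rewrite ltrBlDr ltrDl.
have mS : measurable [set x | f x <= e^-1].
  rewrite -[X in measurable X]setTI.
  rewrite (_ : [set x | f x <= e^-1] = f @^-1` `]-oo, e^-1]).
    by apply: mf => //; exact: measurable_itv.
  by apply/seteqP; split => x; rewrite /= in_itv.
have h0 := h_gt0 e_gt0.
have restr : \int[P]_x Psi (exceedance_process T f e (h e) x) <=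
    \int[P]_x (Psi (exceedance_process T f e (h e) x) * \1_[set x | f x <= e^-1] x) +
    A * fine (P (~` [set x | f x <= e^-1])).
  exact: Rintegral_restrict.
have PsiG : \int[P]_x (Psi (exceedance_process T f e (h e) x) *
      \1_[set x | f x <= e^-1] x) <=
    \int[P]_x G (record_process T f (h e) e^-1 x).
  apply: (@le_Rintegral_lower _ _ _ P _ _ C) => x.
  - by rewrite mulr_ge0.
  - rewrite indicE; case: (boolP (x \in _)) => [/set_mem/= fx|_]; last first.
      by rewrite mulr0; have /andP[] := GC (record_process T f (h e) e^-1 x).
    rewrite mulr1; set nu := exceedance_process T f e (h e) x.
    have HE w : w \in ws -> 0 < H w nu -> exists E,
        size w = L /\ occupies (fun n => f (iter n T x)) e (h e) delta L s w E.
      rewrite mem_filter => /andP[uw wq] Hw.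
      have [wL _] := extensionsP _ _ _ wq.
      have [_ _ /(_ wq)[/(_ _ Hw)[hit few] _]] := HP w.
      by have [E oE] := occupiesP e_gt0 h0 delta_gt0 s_mono wL hit few; exists E.
    have [[w wws Hw]|none] := pselect (exists2 w, w \in ws & 0 < H w nu); last first.
      rewrite /Psi big_seq big1.
        by have /andP[] := GC (record_process T f (h e) e^-1 x).
      move=> w wws; apply/eqP; rewrite mulf_eq0; apply/orP; right.
      by rewrite eq_le H0 andbT leNgt; apply/negP => Hw; apply: none; exists w.
    have [E [wL oE]] := HE _ wws Hw.
    have uws : uniq ws.
      rewrite filter_uniq//; apply: extensions_uniq => /=.
      rewrite map_inj_uniq ?iota_uniq ?andbT; last by move=> ? ? [].
      by apply/negP => /mapP[].
    rewrite /Psi (bigD1_seq w)//= big_seq_cond big1 ?addr0 => [|w' /andP[w'ws w'w]].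
      apply: (@le_trans _ _ (g w)); first by rewrite ler_piMr.
      apply: (pattern_inf_le GC).
      have uw : uniq (levels w) by move: wws; rewrite mem_filter => /andP[].
      exact: (record_process_pattern e_gt0 h0 fx delta_gt0 s_mono wL uw oE).
    apply/eqP; rewrite mulf_eq0; apply/orP; right.
    rewrite eq_le H0 andbT leNgt; apply/negP => Hw'.
    have [E' [w'L oE']] := HE _ w'ws Hw'.
    by move: w'w; rewrite (occupies_inj delta_gt0 s_mono w'L wL oE' oE) eqxx.
  - by have /andP[] := GC (record_process T f (h e) e^-1 x).
have Atail : A * fine (P (~` [set x | f x <= e^-1])) <= eta / 3.
  apply: (@le_trans _ _ (A * (eta / 3 / (A + 1)))).
    by rewrite ler_wpM2l// ltW.
  by rewrite mulrCA ler_piMr ?(ltW eta3)// ler_pdivrMr ?mul1r//; lra.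
rewrite -big_filter -/ws.
have final (S I1 I2 I3 I4 t : R) : S - eta / 3 <= I2 -> I2 - eta / 3 < I3 ->
    I3 <= I4 + t -> I4 <= I1 -> t <= eta / 3 -> S - eta <= I1.
  by move=> *; lra.
exact: final PsiN close restr PsiG Atail.
Unshelve. all: by end_near. Qed.

End grid_lower_bound.

Lemma bernoulli_inequality {R : realType} (b : R) k : 0 <= b <= 1 -> 1 - k%:R * b <= (1 - b) ^+ k.
Proof.
move=> /andP[b0 b1]; elim: k => [|k ih]; first by rewrite mul0r subr0.
have k0 : 0 <= k%:R :> R by [].
have : 0 <= k%:R * (b * b) by rewrite mulr_ge0// mulr_ge0.
have := ler_wpM2l (_ : 0 <= 1 - b) ih.
rewrite subr_ge0 b1 exprS -natr1 => /(_ isT); lra.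
Qed.

(** The total mass is [(exp (- delta) (1 + delta))^L], and
    [exp (- delta) >= 1 - delta]. *)
Lemma word_law_mass {R : realType} (delta : R) L : 0 <= delta <= 1 ->
  1 - L%:R * delta ^+ 2 <= \sum_(y <- record_words L) word_law delta L y <= 1.
Proof.
move=> /andP[delta0 delta1].
rewrite /word_law -big_distrr /= record_law_total -[in expR _]mulNr expRM_natr -exprMn.
have e1 := expR_ge1Dx (- delta).
have e2 := expR_ge1Dx delta.
have e3 := expR_gt0 (- delta).
have le1 : expR (- delta) * (1 + delta) <= 1.
  by rewrite -[leRHS]expR0 -(addNr delta) expRD ler_wpM2l// ltW.
have ge1 : 1 - delta ^+ 2 <= expR (- delta) * (1 + delta) by nra.
rewrite exprn_ile1 ?andbT//; last by rewrite mulr_ge0 ?(ltW e3)//; lra.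
apply: le_trans (bernoulli_inequality _ _) _; last first.
  by rewrite lerXn2r// nnegrE; nra.
by rewrite sqr_ge0 expr_le1.
Qed.

Section grid_words_lower_bound.
Context {R : realType} d1 (Omega1 : measurableType d1).
Variables (P1 : probability Omega1 R).
Variables (X : nat -> {RV P1 >-> R}) (Z : nat -> {RV P1 >-> bool}).
Hypothesis lawX : forall i A, measurable A ->
  distribution P1 (X i) A = exponential_prob 1 A.
Hypothesis indepX : mutually_independent P1 (fun i => X i : Omega1 -> R).
Hypothesis lawZ : forall l A,
  distribution P1 (Z l) A = bernoulli_prob (l.+1%:R^-1 : R) A.
Hypothesis indepZ : mutually_independent P1 (fun l => Z l : Omega1 -> bool).
Hypothesis indepXZ : independent_families P1 (fun i => X i : Omega1 -> R)
  (fun l => Z l : Omega1 -> bool).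

(** The Poisson weights of the words dominate the law of the scanned limit process up
    to two errors: coinciding levels ([L^2 / q]) and the mass lost by rounding
    ([L delta^2]). *)
Lemma grid_words_lower_bound (F : seq (option bool) -> R) (C delta : R) L q :
  0 < delta <= 1 -> (0 < q)%N -> (L ^ 2 <= q)%N ->
  (forall y, 0 <= F y <= C) ->
  \int[P1]_w F (scan_word X Z delta L w) -
    C * (L%:R ^+ 2 / q%:R + L%:R * delta ^+ 2) <=
  \sum_(w <- level_words q L | uniq (levels w))
    F (records w) *
      ((delta / q%:R) ^+ occupied w * expR (- (L%:R * delta))).
Proof.
move=> /andP[delta0 delta1] q0 Lq FC; have F0 y : 0 <= F y by have /andP[] := FC y.
have C0 : 0 <= C by have /andP[h1 h2] := FC [::]; exact: le_trans h2.
have qR0 : 0 < q%:R :> R by rewrite ltr0n.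
have := scan_expectation lawX indepX lawZ indepZ indepXZ delta0 L FC.
have : 0 <= delta <= 1 by rewrite ltW.
move=> /(word_law_mass L) /andP[W0 W1].
have SC : \sum_(y <- record_words L) F y * word_law delta L y <= C.
  apply: (@le_trans _ _ (C * \sum_(y <- record_words L) word_law delta L y)).
    rewrite big_distrr /=; apply: ler_sum => y _; rewrite ler_wpM2r//.
      by rewrite mulr_ge0 ?expR_ge0// mulr_ge0 ?record_law_ge0// exprn_ge0// ltW.
    by have /andP[] := FC y.
  by rewrite ler_piMr.
move: W0 W1; move: (\sum_(y <- _) word_law _ _ _) => W W0 W1.
have := record_pattern_weight L q0 (ltW delta0) F0.
have -> : \sum_(w <- level_words q L | uniq (levels w)) F (records w) *
      ((delta / q%:R) ^+ occupied w * expR (- (L%:R * delta))) =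
    expR (- (L%:R * delta)) *
    \sum_(w <- level_words q L | uniq (levels w))
      F (records w) * (delta / q%:R) ^+ occupied w.
  by rewrite big_distrr; apply: eq_bigr => w _; rewrite mulrA mulrC.
move=> /(ler_wpM2l (expR_ge0 (- (L%:R * delta)))).
rewrite mulrCA.
have -> : expR (- (L%:R * delta)) *
    (\sum_(y <- record_words L) F y * (delta ^+ occupied y * record_law 0 y)) =
  \sum_(y <- record_words L) F y * word_law delta L y.
  rewrite big_distrr; apply: eq_bigr => y _ /=.
  by rewrite /word_law [L%:R * _]mulrC mulrCA.
move: SC; set S := \sum_(y <- record_words L) _; move=> SC lower upper.
have rho0 : 0 <= L%:R ^+ 2 / q%:R :> R by rewrite divr_ge0// exprn_ge0.
have rho1 : L%:R ^+ 2 / q%:R <= 1 :> R.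
  by rewrite ler_pdivrMr// mul1r -natrX ler_nat.
apply: le_trans lower.
have := ler_wpM2l rho0 SC.
have := ler_wpM2l C0 W0.
lra.
Qed.

End grid_words_lower_bound.

(** * Convergence of the record processes *)

Section record_convergence.
Context {R : realType} d (Omega : measurableType d) (P : probability Omega R).
Variables (T : Omega -> Omega) (f : Omega -> R) (h : R -> R).
Variables (m : probability (measurableTypeR R) R).
Variables (d0 : measure_display) (Omega0 : measurableType d0).
Variables (P0 : probability Omega0 R).
Variable N : Omega0 -> point_measure (R := R) (@strip R).
Variables (d1 : measure_display) (Omega1 : measurableType d1).
Variables (P1 : probability Omega1 R).
Variables (X : nat -> {RV P1 >-> R}) (Z : nat -> {RV P1 >-> bool}).
Hypotheses (mf : measurable_fun setT f) (h_gt0 : forall e : R, 0 < e -> 0 < h e).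
Hypotheses (m01 : m `[0, 1]%classic = 1%E) (atomless : forall y : R, m [set y] = 0%E).
Hypothesis poissonN : poisson_point_process P0 N (lebesgue_measure \x m)%E.
Hypothesis cvgN : cvg_in_distribution P
  (fun e => exceedance_process T f e (h e)) 0^'+ P0 N.
Hypothesis lawX : forall i A, measurable A ->
  distribution P1 (X i) A = exponential_prob 1 A.
Hypothesis indepX : mutually_independent P1 (fun i => X i : Omega1 -> R).
Hypothesis lawZ : forall l A,
  distribution P1 (Z l) A = bernoulli_prob (l.+1%:R^-1 : R) A.
Hypothesis indepZ : mutually_independent P1 (fun l => Z l : Omega1 -> bool).
Hypothesis indepXZ : independent_families P1 (fun i => X i : Omega1 -> R)
  (fun l => Z l : Omega1 -> bool).

Let record e x := record_process T f (h e) e^-1 x.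
Let limit w := limit_process (fun i => X i) (fun l => Z l) w.
(* The window has length L delta = n + 1, while L delta^2 = 1 / (n + 1); with
   q = (n + 1)^7 levels, L^2 / q = 1 / (n + 1) as well. *)
Let delta (n : nat) : R := n.+1%:R ^- 2.
Let L (n : nat) := (n.+1 ^ 3)%N.

Let delta_gt0 n : 0 < delta n.
Proof. by rewrite invr_gt0 exprn_gt0. Qed.

Let L_delta n : (L n)%:R * delta n = n.+1%:R.
Proof.
have : n.+1%:R != 0 :> R by rewrite pnatr_eq0.
by rewrite /L /delta natrX; move: (n.+1%:R : R) => k k0; field.
Qed.

Let delta_cvg0 : delta n @[n --> \oo] --> 0.
Proof.
rewrite (_ : delta = fun n => n.+1%:R^-1 * n.+1%:R^-1); last first.
  by apply/funext => n; rewrite /delta -exprVn expr2.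
by rewrite -[X in _ --> X](mulr0 0); apply: cvgM; exact: cvg_harmonic.
Qed.

Let window_diverges K : \forall n \near \oo, K < (L n)%:R * delta n.
Proof.
near=> n; rewrite L_delta; apply: lt_trans (truncnS_gt K) _.
rewrite ltr_nat ltnS; near: n; exact: nbhs_infty_gt.
Unshelve. all: by end_near. Qed.

Section test_function.
Variables (G : point_measure (R := R) (@halfline R) -> R) (C : R).
Hypotheses (cG : continuous G) (GC : forall nu, 0 <= G nu <= C).

Lemma record_liminf (eta : R) : 0 < eta ->
  \forall e \near 0^'+, \int[P1]_w G (limit w) - eta <= \int[P]_x G (record e x).
Proof.
move=> eta0; have C0 : 0 <= C by have /andP[h1 h2] := GC point; exact: le_trans h2.
have eta3 : 0 < eta / 3 by rewrite divr_gt0.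
have lim := @limit_expectation _ _ _ _ _ Z lawX indepX _ _ cG GC _ _
  delta_gt0 delta_cvg0 window_diverges.
have error : C * (n.+1%:R^-1 + n.+1%:R^-1) @[n --> \oo] --> (0 : R).
  rewrite -[X in _ --> X](mulr0 C) -[X in C * X](addr0 0).
  by apply: cvgMl_tmp; apply: cvgD; exact: cvg_harmonic.
have [n [close small]] : exists n,
    \int[P1]_w G (limit w) - eta / 3 <
      \int[P1]_w pattern_inf G (delta n) (L n) (scan_word X Z (delta n) (L n) w) /\
    C * (n.+1%:R^-1 + n.+1%:R^-1) < eta / 3.
  apply: (@filter_ex _ (\oo : set_system nat)); near=> n; split; near: n.
    by apply: (cvgr_gt _ lim); rewrite ltrBlDr ltrDl.
  exact: (cvgr_lt _ error).
have delta1 : 0 < delta n <= 1.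
  rewrite delta_gt0 invf_le1 ?exprn_gt0//.
  by rewrite exprn_ege1// ler1n.
have q0 : (0 < n.+1 ^ 7)%N by rewrite expn_gt0.
have Lq : (L n ^ 2 <= n.+1 ^ 7)%N by rewrite /L -expnM leq_pexp2l.
have := grid_words_lower_bound lawX indepX lawZ indepZ indepXZ delta1 q0 Lq
  (pattern_inf_bounds GC (delta n) (L n)).
have -> : (L n)%:R ^+ 2 / (n.+1 ^ 7)%:R + (L n)%:R * delta n ^+ 2 =
    n.+1%:R^-1 + n.+1%:R^-1 :> R.
  have : n.+1%:R != 0 :> R by rewrite pnatr_eq0.
  by rewrite /L /delta !natrX; move: (n.+1%:R : R) => k k0; field.
move=> words.
have := grid_lower_bound mf h_gt0 m01 atomless poissonN cvgN (L n)
  (delta_gt0 n) q0 GC eta3.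
apply: filterS => e grid.
have final (I1 I2 I S r : R) : I - r <= S -> I1 - eta / 3 < I -> r < eta / 3 ->
    S - eta / 3 <= I2 -> I1 - eta <= I2 by move=> *; lra.
exact: final words close small grid.
Unshelve. all: by end_near. Qed.

(** Lower integrals need not be additive, but [G] of the limit process is almost surely
    a limit of measurable functions. *)
Lemma limit_complement :
  \int[P1]_w G (limit w) + \int[P1]_w (C - G (limit w)) = C.
Proof.
pose u n w := pattern_inf G (delta n) (L n) (scan_word X Z (delta n) (L n) w).
have [A [mA A0 AP]] := gaps_diverge lawX indepX.
have mu n : measurable_fun setT (u n).
  apply: (@scan_measurable _ _ _ _ (fun i => X i) (fun l => Z l)) => i;
    exact: measurable_funPT.
have uC n w : 0 <= u n w <= C by exact: pattern_inf_bounds.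
have ul w : A w -> u n w @[n --> \oo] --> G (limit w).
  move=> /AP[x0 xoo].
  exact: (@pattern_inf_cvg _ G C cG GC (X ^~ w) (Z ^~ w) _ _ x0 xoo
    delta_gt0 delta_cvg0 window_diverges).
have cvg1 : \int[P1]_w u n w @[n --> \oo] --> \int[P1]_w G (limit w).
  by apply: (@Rintegral_cvg_ae _ _ _ P1 _ _ C A).
have cvg2 : \int[P1]_w (C - u n w) @[n --> \oo] --> \int[P1]_w (C - G (limit w)).
  apply: (@Rintegral_cvg_ae _ _ _ P1 _ _ C A) => //.
  - by move=> n; apply: measurable_funB => //; exact: measurable_cst.
  - by move=> n w; have /andP[? ?] := uC n w; rewrite subr_ge0 gerBl; apply/andP.
  - by move=> w; have /andP[? ?] := GC (limit w); rewrite subr_ge0 gerBl; apply/andP.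
  - by move=> w Aw; apply: cvgB; [exact: cvg_cst|exact: ul].
have sumC n : \int[P1]_w u n w + \int[P1]_w (C - u n w) = C.
  have u0 w : 0 <= u n w by have /andP[] := uC n w.
  have v0 w : 0 <= C - u n w by have /andP[] := uC n w; rewrite subr_ge0.
  apply: EFin_inj; rewrite EFinD (@RintegralE _ _ _ P1 _ C)//; last first.
    by move=> w; have /andP[] := uC n w.
  rewrite (@RintegralE _ _ _ P1 _ C)//; last first.
    by move=> w; have /andP[? ?] := uC n w; rewrite gerBl.
  rewrite -ge0_integralD//.
  - under eq_integral do rewrite -EFinD addrC subrK.
    by rewrite integral_cst// [X in (_ * X)%E]probability_setT mule1.
  - by move=> w _; rewrite lee_fin.
  - exact/measurable_EFinP.
  - by move=> w _; rewrite lee_fin.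
  - by apply/measurable_EFinP; apply: measurable_funB => //; exact: measurable_cst.
have cvgC : (\int[P1]_w u n w + \int[P1]_w (C - u n w)) @[n --> \oo] -->
    \int[P1]_w G (limit w) + \int[P1]_w (C - G (limit w)) by exact: cvgD.
move: cvgC; under eq_fun do rewrite sumC.
by move=> cvgC; apply: (cvg_unique (@Rhausdorff R) cvgC); exact: cvg_cst.
Qed.

End test_function.

(** The lower bound for [C - G] bounds the expectations of [G] from above, since the
    lower integrals of [G] and [C - G] of the record process add up to at most [C]. *)
Lemma record_integral_cvg (G : point_measure (R := R) (@halfline R) -> R) (C : R) :
  continuous G -> (forall nu, 0 <= G nu <= C) ->
  \int[P]_x G (record e x) @[e --> 0^'+] --> \int[P1]_w G (limit w).
Proof.
move=> cG GC; have GC' nu : 0 <= C - G nu <= C.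
  by have /andP[? ?] := GC nu; rewrite subr_ge0 gerBl; apply/andP.
have cG' : continuous (fun nu => C - G nu).
  by apply: continuousB_fun => // nu; exact: cst_continuous.
have total := limit_complement cG GC.
apply/cvgrPdist_le => eta eta0; near=> e.
have low : \int[P1]_w G (limit w) - eta <= \int[P]_x G (record e x).
  by near: e; exact: (record_liminf cG GC).
have high : \int[P1]_w (C - G (limit w)) - eta <= \int[P]_x (C - G (record e x)).
  by near: e; exact: (record_liminf cG' GC').
have sumC : \int[P]_x G (record e x) + \int[P]_x (C - G (record e x)) <= C.
  have GCid x : G (record e x) + (C - G (record e x)) <= C by rewrite addrC subrK.
  apply: le_trans (@Rintegral_superadditive _ _ _ P _ _ C _ _ GCid) _.
  - by move=> x; have /andP[] := GC (record e x).
  - by move=> x; have /andP[] := GC' (record e x).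
  have C0 : 0 <= C by have /andP[h1 h2] := GC point; exact: le_trans h2.
  rewrite -lee_fin (@RintegralE _ _ _ P _ C) => [|x|x].
  - by apply: integral_bounded => x; rewrite addrC subrK.
  - by rewrite addrC subrK.
  - by rewrite addrC subrK.
rewrite ler_norml; move: total low high sumC.
move: (\int[P1]_w _) (\int[P1]_w _) (\int[P]_x _) (\int[P]_x _) => I1 I2 I3 I4.
lra.
Unshelve. all: by end_near. Qed.

Lemma expectation_cvg (G : point_measure (R := R) (@halfline R) -> R) (C : R) :
  continuous G -> (forall nu, `|G nu| <= C) ->
  'E_P[G \o record e]%E @[e --> 0^'+] --> 'E_P1[G \o limit]%E.
Proof.
move=> cG GC; pose Gp nu := Num.max (G nu) 0; pose Gm nu := Num.max (- G nu) 0.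
have C0 : 0 <= C by exact: le_trans (GC point).
have GpC nu : 0 <= Gp nu <= C.
  rewrite le_max lexx orbT ge_max C0 andbT.
  exact: le_trans (ler_norm _) (GC nu).
have GmC nu : 0 <= Gm nu <= C.
  rewrite le_max lexx orbT ge_max C0 andbT.
  by apply: le_trans (ler_norm _) _; rewrite normrN.
have cmax (F : point_measure (R := R) (@halfline R) -> R) : continuous F ->
    continuous (fun nu => Num.max (F nu) 0).
  by move=> cF nu; apply: continuous_max; [exact: cF|exact: cst_continuous].
have E d' (O : measurableType d') (Q : probability O R)
    (Y : O -> point_measure (R := R) (@halfline R)) :
    'E_Q[G \o Y]%E = (\int[Q]_w Gp (Y w) - \int[Q]_w Gm (Y w))%:E.
  rewrite unlock integralE EFinB.
  have Gp0 w : 0 <= Gp (Y w) by have /andP[] := GpC (Y w).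
  have Gm0 w : 0 <= Gm (Y w) by have /andP[] := GmC (Y w).
  rewrite (@RintegralE _ _ _ Q _ C)//; last by move=> w; have /andP[] := GpC (Y w).
  rewrite (@RintegralE _ _ _ Q _ C)//; last by move=> w; have /andP[] := GmC (Y w).
  by congr (_ - _)%E; apply: eq_integral => w _;
    rewrite ?funeposE ?funenegE /= ?EFin_max// -EFinN -EFin_max.
rewrite E; under eq_fun do rewrite E.
apply: cvg_EFin; first exact: nearW.
apply: cvgB; first exact: (record_integral_cvg (cmax _ cG) GpC).
apply: (record_integral_cvg _ GmC); apply: cmax.
rewrite (_ : (fun nu => - G nu) = fun nu => 0 - G nu); last first.
  by apply/funext => nu; rewrite sub0r.
by apply: continuousB_fun => // nu; exact: cst_continuous.
Qed.

End record_convergence.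

Theorem proposition4p1 (R : realType)
    (d : measure_display) (Omega : measurableType d)
    (mu : probability Omega R) (T : Omega -> Omega) (f : Omega -> R)
    (h : R -> R) (P : probability Omega R)
    (m : probability (measurableTypeR R) R)
    (d0 : measure_display) (Omega0 : measurableType d0)
    (P0 : probability Omega0 R)
    (N : Omega0 -> point_measure (R := R) (@strip R))
    (d1 : measure_display) (Omega1 : measurableType d1)
    (P1 : probability Omega1 R)
    (X : nat -> {RV P1 >-> R}) (Z : nat -> {RV P1 >-> bool}) :
  measure_preserving mu T ->
  measurable_fun setT f -> (forall x, 0 <= f x) ->
  (forall e : R, 0 < e -> 0 < h e) ->
  m `[0, 1]%classic = 1%E -> (forall y : R, m [set y] = 0%E) ->
  poisson_point_process P0 N (lebesgue_measure \x m)%E ->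
  cvg_in_distribution P (fun e => exceedance_process T f e (h e)) 0^'+ P0 N ->
  (forall i A, measurable A ->
     distribution P1 (X i) A = exponential_prob 1 A) ->
  mutually_independent P1 (fun i => X i : Omega1 -> R) ->
  (forall l A, distribution P1 (Z l) A = bernoulli_prob (l.+1%:R^-1 : R) A) ->
  mutually_independent P1 (fun l => Z l : Omega1 -> bool) ->
  independent_families P1 (fun i => X i : Omega1 -> R)
    (fun l => Z l : Omega1 -> bool) ->
  cvg_in_distribution P (fun e => record_process T f (h e) e^-1) 0^'+
    P1 (limit_process (fun i => X i) (fun l => Z l)).
Proof.
move=> _ mf _ h_gt0 m01 atomless poissonN cvgN lawX indepX lawZ indepZ indepXZ.
move=> G cG [C GC].
exact: (expectation_cvg mf h_gt0 m01 atomless poissonN cvgN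
  lawX indepX lawZ indepZ indepXZ cG GC).
Qed.
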